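(* Let $K$ be a countable field of characteristic $p$, let $U$ be a coherent good set of valuations on $K$, and let $K_0\subseteq K$ be the field of constants of $U$. Let $\phi:A\to K\{\tau\}$ be a Drinfeld module of positive relative modular transcendence degree over $K_0$. Then $\phi(K^{\mathrm{per}})$ is the direct sum of a finite torsion $A$-submodule and a free $A$-submodule of rank $\aleph_0$, where $K^{\mathrm{per}}$ is the perfect closure of $K$.
   Context: Setting: $p$ prime, $q$ a power of $p$, $A$ the ring of functions on a nonsingular projective curve over $\mathbb{F}_q$ regular away from a fixed closed point; $K\supseteq\mathbb{F}_q$. $K\{\tau\}$ twisted polynomials with $\tau(x)=x^q$. A Drinfeld module $\phi:A\to K\{\tau\}$ is a ring morphism with $\tau^0$-coefficient of $\phi_a$ equal to $i(a)$ (fixed $i:A\to K$), not all $\phi_a$ of degree $0$ in $\tau$. $\phi(L)$ is $L$ with $A$-action $a\cdot x=\phi_a(x)$. Field of definition: smallest field containing all coefficients of all $\phi_a$; $\phi^{(\gamma)}_a=\gamma^{-1}\phi_a\gamma$; relative modular transcendence degree over $K_0$: minimum over $\gamma\in K^{\mathrm{alg}}\setminus\{0\}$ of the transcendence degree over $K_0$ of the compositum of $K_0$ and the field of definition of $\phi^{(\gamma)}$. Valuations discrete, normalized with value group $\mathbb{Z}$. Good set of valuations: set $U$ with degrees $d:U\to\mathbb{R}_{>0}$, each nonzero $x$ has $v(x)\ne0$ for finitely many $v$, and $\sum_{v\in U}d(v)v(x)=0$; field of constants $\{0\}\cup\{x:v(x)=0\,\forall v\in U\}$. $v$ coherent: $\sum_{w|v}e(w|v)f(w|v)=[L:K]$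 for all finite $L/K$, with $d(w)=f(w|v)d(v)/[L:K]$; $U$ coherent: all its valuations coherent and for every finite $L/K$ the set of extensions is a good set on $L$. *)

(* Defs.v *)
From HB Require Import structures.
From mathcomp Require Import all_boot all_order all_algebra all_field.
From mathcomp Require mpoly.
Import (canonicals) mpoly.
From mathcomp Require Import boolp classical_sets functions cardinality fsbigop.
From mathcomp Require Import reals.

Set Implicit Arguments.
Unset Strict Implicit.
Unset Printing Implicit Defensive.

Import Order.TTheory GRing.Theory Num.Theory.

Local Open Scope classical_set_scope.
Local Open Scope ring_scope.

(* Discrete valuations are normalized (value group [int]).  The value at [0],
   conventionally +oo, is encoded by the junk value [0]; fixing it makes equality
   of functions the same as equality of valuations, and [0 <= v x] describes
   the valuation ring, [0] included. *)
Definition is_valuation (F : fieldType) (v : F -> int) : Prop :=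
  [/\ v 0 = 0,
      forall x y, x != 0 -> y != 0 -> v (x * y) = v x + v y,
      forall x y, x != 0 -> y != 0 -> x + y != 0 ->
        Num.min (v x) (v y) <= v (x + y)
    & forall n : int, exists2 x, x != 0 & v x = n].

(* The sum has finite support by the third condition. *)
Definition good_set (R : realType) (F : fieldType)
    (U : set (F -> int)) (d : (F -> int) -> R) : Prop :=
  [/\ forall v, U v -> is_valuation v,
      forall v, U v -> 0 < d v,
      forall x : F, x != 0 -> finite_set (U `&` [set v | v x != 0])
    & forall x : F, x != 0 -> \sum_(v \in U) d v * (v x)%:~R = 0].

Definition constants (F : fieldType) (U : set (F -> int)) : set F :=
  [set 0] `|` [set x | x != 0 /\ forall v, U v -> v x = 0].

Section Extensions.
Variables (K : fieldType) (L : fieldExtType K).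
Implicit Types (v : K -> int) (w : L -> int).

(* As [w] is normalized, the value group of its restriction to [K] is [e * int],
   where [e] is the ramification index. *)
Definition has_ramification v w (e : nat) : Prop :=
  (0 < e)%N /\ forall x : K, w x%:A = e%:Z * v x.

Definition lies_over w v : Prop :=
  is_valuation w /\ exists e, has_ramification v w e.

Definition ramification w v : nat := xget 0%N [set e | has_ramification v w e].

Definition in_maximal_ideal (F : fieldType) (v : F -> int) (x : F) : Prop :=
  x = 0 \/ 0 < v x.

(* The residue classes of the [b i] form a basis of the residue field of [w]
   over that of [v]. *)
Definition residue_basis v w (n : nat) (b : 'I_n -> L) : Prop :=
  [/\ forall i, 0 <= w (b i),
      forall c : 'I_n -> K, (forall i, 0 <= v (c i)) ->
        in_maximal_ideal w (\sum_i c i *: b i) ->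
        forall i, in_maximal_ideal v (c i)
    & forall y, 0 <= w y -> exists2 c : 'I_n -> K, forall i, 0 <= v (c i) &
        in_maximal_ideal w (y - \sum_i c i *: b i)].

Definition residue_degree w v : nat :=
  xget 0%N [set n | exists b : 'I_n -> L, residue_basis v w b].

Definition extensions (U : set (K -> int)) : set (L -> int) :=
  [set w | exists2 v, U v & lies_over w v].

(* For [w] in [extensions U], the valuation of [U] below [w] is unique. *)
Definition extended_degree (R : realType) (U : set (K -> int))
    (d : (K -> int) -> R) (w : L -> int) : R :=
  let v := xget (fun=> 0) [set v | U v /\ lies_over w v] in
  (residue_degree w v)%:R * d v / (\dim {:L})%:R.

End Extensions.

Definition coherent_valuation (K : fieldType) (v : K -> int) : Prop :=
  forall L : fieldExtType K,
    \sum_(w \in [set w : L -> int | lies_over w v])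
      (ramification w v * residue_degree w v)%N = \dim {:L}.

Definition coherent_set (R : realType) (K : fieldType)
    (U : set (K -> int)) (d : (K -> int) -> R) : Prop :=
  (forall v, U v -> coherent_valuation v) /\
  forall L : fieldExtType K, good_set (@extensions K L U) (extended_degree U d).

Section Subfields.
Variable F : fieldType.
Implicit Types k E B : set F.

Definition subfield_generated B : set F :=
  smallest [set E : set F | GRing.divring_closed (mem E)] B.

Definition algebraic_over k (x : F) : Prop :=
  exists2 P : {poly F}, P != 0 & (forall i, k P`_i) /\ root P x.

Definition algebraically_independent k B : Prop :=
  forall (n : nat) (x : 'I_n -> F), injective x -> (forall i, B (x i)) ->
  forall P : mpoly.mpoly n F, (forall m, k (mpoly.mcoeff m P)) ->
    mpoly.meval x P = 0 -> P = 0.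

Definition transcendence_basis k E B : Prop :=
  [/\ B `<=` E, algebraically_independent k B
    & forall x, E x -> algebraic_over (subfield_generated (k `|` B)) x].

Definition has_trdeg k E (n : nat) : Prop :=
  exists2 B, transcendence_basis k E B & (B #= `I_n)%card.

End Subfields.

(* Nonsingular projective curves over [Fq] correspond to their function fields,
   the finitely generated extensions of transcendence degree 1, and closed
   points to the normalized discrete valuations (all of which are trivial on
   the finite field [Fq]). *)
Definition is_function_field (Fq : finFieldType) (F : fieldType)
    (jF : {rmorphism Fq -> F}) : Prop :=
  (exists S : seq F, subfield_generated (range jF `|` [set` S]) = [set: F]) /\
  has_trdeg (range jF) [set: F] 1.

Section CurveRing.
Variables (F : fieldType) (oo : F -> int).

Definition regular_away : {pred F} :=
  [pred f | `[< forall v, is_valuation v -> v <> oo -> 0 <= v f >]].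

Lemma valuation1 v : is_valuation v -> v (1 : F) = 0.
Proof.
case=> _ vM _ _; apply: (@addrI _ (v 1)).
by rewrite -vM ?oner_neq0 // mulr1 addr0.
Qed.

Lemma valuationN1 v : is_valuation v -> v (-1 : F) = 0.
Proof.
move=> vv; have [_ vM _ _] := vv.
have N1 : (-1 : F) != 0 by rewrite oppr_eq0 oner_neq0.
have := vM _ _ N1 N1; rewrite mulrNN mulr1 valuation1 //= => /esym/eqP.
by rewrite -mulr2n mulrn_eq0 => /eqP.
Qed.

Lemma regular_away_subring : subring_closed regular_away.
Proof.
split=> [|f g|f g].
- by apply/asboolP => v vv _; rewrite valuation1.
- move=> /asboolP fA /asboolP gA; apply/asboolP => v vv voo.
  have [v0 vM vD _] := vv; have {fA gA} [vf vg] := (fA v vv voo, gA v vv voo).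
  have vN x : v (- x) = v x.
    have [->|x0] := eqVneq x 0; first by rewrite oppr0.
    by rewrite -mulN1r vM ?oppr_eq0 ?oner_neq0 // valuationN1 // add0r.
  have [->|f0] := eqVneq f 0; first by rewrite sub0r vN.
  have [->|g0] := eqVneq g 0; first by rewrite subr0.
  have [->|fg0] := eqVneq (f - g) 0; first by rewrite v0.
  by apply: le_trans (vD _ _ f0 _ fg0); rewrite ?oppr_eq0 // le_min vf vN.
- move=> /asboolP fA /asboolP gA; apply/asboolP => v vv voo.
  have [v0 vM _ _] := vv; have {fA gA} [vf vg] := (fA v vv voo, gA v vv voo).
  have [->|f0] := eqVneq f 0; first by rewrite mul0r v0.
  have [->|g0] := eqVneq g 0; first by rewrite mulr0 v0.
  by rewrite vM // addr_ge0.
Qed.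

HB.instance Definition _ :=
  GRing.isSubringClosed.Build F regular_away regular_away_subring.

(* The ring of functions regular away from the closed point [oo]. *)
Record curve_ring := CurveRing {
  curve_fun :> F;
  curve_funP : curve_fun \in regular_away }.

HB.instance Definition _ := [isSub for curve_fun].
HB.instance Definition _ := [Choice of curve_ring by <:].
HB.instance Definition _ := [SubChoice_isSubComNzRing of curve_ring by <:].

End CurveRing.

(* [K{tau}], [tau x = x ^+ q] with [q = #|Fq|].  The twisted polynomial
   [\sum_i a_i tau^i] is represented by [\sum_i a_i *: 'X^i]; only the
   multiplication differs from that of [{poly K}]. *)
Definition twpoly (Fq : finFieldType) (K : fieldType)
  (j : {rmorphism Fq -> K}) : Type := {poly K}.

Section TwistedPolynomials.
Variables (Fq : finFieldType) (K : fieldType) (j : {rmorphism Fq -> K}).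
Local Notation q := #|Fq|.

HB.instance Definition _ := GRing.Zmodule.copy (twpoly j) {poly K}.

Lemma frobD (x y : K) i : (x + y) ^+ (q ^ i) = x ^+ (q ^ i) + y ^+ (q ^ i).
Proof.
have [p pr_p chp] := finPcharP Fq.
apply: exprDn_pchar.
rewrite pnatX (eq_pnat _ (pcharf_eq (rmorph_pchar j chp))).
have -> // : p.-nat q.
by rewrite (card_pprimeChar chp) pnatX pnat_id.
Qed.

Lemma q_gt0 i : (0 < q ^ i)%N.
Proof. by rewrite expn_gt0; apply/orP; left; apply/card_gt0P; exists 0. Qed.

Lemma frob0 i : (0 : K) ^+ (q ^ i) = 0.
Proof. by rewrite expr0n eqn0Ngt q_gt0. Qed.

Lemma frob_sum I (r : seq I) (P : pred I) (f : I -> K) i :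
  (\sum_(k <- r | P k) f k) ^+ (q ^ i) = \sum_(k <- r | P k) f k ^+ (q ^ i).
Proof. by apply: (big_morph (fun x => x ^+ (q ^ i)) (fun x y => frobD x y i) (frob0 i)). Qed.

Definition twmul (f g : {poly K}) : {poly K} :=
  \sum_(m < size f) \sum_(n < size g) (f`_m * g`_n ^+ (q ^ m)) *: 'X^(m + n).

Lemma twmul_widen M N (f g : {poly K}) : (size f <= M)%N -> (size g <= N)%N ->
  twmul f g = \sum_(m < M) \sum_(n < N) (f`_m * g`_n ^+ (q ^ m)) *: 'X^(m + n).
Proof.
move=> fM gN; rewrite /twmul.
have sg m : \sum_(n < size g) (f`_m * g`_n ^+ (q ^ m)) *: 'X^(m + n) =
            \sum_(n < N) (f`_m * g`_n ^+ (q ^ m)) *: 'X^(m + n).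
  rewrite (big_ord_widen N (fun n => (f`_m * g`_n ^+ (q ^ m)) *: 'X^(m + n))) //.
  rewrite big_mkcond /=; apply: eq_bigr => n _; case: ltnP => // h.
  by rewrite (nth_default 0 h) frob0 mulr0 scale0r.
under eq_bigr => m _ do rewrite sg.
rewrite (big_ord_widen M (fun m => \sum_(n < N) (f`_m * g`_n ^+ (q ^ m)) *: 'X^(m + n))) //.
rewrite big_mkcond /=; apply: eq_bigr => m _; case: ltnP => // h.
by rewrite big1 // => n _; rewrite (nth_default 0 h) mul0r scale0r.
Qed.

Lemma twmulDl : left_distributive twmul +%R.
Proof.
move=> f g h; set N := maxn (size f) (size g).
have sD : (size (f + g)%R <= N)%N by apply: size_polyD.
rewrite !(@twmul_widen N (size h)) ?leq_maxl ?leq_maxr // -big_split /=.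
apply: eq_bigr => m _; rewrite -big_split; apply: eq_bigr => n _ /=.
by rewrite coefD mulrDl scalerDl.
Qed.

Lemma twmulDr : right_distributive twmul +%R.
Proof.
move=> h f g; set N := maxn (size f) (size g).
have sD : (size (f + g)%R <= N)%N by apply: size_polyD.
rewrite !(@twmul_widen (size h) N) ?leq_maxl ?leq_maxr // -big_split /=.
apply: eq_bigr => m _; rewrite -big_split; apply: eq_bigr => n _ /=.
by rewrite coefD frobD mulrDr scalerDl.
Qed.

Lemma twmul_monomial a b m n :
  twmul (a *: 'X^m) (b *: 'X^n) = (a * b ^+ (q ^ m)) *: 'X^(m + n).
Proof.
rewrite (@twmul_widen m.+1 n.+1); last 2 first.
- by rewrite (leq_trans (size_scale_leq _ _)) // size_polyXn.
- by rewrite (leq_trans (size_scale_leq _ _)) // size_polyXn.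
rewrite big_ord_recr /= big1 ?add0r => [|i _]; last first.
  rewrite big1 // => k _.
  by rewrite coefZ coefXn ltn_eqF // mulr0 mul0r scale0r.
rewrite big_ord_recr /= big1 ?add0r => [|k _]; last first.
  by rewrite !coefZ !coefXn (ltn_eqF (ltn_ord k)) [b * _]mulr0 frob0 mulr0 scale0r.
by rewrite !coefZ !coefXn !eqxx !mulr1.
Qed.

Lemma poly_monomials (f : {poly K}) : f = \sum_(m < size f) f`_m *: 'X^m.
Proof. by rewrite -[LHS]coefK poly_def. Qed.

Lemma biadditive_assoc (mul : {poly K} -> {poly K} -> {poly K}) :
  left_distributive mul +%R -> right_distributive mul +%R ->
  (forall a b c m n k, mul (a *: 'X^m) (mul (b *: 'X^n) (c *: 'X^k)) =
                       mul (mul (a *: 'X^m) (b *: 'X^n)) (c *: 'X^k)) ->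
  associative mul.
Proof.
move=> mulDl mulDr mulA.
have mul0l g : mul 0 g = 0.
  by apply: (addrI (mul 0 g)); rewrite -mulDl !addr0.
have mul0r g : mul g 0 = 0.
  by apply: (addrI (mul g 0)); rewrite -mulDr !addr0.
have suml n (F : 'I_n -> {poly K}) g :
    mul (\sum_k F k) g = \sum_k mul (F k) g.
  by apply: (big_morph (mul^~ g) (fun x y => mulDl x y g) (mul0l g)).
have sumr n (F : 'I_n -> {poly K}) g :
    mul g (\sum_k F k) = \sum_k mul g (F k).
  by apply: (big_morph (mul g) (mulDr g) (mul0r g)).
move=> f g h; rewrite (poly_monomials f) !suml; apply: eq_bigr => m _.
rewrite (poly_monomials g) suml !sumr suml; apply: eq_bigr => n _.
by rewrite (poly_monomials h) !sumr; apply: eq_bigr => k _; apply: mulA.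
Qed.

Lemma twmulA : associative twmul.
Proof.
apply: biadditive_assoc twmulDl twmulDr _ => a b c m n k.
by rewrite !twmul_monomial exprMn -exprM -expnD addnA mulrA (addnC m n).
Qed.

Lemma twmul1l : left_id 1 twmul.
Proof.
move=> f; rewrite (@twmul_widen 1 (size f)) ?size_poly1 // big_ord1.
rewrite [RHS]poly_monomials; apply: eq_bigr => n _.
by rewrite coef1 mul1r expn0 expr1.
Qed.

Lemma twmul1r : right_id 1 twmul.
Proof.
move=> f; rewrite (@twmul_widen (size f) 1) ?size_poly1 //.
rewrite [RHS]poly_monomials; apply: eq_bigr => m _.
by rewrite big_ord1 coef1 expr1n mulr1 addn0.
Qed.

HB.instance Definition _ := GRing.Zmodule_isNzRing.Build (twpoly j)
  twmulA twmul1l twmul1r twmulDl twmulDr (oner_neq0 {poly K}).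

Definition twcoef (f : twpoly j) (n : nat) : K := (f : {poly K})`_n.

Definition twconst (c : K) : twpoly j := c%:P.

End TwistedPolynomials.

Definition twmap (Fq : finFieldType) (K L : fieldType) (j : {rmorphism Fq -> K})
  (e : {rmorphism K -> L}) (f : twpoly j) : twpoly (e \o j) := map_poly e f.

Section Drinfeld.
Variables (Fq : finFieldType) (K : fieldType) (j : {rmorphism Fq -> K}).
Variable A : comNzRingType.
Implicit Type phi : {rmorphism A -> twpoly j}.

Definition is_drinfeld_module (i : {rmorphism A -> K}) phi : Prop :=
  (forall a, twcoef (phi a) 0 = i a) /\
  exists a n, (0 < n)%N /\ twcoef (phi a) n != 0.

Definition tweval (L : fieldType) (e : {rmorphism K -> L}) (f : twpoly j)
    (x : L) : L :=
  \sum_(n < size (f : {poly K})) e (twcoef f n) * x ^+ (#|Fq| ^ n).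

(* [phi(L)]: the additive group of the extension [L] of [K] with [A] acting
   through [phi]. *)
Definition drinfeld_points (L : fieldType) phi (e : {rmorphism K -> L}) : Type := L.

Section Points.
Variables (L : fieldType) (phi : {rmorphism A -> twpoly j}).
Variable e : {rmorphism K -> L}.

HB.instance Definition _ := GRing.Zmodule.copy (drinfeld_points phi e) L.

Lemma tweval_widen N (f : twpoly j) x : (size (f : {poly K}) <= N)%N ->
  tweval e f x = \sum_(n < N) e (twcoef f n) * x ^+ (#|Fq| ^ n).
Proof.
move=> fN; rewrite /tweval.
rewrite (big_ord_widen N (fun n => e (twcoef f n) * x ^+ (#|Fq| ^ n))) //.
rewrite big_mkcond /=; apply: eq_bigr => m _; case: ltnP => // h.
by rewrite /twcoef nth_default // rmorph0 mul0r.
Qed.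

Lemma twevalDl x : {morph (tweval e)^~ x : f g / f + g >-> f + g}.
Proof.
move=> f g; set N := maxn (size (f : {poly K})) (size (g : {poly K})).
have sD : (size ((f : {poly K}) + g)%R <= N)%N by apply: size_polyD.
rewrite !(@tweval_widen N) ?leq_maxl ?leq_maxr // -big_split /=.
by apply: eq_bigr => m _; rewrite /twcoef coefD rmorphD mulrDl.
Qed.

Lemma tweval0 x : tweval e 0 x = 0.
Proof. by apply: (addrI (tweval e 0 x)); rewrite -twevalDl !addr0. Qed.

Lemma twevalDr f : {morph tweval e f : x y / x + y}.
Proof.
move=> x y; rewrite /tweval -big_split /=; apply: eq_bigr => m _.
by rewrite (frobD (e \o j)) mulrDr.
Qed.

Lemma tweval_sum I (r : seq I) (f : I -> twpoly j) x :
  tweval e (\sum_(k <- r) f k) x = \sum_(k <- r) tweval e (f k) x.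
Proof. by apply: (big_morph ((tweval e)^~ x) (twevalDl x) (tweval0 x)). Qed.

Lemma tweval_monomial a n x :
  tweval e (a *: 'X^n : {poly K}) x = e a * x ^+ (#|Fq| ^ n).
Proof.
rewrite (@tweval_widen n.+1); last first.
  by rewrite (leq_trans (size_scale_leq _ _)) // size_polyXn.
rewrite big_ord_recr /= big1 ?add0r => [|i _].
  by rewrite /twcoef coefZ coefXn eqxx mulr1.
by rewrite /twcoef coefZ coefXn ltn_eqF // mulr0 rmorph0 mul0r.
Qed.

Lemma twevalM (f g : twpoly j) x :
  tweval e (f * g) x = tweval e f (tweval e g x).
Proof.
rewrite -[f * g]/(twmul Fq f g) /twmul [LHS]tweval_sum [RHS]/tweval.
apply: eq_bigr => m _.
rewrite [LHS]tweval_sum [tweval e g x]/tweval (frob_sum (e \o j)) mulr_sumr.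
apply: eq_bigr => n _; rewrite tweval_monomial rmorphM rmorphXn.
by rewrite exprMn -exprM -expnD (addnC n) mulrA.
Qed.

Lemma tweval1 x : tweval e 1 x = x.
Proof.
have -> : 1 = (1 *: 'X^0 : {poly K}) :> twpoly j by rewrite scale1r expr0.
by rewrite tweval_monomial rmorph1 mul1r expn0 expr1.
Qed.

Definition drinfeld_scale (a : A) (x : drinfeld_points phi e) :
  drinfeld_points phi e := tweval e (phi a) x.

Fact drinfeld_scaleA a b x :
  drinfeld_scale a (drinfeld_scale b x) = drinfeld_scale (a * b) x.
Proof. by rewrite /drinfeld_scale rmorphM twevalM. Qed.

Fact drinfeld_scale1 : left_id 1 drinfeld_scale.
Proof. by move=> x; rewrite /drinfeld_scale rmorph1 tweval1. Qed.

Fact drinfeld_scaleDr : right_distributive drinfeld_scale +%R.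
Proof. by move=> a x y; apply: twevalDr. Qed.

Fact drinfeld_scaleDl x : {morph drinfeld_scale^~ x : a b / a + b}.
Proof. by move=> a b; rewrite /drinfeld_scale rmorphD twevalDl. Qed.

HB.instance Definition _ := GRing.Zmodule_isLmodule.Build A (drinfeld_points phi e)
  drinfeld_scaleA drinfeld_scale1 drinfeld_scaleDr drinfeld_scaleDl.

End Points.

Section ModularDegree.
Variables (Ka : fieldType) (ja : {rmorphism K -> Ka}).
Variable phi : {rmorphism A -> twpoly j}.

(* [phi^(gamma)_a = gamma^-1 phi_a gamma], a product in [Ka{tau}]. *)
Definition conjugate (gamma : Ka) (a : A) : twpoly (ja \o j) :=
  twconst _ gamma^-1 * twmap ja (phi a) * twconst _ gamma.

Definition field_of_definition (psi : A -> twpoly (ja \o j)) : set Ka :=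
  subfield_generated [set c | exists a n, c = twcoef (psi a) n].

Definition compositum (E1 E2 : set Ka) : set Ka := subfield_generated (E1 `|` E2).

Definition has_conjugate_trdeg (K0 : set K) (gamma : Ka) (n : nat) : Prop :=
  has_trdeg (ja @` K0)
    (compositum (ja @` K0) (field_of_definition (conjugate gamma))) n.

(* [n] is the minimum of the transcendence degrees of the conjugates of [phi].
   These are all finite when [A] is a finitely generated ring. *)
Definition relative_modular_trdeg (K0 : set K) (n : nat) : Prop :=
  (exists2 gamma, gamma != 0 & has_conjugate_trdeg K0 gamma n) /\
  forall gamma m, gamma != 0 -> has_conjugate_trdeg K0 gamma m -> (n <= m)%N.

End ModularDegree.
End Drinfeld.

Definition is_algebraic_closure (K : fieldType) (Ka : closedFieldType)
  (ja : {rmorphism K -> Ka}) : Prop := forall x, algebraicOver ja x.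

Definition is_perfect_closure (p : nat) (K L : fieldType)
    (e : {rmorphism K -> L}) : Prop :=
  (forall x : L, exists y, y ^+ p = x) /\
  (forall x : L, exists n a, x ^+ (p ^ n) = e a).

Section Modules.
Variables (A : nzRingType) (V : lmodType A).
Implicit Types M N : set V.

Definition submodule M : Prop := GRing.submod_closed (mem M).

Definition torsion_submodule M : Prop :=
  submodule M /\ forall x, M x -> exists2 a : A, a != 0 & a *: x = 0.

(* Free with a basis indexed by [nat]. *)
Definition free_submodule_aleph0 M : Prop :=
  submodule M /\ exists b : nat -> V,
    (forall n (c : nat -> A), \sum_(k < n) c k *: b k = 0 ->
       forall k, (k < n)%N -> c k = 0) /\
    M = [set x | exists n (c : nat -> A), x = \sum_(k < n) c k *: b k].

Definition is_direct_sum M N : Prop :=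
  M `&` N = [set 0] /\ forall x, exists y z, [/\ M y, N z & x = y + z].

End Modules.

(* Main.v *)
(* Fix [t] in [A] such that [phi t] has degree [r > 0], and put [Q = q ^ r].  The valuations of
   [U] extend to [Kper] with values in Z[1/p], and the product formula persists.  Normalize them
   as if [phi t] were monic.  The excess of a point sums over [v] the amounts by which it lies
   outside a ball at [v]; multiplication by a polynomial of degree [n] in [t] multiplies it by
   [Q ^ n] up to a bounded error.  A positive modular transcendence degree forces a place [v0]
   at which a coefficient of the normalized [phi t] has a pole.

   If all multiples of [z] by polynomials in [t] of bounded degree have small excess, then by
   interpolation and the pigeonhole principle more than [Q] of them are mutually close at all bad
   places, and by the product formula distinct ones cannot be too close at [v0].  Interpolating
   [phi t] through them bounds its coefficients at [v0] and contradicts the pole, so [z] is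
   torsion of bounded order.  By Dirichlet approximation the division closure of a finitely
   generated submodule then has bounded denominators, while the rank is infinite because the
   values on [Kper] have unbounded denominators.

   Hence [phi(Kper)] modulo torsion is a lattice in a space of polynomials over [F] and a direct
   sum of fractional ideals of the Dedekind ring [A]; an infinite such sum is free by Steinitz'
   isomorphism and a swindle. *)

Require Import Defs.
From HB Require Import structures.
From mathcomp Require Import all_boot all_order all_algebra all_field.
From mathcomp Require mpoly.
Import (canonicals) mpoly.
From mathcomp Require Import ring lra zify.
From mathcomp Require Import boolp classical_sets functions cardinality fsbigop.
From mathcomp Require Import reals.

Set Implicit Arguments.
Unset Strict Implicit.
Unset Printing Implicit Defensive.

Import Order.TTheory GRing.Theory Num.Theory.

Local Open Scope classical_set_scope.
Local Open Scope ring_scope.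

(** * Fractional ideals of a Dedekind ring *)

(** The element gamma that makes [phi t] monic lies in an algebraic extension of [K]. Only its
    valuations matter, so the real number [shift v] replaces it and all points stay in [Kper].

    The obstacle is that residue fields may be infinite: a ball modulo a smaller ball need not be
    finite, and bounded excess alone gives no finiteness. Interpolation supplies it, in two roles.
    Applied to a high iterate of [phi t], whose leading coefficient has known value, it forces two
    of any [Q ^ N + 1] small points with small images to be close. Applied to [phi t] itself at
    [Q + 1] close points, it meets the pole at [v0].

    The Dedekind property enters as finiteness of all proper quotients plus complete integral
    closedness. Finiteness is read off [phi]: operators commuting with [phi t] have few leading
    coefficients in each degree.

    Denominators are bounded on each finite-rank piece, with a bound depending on the piece. This is
    why the lattice is filtered by degree and studied through its ideals of leading coefficients. *)

Section FiniteQuotients.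
Variables (F : fieldType) (O : set F).
Hypothesis O1 : O 1.
Hypothesis OB : forall x y, O x -> O y -> O (x - y).
Hypothesis OM : forall x y, O x -> O y -> O (x * y).
Hypothesis Hfin : forall c, O c -> c != 0 -> exists s : seq F,
  forall x, O x -> exists2 y, y \in s & exists2 z, O z & x - y = c * z.
Hypothesis Hic : forall c x, c != 0 -> (forall n, O (c * x ^+ n)) -> O x.

Lemma order0 : O 0. Proof. by rewrite -(subrr 1); apply: OB. Qed.
Lemma orderN x : O x -> O (- x).
Proof. by move=> Ox; rewrite -sub0r; apply: OB => //; apply: order0. Qed.
Lemma orderD x y : O x -> O y -> O (x + y).
Proof. by move=> Ox Oy; rewrite -[y]opprK; apply: OB => //; apply: orderN. Qed.
Lemma orderX x n : O x -> O (x ^+ n).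
Proof. by move=> Ox; elim: n => [//|n IH]; rewrite exprS; apply: OM. Qed.

Definition is_ideal (a : set F) : Prop :=
  [/\ a `<=` O, a 0, forall x y, a x -> a y -> a (x - y)
    & forall x y, O x -> a y -> a (x * y)].

Section Ideal.
Variables (a : set F) (ha : is_ideal a).

Lemma idealO x : a x -> O x. Proof. by case: ha => h _ _ _; apply: h. Qed.
Lemma ideal0 : a 0. Proof. by case: ha. Qed.
Lemma idealB x y : a x -> a y -> a (x - y). Proof. by case: ha => _ _ h _; apply: h. Qed.
Lemma idealMl x y : O x -> a y -> a (x * y). Proof. by case: ha => _ _ _; apply. Qed.
Lemma idealMr x y : a x -> O y -> a (x * y).
Proof. by move=> ax Oy; rewrite mulrC; apply: idealMl. Qed.
Lemma idealN x : a x -> a (- x).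
Proof. by move=> ax; rewrite -sub0r; apply: idealB => //; apply: ideal0. Qed.
Lemma idealD x y : a x -> a y -> a (x + y).
Proof. by move=> ax ay; rewrite -[y]opprK; apply: idealB => //; apply: idealN. Qed.

Lemma ideal_sum (n : nat) (f : 'I_n -> F) : (forall i, a (f i)) -> a (\sum_i f i).
Proof.
by move=> h; apply: (big_ind a); [exact: ideal0 | exact: idealD | move=> i _].
Qed.

(* Multiplying [d0] by a suitable monomial in the [j]s. *)
Lemma ideal_annihilated (d0 : F) (js : seq F) : ~ a d0 ->
  (forall j, j \in js -> O j /\ exists n, a (d0 * j ^+ n)) ->
  exists w, [/\ O w, ~ a (d0 * w) & forall j, j \in js -> a (d0 * w * j)].
Proof.
elim: js d0 => [|j js IH] d0 ad0 h; first by exists 1; rewrite mulr1; split.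
have [Oj [n hn]] := h j (mem_head _ _).
have hex : exists n, `[< a (d0 * j ^+ n) >] by exists n; apply/asboolP.
have [[|m] /asboolP hm min] := ex_minnP hex.
  by case: ad0; rewrite -[d0]mulr1 -(expr0 j).
have [|i ijs|w [Ow aw hw]] := IH (d0 * j ^+ m).
- by move=> /asboolP /min; rewrite ltnn.
- have [|Oi [k hk]] := h i; first by rewrite inE ijs orbT.
  split=> //; exists k; rewrite mulrAC; apply: idealMr => //; exact: orderX.
exists (j ^+ m * w); rewrite !mulrA; split=> //.
  by apply: OM => //; apply: orderX.
move=> i; rewrite inE => /orP[/eqP->|]; last exact: hw.
have -> : d0 * j ^+ m * w * j = d0 * j ^+ m.+1 * w by rewrite exprS; ring.
exact: idealMr.
Qed.
End Ideal.

Definition multiples (c : F) : set F := [set x | exists2 z, O z & x = c * z].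

Lemma multiples_ideal c : O c -> is_ideal (multiples c).
Proof.
move=> Oc; split.
- by move=> _ [z Oz ->]; apply: OM.
- by exists 0; [apply: order0 | rewrite mulr0].
- move=> _ _ [z Oz ->] [t Ot ->]; exists (z - t); first exact: OB.
  by rewrite mulrBr.
- by move=> x _ Ox [z Oz ->]; exists (x * z); [apply: OM | ring].
Qed.

Lemma finite_pigeonhole (c : F) (f : nat -> F) : O c -> c != 0 -> (forall n, O (f n)) ->
  exists n m, multiples c (f n - f (n + m.+1)%N).
Proof.
move=> Oc c0 Of; have [s hs] := Hfin Oc c0.
have {}hs n : exists y, y \in s /\ multiples c (f n - y).
  by have [y ys h] := hs _ (Of n); exists y.
have [g hg] := choice hs.
have : ~~ uniq (map g (iota 0 (size s).+1)).
  apply/negP => ug; have : (size (map g (iota 0 (size s).+1)) <= size s)%N.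
    by apply: uniq_leq_size => // _ /mapP[k _ ->]; have [] := hg k.
  by rewrite size_map size_iota ltnn.
move=> /(uniqPn 0); rewrite size_map size_iota => -[i [k [ik kS]]].
rewrite !(nth_map 0%N) ?size_iota ?(ltn_trans ik) // !nth_iota ?(ltn_trans ik) //.
rewrite !add0n => gik; exists i, (k - i).-1.
have -> : (i + (k - i).-1.+1 = k)%N by lia.
have [_ h1] := hg i; have [_ h2] := hg k.
have -> : f i - f k = (f i - g i) - (f k - g k) by rewrite gik; ring.
by apply: idealB => //; apply: multiples_ideal.
Qed.

Lemma finite_power_period (c e : F) : O c -> c != 0 -> O e ->
  exists n m, multiples c (e ^+ n * (1 - e ^+ m.+1)).
Proof.
move=> Oc c0 Oe; have [n [m h]] := finite_pigeonhole Oc c0 (fun n => orderX n Oe).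
by exists n, m; rewrite mulrBr mulr1 -exprD.
Qed.

Definition is_fractional_ideal (I : set F) : Prop :=
  [/\ I 0, forall x y, I x -> I y -> I (x - y), forall x y, O x -> I y -> I (x * y),
      exists2 x, I x & x != 0 & exists2 c, c != 0 & forall x, I x -> O (c * x)].

Definition colon (J I : set F) : set F := [set x | forall y, I y -> J (x * y)].
Definition inv_ideal (I : set F) : set F := colon O I.

Lemma frac0 I : is_fractional_ideal I -> I 0. Proof. by case. Qed.
Lemma fracB I x y : is_fractional_ideal I -> I x -> I y -> I (x - y).
Proof. by case=> _ h _ _ _; apply: h. Qed.
Lemma fracN I x : is_fractional_ideal I -> I x -> I (- x).
Proof. by move=> hI Ix; rewrite -sub0r; apply: fracB => //; apply: frac0. Qed.
Lemma fracD I x y : is_fractional_ideal I -> I x -> I y -> I (x + y).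
Proof. by move=> hI Ix Iy; rewrite -[y]opprK; apply: fracB => //; apply: fracN. Qed.
Lemma fracMl I x y : is_fractional_ideal I -> O x -> I y -> I (x * y).
Proof. by case=> _ _ h _ _; apply: h. Qed.
Lemma fracMr I x y : is_fractional_ideal I -> I x -> O y -> I (x * y).
Proof. by move=> hI Ix Oy; rewrite mulrC; apply: fracMl. Qed.

Lemma inv_fractional I : is_fractional_ideal I -> is_fractional_ideal (inv_ideal I).
Proof.
case=> I0 IB IM [x Ix x0] [c c0 hc]; split.
- by move=> y _; rewrite mul0r; apply: order0.
- by move=> u v hu hv y Iy; rewrite mulrBl; apply: OB; [apply: hu | apply: hv].
- by move=> u v Ou hv y Iy; rewrite -mulrA; apply: OM => //; apply: hv.
- by exists c.
- by exists x => // y hy; rewrite mulrC; apply: hy.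
Qed.

Lemma colon_fractional I J : is_fractional_ideal I -> is_fractional_ideal J ->
  is_fractional_ideal (colon J (inv_ideal I)).
Proof.
move=> hI hJ; have [_ _ _ [x Ix x0] [c c0 hc]] := hI.
have [J0 JB JM [y Jy y0] [d d0 hd]] := hJ; split.
- by move=> z _; rewrite mul0r.
- by move=> u v hu hv z Iz; rewrite mulrBl; apply: JB; [apply: hu | apply: hv].
- by move=> u v Ou hv z Iz; rewrite -mulrA; apply: JM => //; apply: hv.
- exists (x * y); last by rewrite mulf_neq0.
  by move=> z Iz; rewrite mulrAC (mulrC x); apply: JM => //; apply: Iz.
- exists (d * c) => [|u hu]; first by rewrite mulf_neq0.
  by rewrite -mulrA (mulrC c); apply: hd; apply: hu.
Qed.

Section Invertible.
Variables (I : set F) (hI : is_fractional_ideal I).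

Let products : set F := [set s | exists n (x y : 'I_n -> F),
  [/\ forall i, inv_ideal I (x i), forall i, I (y i) & s = \sum_i x i * y i]].

Let productsI : is_ideal products.
Proof.
split.
- move=> _ [n [x [y [hx hy ->]]]]; apply: (big_ind O); first exact: order0.
    exact: orderD.
  by move=> i _; apply: hx.
- by exists 0%N, (fun=> 0), (fun=> 0); rewrite big_ord0; split=> // -[].
- move=> _ _ [n [x [y [hx hy ->]]]] [m [u [v [hu hv ->]]]].
  exists (n + m)%N, (fun i : 'I_(n + m) => match fintype.split i with inl i => x i | inr i => - u i end),
    (fun i : 'I_(n + m) => match fintype.split i with inl i => y i | inr i => v i end); split.
  + move=> i; case: fintype.split => k //; exact: (fracN (inv_fractional hI)).
  + by move=> i; case: fintype.split.
  rewrite big_split_ord -sumrN; congr (_ + _); apply: eq_bigr => i _.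
    by rewrite (unsplitK (inl i)).
  by rewrite (unsplitK (inr i)) mulNr.
- move=> z _ Oz [n [x [y [hx hy ->]]]]; exists n, (fun i => z * x i), y; split=> //.
    by move=> i; exact: (fracMl (inv_fractional hI)).
  by rewrite mulr_sumr; apply: eq_bigr => i _; rewrite mulrA.
Qed.

(* If [I * I^-1 <> O], an element [w] outside [O] multiplies [I * I^-1] into [O], hence
   [I^-1] into itself, so [w] is almost integral over [O]. *)
Lemma fractional_invertible : exists n (x y : 'I_n -> F),
  [/\ forall i, inv_ideal I (x i), forall i, I (y i) & \sum_i x i * y i = 1].
Proof.
have [|nP1] := pselect (products 1).
  by move=> [n [x [y [hx hy /esym h]]]]; exists n, x, y.
exfalso; have [_ _ _ [y0 Iy0 y00] [d d0 hd]] := hI; pose c := d * y0.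
have hprod x y : inv_ideal I x -> I y -> products (x * y).
  by move=> hx hy; exists 1%N, (fun=> x), (fun=> y); rewrite big_ord1; split.
have Pc : products c by apply: hprod.
have Oc := idealO productsI Pc; have c0 : c != 0 by rewrite mulf_neq0.
have cI := multiples_ideal Oc; have [s hs] := Hfin Oc c0.
(* This yields a finite list [js] inside [products] that meets every class modulo [c] met by
   [products]. *)
have hr y : exists j, products j /\
    ((exists2 i, products i & multiples c (i - y)) -> multiples c (j - y)).
  have [[i Pi ci]|h] := pselect (exists2 i, products i & multiples c (i - y)).
    by exists i.
  by exists 0; split; [exact: (ideal0 productsI) | move/h].
have {hr}[r hr] := choice hr; pose js := map r s.
have jsP j : j \in js -> products j by case/mapP=> y _ ->; have [] := hr y.
have hjs j : products j -> exists2 i, i \in js & multiples c (j - i).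
  move=> Pj; have [y ys cy] := hs _ (idealO productsI Pj).
  exists (r y); first exact: map_f.
  have [_ h] := hr y; have -> : j - r y = (j - y) - (r y - y) by ring.
  by apply: idealB => //; apply: h; exists j.
have [u [Pu cu]] : exists u, products (1 - u) /\
    forall j, j \in js -> O j /\ exists n, multiples c (u * j ^+ n).
  elim: js jsP {hjs} => [|j js IH] jsP.
    by exists 1; rewrite subrr; split; [exact: (ideal0 productsI) |].
  have [|u [Pu cu]] := IH; first by move=> i ijs; apply: jsP; rewrite inE ijs orbT.
  have Pj := jsP j (mem_head _ _); have Oj := idealO productsI Pj.
  have [n [m hnm]] := finite_power_period Oc c0 Oj.
  have Ou : O u.
    by rewrite -[u](subKr 1); apply: OB => //; apply: idealO Pu.
  exists (u * (1 - j ^+ m.+1)); split.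
    have -> : 1 - u * (1 - j ^+ m.+1) = (1 - u) + (u * j ^+ m) * j.
      by rewrite exprS; ring.
    apply: idealD => //; apply: idealMl => //; apply: OM => //; exact: orderX.
  move=> i; rewrite inE => /predU1P[->|ijs].
    split=> //; exists n; rewrite -mulrA (mulrC _ (j ^+ n)); exact: idealMl.
  have [Oi [k hk]] := cu i ijs; split=> //; exists k.
  rewrite mulrAC; apply: idealMr => //; apply: OB => //; exact: orderX.
have ncu : ~ multiples c u.
  move=> [z Oz uz]; apply: nP1; have -> : 1 = (1 - u) + z * c by rewrite uz; ring.
  by apply: idealD => //; apply: idealMl.
have [w [Ow cw hw]] := ideal_annihilated cI ncu cu.
pose e := u * w; have Oe : O e.
  apply: OM => //; rewrite -[u](subKr 1); apply: OB => //; exact: idealO Pu.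
have ej j : products j -> multiples c (e * j).
  move=> Pj; have [i ijs ci] := hjs j Pj.
  have -> : e * j = e * (j - i) + e * i by ring.
  by apply: idealD => //; [apply: idealMl | apply: hw].
(* [e] maps [products] into [c O], so [e / c] maps [inv_ideal I] to itself. Its powers times [d]
   stay there and pair with [y0] to give [c * (e / c) ^+ n] in [O]. *)
have stable x : inv_ideal I x -> inv_ideal I (e / c * x).
  move=> hx y Iy; have [z Oz ez] := ej _ (hprod _ _ hx Iy).
  suff -> : e / c * x * y = z by [].
  by apply: (mulfI c0); rewrite -ez; field.
have stableX n : inv_ideal I ((e / c) ^+ n * d).
  elim: n => [|n IH]; first by rewrite mul1r.
  by rewrite exprS -mulrA; apply: stable.
have Oec : O (e / c).
  by apply: (Hic c0) => n; rewrite {1}/c mulrC mulrA; apply: stableX.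
by apply: cw; exists (e / c) => //; rewrite [c * _]mulrC divfK.
Qed.
End Invertible.

(** The powers of [e] modulo [c] are eventually periodic. An exponent that is a multiple of the
    period [m.+1] and at least the preperiod [n] gives an idempotent; [m.+1 * n.+1] is one. *)
Lemma finite_power_idempotent (a : set F) (c e : F) : is_ideal a -> a c -> c != 0 -> O e ->
  exists m, a (e ^+ m.+1 - e ^+ m.+1 * e ^+ m.+1).
Proof.
move=> ha ac c0 Oe; have Oc := idealO ha ac.
have [n [m [z Oz hz]]] := finite_power_period Oc c0 Oe.
have [k kE] : exists k, (k.+1 = m.+1 * n.+1)%N by exists (m.+1 * n.+1).-1; rewrite prednK.
have [h Oh hE] : exists2 h, O h & 1 - e ^+ k.+1 = (1 - e ^+ m.+1) * h.
  rewrite kE exprM; move: (e ^+ m.+1) (orderX m.+1 Oe) => g Og.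
  elim: n.+1 => [|l [h Oh hl]]; first by exists 0; rewrite ?mulr0 ?subrr //; apply: order0.
  exists (h + g ^+ l); first by apply: orderD => //; apply: orderX.
  by rewrite mulrDr -hl exprS; ring.
have kn : (n <= k.+1)%N by rewrite kE mulSn (leq_trans (leqnSn n)) ?leq_addr // mulnC leq_pmulr.
exists k; rewrite -[X in X - _]mulr1 -mulrBr hE -(subnK kn) exprD.
have -> : e ^+ (k.+1 - n) * e ^+ n * ((1 - e ^+ m.+1) * h) =
          (e ^+ (k.+1 - n) * z * h) * c by rewrite -!mulrA (mulrA (e ^+ n)) hz; ring.
by apply: (idealMl ha) => //; do 2?[apply: OM => //]; apply: orderX.
Qed.

(* The classes of [b * beta] are idempotents of [O / a], enlarged until they exceed the
   idempotent powers of all the [x * y]. *)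
Lemma invertible_mod_ideal (L a : set F) (c : F) : is_fractional_ideal L -> is_ideal a ->
  a c -> c != 0 -> exists b beta, [/\ L b, inv_ideal L beta & a (1 - b * beta)].
Proof.
move=> hL ha ac c0; have hL' := inv_fractional hL.
have step (ps : seq (F * F)) : (forall p, p \in ps -> inv_ideal L p.1 /\ L p.2) ->
    exists b beta, [/\ L b, inv_ideal L beta, a (b * beta - b * beta * (b * beta)) &
      forall p, p \in ps -> exists m, a ((1 - b * beta) * (p.1 * p.2) ^+ m)].
  elim: ps => [|[x y] ps IH] hps.
    exists 0, 0; split; rewrite ?mulr0 ?subrr //; [exact: frac0 | exact: frac0 |].
    exact: ideal0.
  have [|b [be [Lb Lbe hid hm]]] := IH; first by move=> p pps; apply: hps; rewrite inE pps orbT.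
  have [/= Lx Ly] := hps (x, y) (mem_head _ _).
  set e := b * be in hid hm; have Oe : O e by rewrite /e mulrC; apply: Lbe.
  have Oxy : O (x * y) by apply: Lx.
  have [m hf] := finite_power_idempotent ha ac c0 Oxy.
  set f := (x * y) ^+ m.+1 in hf; have Of : O f by apply: orderX.
  have O1e : O (1 - e) by apply: OB.
  have Oxm : O ((x * y) ^+ m) by apply: orderX.
  (* Modulo [a] the cross terms contain [e * (1 - e)] and vanish, so [b' * be'] becomes [g], the
     join of the idempotents [e] and [f]. *)
  pose b' := e * b + (1 - e) * f * (x * y) ^+ m * y; pose be' := e * be + (1 - e) * x.
  pose g := e + (1 - e) * f; have Og : O g by apply: orderD => //; apply: OM.
  have hd : a (b' * be' - g).
    have -> : b' * be' - g = (b * x - (1 + e)) * (e - e * e)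
       + (be * y) * f * (x * y) ^+ m * (e - e * e)
       + (1 - e) * (- 1) * (f - f * f) + (- (f * f)) * (e - e * e).
      by rewrite /b' /be' /g /f exprS /e; ring.
    have Obx : O (b * x) by rewrite mulrC; apply: Lx.
    have Oby : O (be * y) by apply: Lbe.
    have ON1 : O (-1) by apply: orderN.
    do 3?[apply: (idealD ha)]; apply: (idealMl ha) => //.
    - by apply: OB => //; apply: orderD.
    - by do 2?[apply: OM => //].
    - exact: OM.
    - by apply: orderN; apply: OM.
  set de := b' * be' - g in hd; have Ode := idealO ha hd.
  have bbE : b' * be' = g + de by rewrite /de; ring.
  exists b', be'; split.
  - apply: (fracD hL); apply: (fracMl hL) => //.
    by do 2?[apply: OM => //].
  - by apply: (fracD hL'); apply: (fracMl hL').
  - rewrite bbE.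
    have -> : g + de - (g + de) * (g + de) = (1 - g - g - de) * de +
       (1 - f) * (e - e * e) + (1 - e) * (1 - e) * (f - f * f) by rewrite /g; ring.
    do 2?[apply: (idealD ha)]; apply: (idealMl ha) => //; last exact: OM.
      by do 3?[apply: OB => //].
    exact: OB.
  rewrite bbE => p; rewrite inE => /predU1P[->/=|pps].
    exists m.+1; rewrite -/f.
    have -> : (1 - (g + de)) * f = (1 - e) * (f - f * f) - f * de by rewrite /g; ring.
    by apply: (idealB ha); apply: (idealMl ha).
  have [k hk] := hm p pps; exists k.
  have -> : (1 - (g + de)) * (p.1 * p.2) ^+ k =
     (1 - f) * ((1 - e) * (p.1 * p.2) ^+ k) - (p.1 * p.2) ^+ k * de by rewrite /g; ring.
  apply: (idealB ha); apply: (idealMl ha) => //; first exact: OB.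
  apply: orderX; have [|Lp1 Lp2] := hps p; first by rewrite inE pps orbT.
  exact: Lp1.
have [n [x [y [hx hy sxy]]]] := fractional_invertible hL.
have [|b [be [Lb Lbe hid hm]]] := step [seq (x i, y i) | i <- enum 'I_n].
  by move=> _ /mapP[i _ ->] /=.
(* Every [x i * y i] is nilpotent on the class of [1 - b * be]. If this class were nonzero, some
   nonzero multiple of it would be killed by all of them, hence by their sum 1. *)
exists b, be; split=> //; apply: contrapT => nae.
have [|w [Ow naw hw]] := ideal_annihilated ha (js := [seq x i * y i | i <- enum 'I_n]) nae.
  move=> _ /mapP[i _ ->]; split; first exact: hx.
  have [|m h] := hm (x i, y i); last by exists m.
  by apply/mapP; exists i; rewrite ?mem_enum.
apply: naw; set d := (1 - _) * w in hw *; rewrite -[d]mulr1 -sxy mulr_sumr; apply: (ideal_sum ha) => i.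
by apply: hw; apply/mapP; exists i; rewrite ?mem_enum.
Qed.

(** For a nonzero [a] in [L1] the products [a * al] form a nonzero ideal, modulo which some [b * be]
    is 1. The four elements are the entries of the determinant-one matrix in Steinitz'
    isomorphism. *)
Lemma fractional_unimodular_pair (L1 L2 : set F) :
  is_fractional_ideal L1 -> is_fractional_ideal L2 ->
  exists a al b be, [/\ L1 a, inv_ideal L1 al, L2 b, inv_ideal L2 be & a * al + b * be = 1].
Proof.
move=> h1 h2; have [_ _ _ [a La a0] _] := h1.
have h1' := inv_fractional h1; have [_ _ _ [al0 Lal0 al00] _] := h1'.
pose A : set F := [set x | exists2 al, inv_ideal L1 al & x = a * al].
have hA : is_ideal A.
  split.
  - by move=> _ [al hal ->]; rewrite mulrC; apply: hal.
  - by exists 0; rewrite ?mulr0 //; apply: frac0.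
  - move=> _ _ [al hal ->] [al' hal' ->]; exists (al - al'); last by rewrite mulrBr.
    exact: (fracB h1').
  - move=> x _ Ox [al hal ->]; exists (x * al); last by ring.
    exact: (fracMl h1').
have Aa : A (a * al0) by exists al0.
have [|b [be [Lb Lbe [al hal hE]]]] := invertible_mod_ideal h2 hA Aa; first by rewrite mulf_neq0.
by exists a, al, b, be; split=> //; rewrite -hE subrK.
Qed.

Lemma inv_idealK I : is_fractional_ideal I -> inv_ideal (inv_ideal I) `<=` I.
Proof.
move=> hI z hz; have [n [x [y [hx hy sxy]]]] := fractional_invertible hI.
have [I0 IB IM _ _] := hI; rewrite -[z]mulr1 -sxy mulr_sumr.
apply: (big_ind I) => // [u v|i _]; first exact: fracD.
by rewrite mulrA; apply: IM => //; apply: hz.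
Qed.

(* Steinitz twice: [J + J' = I^-1 + I'] and [I + I^-1 = O + O]. *)
Lemma steinitz_absorption (W : lmodType F) (I J J' : set F) (g E E' : W) :
  is_fractional_ideal I -> is_fractional_ideal J -> is_fractional_ideal J' ->
  exists u1 u2 I' g', [/\ is_fractional_ideal I',
    forall x, I x -> exists o1 o2, [/\ O o1, O o2 & x *: g = o1 *: u1 + o2 *: u2],
    forall x, J x -> exists o1 o2 z,
      [/\ O o1, O o2, I' z & x *: E = o1 *: u1 + o2 *: u2 + z *: g'],
    forall x, J' x -> exists o1 o2 z,
      [/\ O o1, O o2, I' z & x *: E' = o1 *: u1 + o2 *: u2 + z *: g'] &
    [/\ exists x y z, [/\ I x, J y, J' z & u1 = x *: g + y *: E + z *: E'],
      exists x y z, [/\ I x, J y, J' z & u2 = x *: g + y *: E + z *: E'],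
      forall x, I' x -> exists y z, [/\ J y, J' z & x *: g' = y *: E + z *: E'] &
      forall c1 c2 c3, exists A B C,
        c1 *: u1 + c2 *: u2 + c3 *: g' = A *: g + B *: E + C *: E' /\
        (A = 0 -> B = 0 -> C = 0 -> [/\ c1 = 0, c2 = 0 & c3 = 0])]].
Proof.
move=> hI hJ hJ'; have hI' := inv_fractional hI.
pose L J := colon J (inv_ideal I).
have [a [al [b [be [La Lal Lb Lbe e1]]]]] :=
  fractional_unimodular_pair (colon_fractional hI hJ) (colon_fractional hI hJ').
have [a' [al' [b' [be' [Ia' Ial' Ib' Ibe' e2]]]]] := fractional_unimodular_pair hI hI'.
have {}Ibe' : I be' by apply: inv_idealK.
have LI K x al0 : is_fractional_ideal K -> inv_ideal (L K) al0 -> K x -> inv_ideal I (al0 * x).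
  move=> hK hal Kx y Iy; rewrite -mulrA; apply: hal => z hz.
  by rewrite -mulrA; apply: (fracMr hK) => //; rewrite mulrC; apply: hz.
(* The pairs [E], [E'] and [g1], [g'] differ by a matrix whose determinant is 1 by [e1]; the pairs
   [g], [g1] and [u1], [u2] by one whose determinant is 1 by [e2]. The vector [g1] is to carry the
   inverse of [I]. *)
have [g1 g1d] : exists w : W, w = a *: E + b *: E' by exists (a *: E + b *: E').
have [g' g'd] : exists w : W, w = - be *: E + al *: E' by exists (- be *: E + al *: E').
pose u1 := a' *: g + b' *: g1; pose u2 := - be' *: g + al' *: g1.
have Oala : O (al * a) by apply: Lal.
have Obeb : O (be * b) by apply: Lbe.
(* The coefficients [x] for which both coordinates of [x *: g'] are allowed; no product of ideals
   has to be formed. *)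
pose I' : set F := [set x | J (be * x) /\ J' (al * x)].
have JbI' x : J x -> I' (x * b).
  move=> Jx; split; first by rewrite mulrCA; apply: (fracMr hJ).
  by rewrite mulrA mulrC; apply: Lb; apply: (LI J).
have JaI' x : J' x -> I' (x * a).
  move=> Jx; split; last by rewrite mulrCA; apply: (fracMr hJ').
  by rewrite mulrA mulrC; apply: La; apply: (LI J').
have I'f : is_fractional_ideal I'.
  split.
  - by split; rewrite mulr0; [exact: frac0 hJ | exact: frac0 hJ'].
  - move=> x y [x1 x2] [y1 y2].
    by split; rewrite mulrBr; [exact: fracB hJ _ _ | exact: fracB hJ' _ _].
  - move=> x y Ox [y1 y2].
    by split; rewrite mulrCA; [exact: fracMl hJ _ _ | exact: fracMl hJ' _ _].
  - have [_ _ _ [x Jx x0] _] := hJ; have [_ _ _ [x' Jx' x0'] _] := hJ'.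
    have [a0|a0] := eqVneq a 0.
      exists (x * b); first exact: JbI'.
      rewrite mulf_neq0 //; apply: contra_eq_neq e1 => ->.
      by rewrite a0 !mul0r addr0 eq_sym oner_neq0.
    by exists (x' * a); [exact: JaI' | rewrite mulf_neq0].
  have [_ _ _ _ [c c0 hc]] := hJ; have [_ _ _ _ [c' c'0 hc']] := hJ'.
  have [be0|be0] := eqVneq be 0.
    exists (c' * al) => [|x [_ ?]]; last by rewrite -mulrA; apply: hc'.
    rewrite mulf_neq0 //; apply: contra_eq_neq e1 => ->.
    by rewrite be0 !mulr0 addr0 eq_sym oner_neq0.
  by exists (c * be) => [|x [? _]]; [rewrite mulf_neq0 | rewrite -mulrA; apply: hc].
have gE : g = al' *: u1 - b' *: u2.
  rewrite /u1 /u2 !scalerDr !scalerA opprD addrACA -!scalerBl.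
  have -> : al' * a' - b' * - be' = 1 by rewrite -e2; ring.
  have -> : al' * b' - b' * al' = 0 by ring.
  by rewrite scale0r addr0 scale1r.
have g1E : g1 = be' *: u1 + a' *: u2.
  rewrite /u1 /u2 !scalerDr !scalerA addrACA -!scalerDl.
  have -> : be' * a' + a' * - be' = 0 by ring.
  have -> : be' * b' + a' * al' = 1 by rewrite -e2; ring.
  by rewrite scale0r add0r scale1r.
have EE : E = al *: g1 - b *: g'.
  rewrite g1d g'd !scalerDr !scalerA opprD addrACA -!scalerBl.
  have -> : al * a - b * - be = 1 by rewrite -e1; ring.
  have -> : al * b - b * al = 0 by ring.
  by rewrite scale0r addr0 scale1r.
have E'E : E' = be *: g1 + a *: g'.
  rewrite g1d g'd !scalerDr !scalerA addrACA -!scalerDl.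
  have -> : be * a + a * - be = 0 by ring.
  have -> : be * b + a * al = 1 by rewrite -e1; ring.
  by rewrite scale0r add0r scale1r.
have u1E : u1 = a' *: g + (b' * a) *: E + (b' * b) *: E'.
  by rewrite /u1 g1d scalerDr !scalerA addrA.
have u2E : u2 = - be' *: g + (al' * a) *: E + (al' * b) *: E'.
  by rewrite /u2 g1d scalerDr !scalerA addrA.
exists u1, u2, I', g'; split=> //.
- move=> x Ix; exists (x * al'), (- (x * b')); split.
  + by rewrite mulrC; apply: Ial'.
  + by apply: orderN; rewrite mulrC; apply: Ib'.
  + by rewrite gE scalerBr !scalerA scaleNr.
- move=> x Jx; have hx := LI _ _ _ hJ Lal Jx.
  exists (al * x * be'), (al * x * a'), (- (x * b)); split; try exact: hx.
    by apply: (fracN I'f); apply: JbI'.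
  by rewrite {1}EE g1E scalerBr !scalerDr !scalerA scaleNr !(mulrC al) -!mulrA !(mulrCA al).
- move=> x Jx; have hx := LI _ _ _ hJ' Lbe Jx.
  exists (be * x * be'), (be * x * a'), (x * a); split; try exact: hx.
    exact: JaI'.
  by rewrite {1}E'E g1E !scalerDr !scalerA (mulrC be) -!mulrA.
split.
- exists a', (b' * a), (b' * b); split=> //; rewrite mulrC; [exact: La | exact: Lb].
- exists (- be'), (al' * a), (al' * b); split=> //; first exact: (fracN hI).
    by rewrite mulrC; apply: La.
  by rewrite mulrC; apply: Lb.
- move=> x [x1 x2]; exists (- (be * x)), (al * x); split=> //; first exact: (fracN hJ).
  by rewrite g'd scalerDr !scalerA mulrN (mulrC x) (mulrC al).
move=> c1 c2 c3; pose s := c1 * b' + c2 * al'.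
exists (c1 * a' - c2 * be'), (s * a - c3 * be), (s * b + c3 * al); split.
  transitivity ((c1 * a' - c2 * be') *: g + (s *: g1 + c3 *: g')).
    by rewrite /u1 /u2 !scalerDr !scalerA addrACA -!scalerDl mulrN -addrA.
  rewrite -[RHS]addrA; congr (_ + _); rewrite g1d g'd !scalerDr !scalerA addrACA -!scalerDl.
  by rewrite mulrN.
move=> A0 B0 C0.
have s0 : s = 0.
  by rewrite -[s]mulr1 -e1; transitivity (al * (s * a - c3 * be) + be * (s * b + c3 * al));
     [ring | rewrite B0 C0; ring].
have c30 : c3 = 0.
  by rewrite -[c3]mulr1 -e1; transitivity (a * (s * b + c3 * al) - b * (s * a - c3 * be));
     [ring | rewrite B0 C0; ring].
have c10 : c1 = 0.
  by rewrite -[c1]mulr1 -e2; transitivity (al' * (c1 * a' - c2 * be') + be' * s);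
     [rewrite /s; ring | rewrite A0 s0; ring].
have c20 : c2 = 0.
  by rewrite -[c2]mulr1 -e2; transitivity (a' * s - b' * (c1 * a' - c2 * be'));
     [rewrite /s; ring | rewrite A0 s0; ring].
by [].
Qed.

(** * Infinite sums of fractional ideals *)

Section Combinations.
Variables (W : lmodType F).
Implicit Types (S : nat -> set F) (E : nat -> W).

Definition combinations S E : set W :=
  [set P | exists n c, (forall i, S i (c i)) /\ P = \sum_(i < n) c i *: E i].

Section Closure.
Variables (S : nat -> set F) (E : nat -> W).
Hypothesis S0 : forall i, S i 0.
Hypothesis SD : forall i x y, S i x -> S i y -> S i (x + y).

Lemma combinations0 : combinations S E 0.
Proof. by exists 0%N, (fun=> 0); rewrite big_ord0. Qed.

Lemma combinations_scale i x : S i x -> combinations S E (x *: E i).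
Proof.
move=> Sx; exists i.+1, (fun k => if k == i then x else 0); split.
  by move=> k; case: eqP => [->|].
rewrite big_ord_recr /= eqxx big1 ?add0r // => k _.
by rewrite ltn_eqF // scale0r.
Qed.

Lemma combinationsD P Q : combinations S E P -> combinations S E Q -> combinations S E (P + Q).
Proof.
have widen n m (c : nat -> F) : (n <= m)%N -> \sum_(i < n) c i *: E i =
    \sum_(i < m) (if (i < n)%N then c i else 0) *: E i.
  move=> nm; rewrite (big_ord_widen m (fun i => c i *: E i)) // big_mkcond /=.
  by apply: eq_bigr => i _; case: ifP; rewrite ?scale0r.
move=> [n [c [hc ->]]] [m [c' [hc' ->]]].
exists (maxn n m), (fun i => (if (i < n)%N then c i else 0) + (if (i < m)%N then c' i else 0)).
split; first by move=> i; apply: SD; case: ifP.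
rewrite (widen n (maxn n m)) ?leq_maxl // (widen m (maxn n m)) ?leq_maxr // -big_split /=.
by apply: eq_bigr => i _; rewrite scalerDl.
Qed.
End Closure.
End Combinations.

(* Successive steps of [steinitz_absorption]: the leftover ideal of one step is absorbed by
   the next one, so nothing is left over in the end. *)
Theorem fractional_ideals_sum_free (J : nat -> set F) (E : nat -> {poly F}) :
  (forall n, is_fractional_ideal (J n)) -> (forall n, size (E n) = n.+1) ->
  exists u : nat -> {poly F}, [/\ forall k, combinations J E (u k),
    forall n x, J n x -> combinations (fun=> O) u (x *: E n) &
    forall n (c : nat -> F), \sum_(i < n) c i *: u i = 0 -> forall i, (i < n)%N -> c i = 0].
Proof.
move=> hJ sE.
(* The state of the recursion: the leftover fractional ideal and the vector it multiplies. *)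
pose T := {p : set F * {poly F} | is_fractional_ideal p.1}.
have step (k : nat) (s : T) : exists r : {poly F} * {poly F} * T, 
   [/\ forall x, (sval s).1 x -> exists o1 o2,
      [/\ O o1, O o2 & x *: (sval s).2 = o1 *: r.1.1 + o2 *: r.1.2],
    forall x, J k.*2.+1 x -> exists o1 o2 z,
      [/\ O o1, O o2, (sval r.2).1 z &
        x *: E k.*2.+1 = o1 *: r.1.1 + o2 *: r.1.2 + z *: (sval r.2).2],
    forall x, J k.*2.+2 x -> exists o1 o2 z,
      [/\ O o1, O o2, (sval r.2).1 z &
        x *: E k.*2.+2 = o1 *: r.1.1 + o2 *: r.1.2 + z *: (sval r.2).2] &
    [/\ exists x y z, [/\ (sval s).1 x, J k.*2.+1 y, J k.*2.+2 z &
        r.1.1 = x *: (sval s).2 + y *: E k.*2.+1 + z *: E k.*2.+2],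
      exists x y z, [/\ (sval s).1 x, J k.*2.+1 y, J k.*2.+2 z &
        r.1.2 = x *: (sval s).2 + y *: E k.*2.+1 + z *: E k.*2.+2],
      forall x, (sval r.2).1 x -> exists y z, [/\ J k.*2.+1 y, J k.*2.+2 z &
        x *: (sval r.2).2 = y *: E k.*2.+1 + z *: E k.*2.+2] &
      forall c1 c2 c3, exists A B C,
        c1 *: r.1.1 + c2 *: r.1.2 + c3 *: (sval r.2).2 =
          A *: (sval s).2 + B *: E k.*2.+1 + C *: E k.*2.+2 /\
        (A = 0 -> B = 0 -> C = 0 -> [/\ c1 = 0, c2 = 0 & c3 = 0])]].
  case: s => -[I g] /= hI.
  have [u1 [u2 [I' [g' [hI' h1 h2 h3 h4]]]]] :=
    steinitz_absorption g (E k.*2.+1) (E k.*2.+2) hI (hJ k.*2.+1) (hJ k.*2.+2).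
  by exists (u1, u2, exist _ (I', g') hI').
have [f hf] := choice (fun p : nat * T => step p.1 p.2).
pose st := fix st k : T := if k is l.+1 then (f (l, st l)).2 else exist _ (J 0%N, E 0%N) (hJ 0%N).
pose I k := (sval (st k)).1; pose g k := (sval (st k)).2.
pose u n := if odd n then (f (n./2, st n./2)).1.2 else (f (n./2, st n./2)).1.1.
have ue k : u k.*2 = (f (k, st k)).1.1 by rewrite /u odd_double doubleK.
have uo k : u k.*2.+1 = (f (k, st k)).1.2 by rewrite /u /= odd_double /= uphalf_double.
have Jx0 i : J i 0 by apply: frac0.
have JD i x y : J i x -> J i y -> J i (x + y) by apply: fracD.
have CE i x := @combinations_scale _ J E Jx0 i x.
have CD := @combinationsD _ J E Jx0 JD.
have Uu i x := @combinations_scale _ (fun=> O) u (fun=> order0) i x.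
have UD := @combinationsD _ (fun=> O) u (fun=> order0) (fun _ => orderD).
have Ig k x : I k x -> combinations J E (x *: g k).
  case: k => [|k]; first exact: CE.
  have [_ _ _ [_ _ h _]] := hf (k, st k) => /h[y [z [Jy Jz ->]]].
  by apply: CD; apply: CE.
have Igu k x : I k x -> combinations (fun=> O) u (x *: g k).
  have [h _ _ _] := hf (k, st k) => /h[o1 [o2 [Oo1 Oo2 ->]]].
  by rewrite /= -ue -uo; apply: UD; apply: Uu.
exists u; split.
- move=> n; rewrite -[n]odd_double_half; set k := n./2.
  have [_ _ _ [[x [y [z [hx hy hz e1]]]] [x' [y' [z' [hx' hy' hz' e2]]]] _ _]] := hf (k, st k).
  case: odd; rewrite ?add0n ?add1n ?ue ?uo ?e1 ?e2 /=.
    exact: (CD _ _ (CD _ _ (Ig k _ hx') (CE _ _ hy')) (CE _ _ hz')).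
  exact: (CD _ _ (CD _ _ (Ig k _ hx) (CE _ _ hy)) (CE _ _ hz)).
- case=> [|n] x Jx; first exact: (Igu 0%N).
  rewrite -[n]odd_double_half in Jx *; set k := n./2 in Jx *.
  have [_ h1 h2 _] := hf (k, st k).
  case: odd Jx; rewrite ?add0n ?add1n => Jx.
    have [o1 [o2 [z [Oo1 Oo2 hz ->]]]] := h2 x Jx.
    rewrite /= -ue -uo.
    exact: (UD _ _ (UD _ _ (Uu _ _ Oo1) (Uu _ _ Oo2)) (Igu k.+1 _ hz)).
  have [o1 [o2 [z [Oo1 Oo2 hz ->]]]] := h1 x Jx.
  rewrite /= -ue -uo.
  exact: (UD _ _ (UD _ _ (Uu _ _ Oo1) (Uu _ _ Oo2)) (Igu k.+1 _ hz)).
(* What is built before step [k] has degree at most [k.*2], while the two new [E] have degrees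
   [k.*2.+1] and [k.*2.+2]. Reading off these coefficients kills [C], then [B]; the invertible
   change of basis does the rest. *)
have indep k : forall (c : nat -> F) ga, let P := \sum_(i < k.*2) c i *: u i + ga *: g k in
    (size P <= k.*2.+1)%N /\ (P = 0 -> (forall i, (i < k.*2)%N -> c i = 0) /\ ga = 0).
  elim: k => [|k IH] c ga /=.
    rewrite big_ord0 add0r; split; first by rewrite (leq_trans (size_scale_leq _ _)) // sE.
    move=> h; split=> // ; apply/eqP; move/eqP: h; rewrite scaler_eq0 => /orP[//|/eqP h].
    by have := sE 0%N; rewrite /g /= in h *; rewrite h size_poly0.
  rewrite doubleS !big_ord_recr /= uo ue.
  have [_ _ _ [_ _ _ h]] := hf (k, st k).
  have [A [B [C [e hABC]]]] := h (c k.*2) (c k.*2.+1) ga.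
  have [sz hz] := IH c A.
  set S := \sum_(i < k.*2) _ in sz hz *.
  have -> : S + c k.*2 *: (f (k, st k)).1.1 + c k.*2.+1 *: (f (k, st k)).1.2 + ga *: g k.+1 =
      S + A *: g k + B *: E k.*2.+1 + C *: E k.*2.+2.
    by rewrite -!addrA; congr (_ + _); rewrite !addrA.
  set Q := S + _ in sz hz *; clearbody Q.
  have sQ n : (k.*2 < n)%N -> Q`_n = 0 by move=> kn; apply: nth_default; exact: leq_trans sz _.
  have sEn n m : (m < n)%N -> (E m)`_n = 0 by move=> mn; rewrite nth_default // sE.
  have lE n : (E n)`_n != 0.
    have := lead_coef_eq0 (E n); rewrite lead_coefE sE /= => ->.
    by rewrite -size_poly_eq0 sE.
  split.
    rewrite (leq_trans (size_polyD _ _)) // geq_max (leq_trans (size_scale_leq _ _)) ?sE // andbT.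
    rewrite (leq_trans (size_polyD _ _)) // geq_max (leq_trans (size_scale_leq _ _)) ?sE // andbT.
    by apply: leq_trans sz _; rewrite ltnS -addn2 leq_addr.
  move=> P0.
  have C0 : C = 0.
    have /(congr1 (fun P : {poly F} => P`_k.*2.+2)) := P0.
    rewrite !coefD !coefZ coef0 sQ // sEn // mulr0 !add0r => /eqP.
    by rewrite mulf_eq0 (negPf (lE _)) orbF => /eqP.
  have B0 : B = 0.
    have /(congr1 (fun P : {poly F} => P`_k.*2.+1)) := P0.
    rewrite C0 scale0r addr0 !coefD !coefZ coef0 sQ // add0r => /eqP.
    by rewrite mulf_eq0 (negPf (lE _)) orbF => /eqP.
  move: P0; rewrite B0 C0 !scale0r !addr0 => /hz[ci A0].
  have [c1 c2 c3] := hABC A0 B0 C0; split=> // i; rewrite ltnS leq_eqVlt => /predU1P[->//|].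
  by rewrite ltnS leq_eqVlt => /predU1P[->//|]; apply: ci.
move=> n c c0 i ni.
have [_ h] := indep n (fun i => if (i < n)%N then c i else 0) 0.
have [|ci _] := h; last by have := ci i; rewrite ni; apply; rewrite -addnn ltn_addr.
rewrite scale0r addr0; transitivity (\sum_(i < n) c i *: u i) => //.
rewrite (big_ord_widen n.*2 (fun i => c i *: u i)) -?addnn ?leq_addr //.
by rewrite [RHS]big_mkcond /=; apply: eq_bigr => k _; case: ifP; rewrite ?scale0r.
Qed.
End FiniteQuotients.

(** * Modules with bounded denominators *)

Section LatticeModules.
Variables (F : fieldType) (A : comNzRingType) (io : {rmorphism A -> F}).
Variable V : lmodType A.
Hypothesis io_inj : injective io.

(** Linear dependence over the fraction field, expressed inside [V]; at [n = 0] it says that [x] is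
    torsion. *)
Definition dependent (e : nat -> V) (n : nat) (x : V) : Prop :=
  exists2 a : A, a != 0 & exists c : nat -> A, a *: x = \sum_(k < n) c k *: e k.

Lemma io_eq0 a : (io a == 0) = (a == 0).
Proof. by rewrite -(rmorph0 io) (inj_eq io_inj). Qed.

Lemma mulA_neq0 (a b : A) : a != 0 -> b != 0 -> a * b != 0.
Proof. by rewrite -!io_eq0 rmorphM mulf_eq0 => /negPf-> /negPf->. Qed.

Lemma dependentW e n m x : (n <= m)%N -> dependent e n x -> dependent e m x.
Proof.
move=> nm [a a0 [c ac]]; exists a => //; exists (fun k => if (k < n)%N then c k else 0).
rewrite ac (big_ord_widen m (fun k => c k *: e k)) // big_mkcond /=.
by apply: eq_bigr => k _; case: ifP; rewrite ?scale0r.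
Qed.

Lemma eq_dependent e e' n x : (forall k, (k < n)%N -> e k = e' k) ->
  dependent e n x -> dependent e' n x.
Proof.
move=> ee' [a a0 [c ac]]; exists a => //; exists c; rewrite ac.
by apply: eq_bigr => k _; rewrite ee'.
Qed.

Section Basis.
Variables (w : nat -> V) (w_surj : forall x, exists m, w m = x).
Hypothesis Hrank : forall e n, exists x, ~ dependent e n x.

(** Greedy choice: the next vector is the first element of the enumeration [w] that does not depend
    on those already chosen. *)
Lemma exists_maximal_independent : exists e : nat -> V,
  (forall n, ~ dependent e n (e n)) /\ forall x, exists n, dependent e n x.
Proof.
have hN (p : (nat -> V) * nat) : exists m, ~ dependent p.1 p.2 (w m) /\
    forall k, (k < m)%N -> dependent p.1 p.2 (w k).
  have hex : exists m, `[< ~ dependent p.1 p.2 (w m) >].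
    have [x hx] := Hrank p.1 p.2; have [m mx] := w_surj x.
    by exists m; apply/asboolP; rewrite mx.
  have [m /asboolP hm min] := ex_minnP hex; exists m; split=> // k km.
  apply: contrapT => hk; move: km; rewrite ltnNge => /negP; apply.
  by apply: min; apply/asboolP.
have [N hNP] := choice hN.
(* [g n] carries all of the first [n] choices, since the next one depends on the whole list. *)
pose g := fix g n : nat -> V := if n is k.+1 then
  fun i => if i == k then w (N (g k, k)) else g k i else fun=> 0.
pose e k := g k.+1 k.
have eE k : e k = w (N (g k, k)) by rewrite /e /= eqxx.
have ge n k : (k < n)%N -> g n k = e k.
  elim: n => [//|n IH]; rewrite ltnS leq_eqVlt => /predU1P[->//|kn] /=.
  by rewrite ltn_eqF // IH.
have gd n x : dependent (g n) n x <-> dependent e n x.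
  by split; apply: eq_dependent => k kn; rewrite ge.
have nd n : ~ dependent e n (e n).
  by move=> /gd; rewrite eE; have [] := hNP (g n, n).
have dS n : dependent e n.+1 (e n).
  exists 1; first exact: oner_neq0.
  exists (fun k => (k == n)%:R); rewrite scale1r big_ord_recr /= eqxx scale1r big1 ?add0r //.
  by move=> k _; rewrite ltn_eqF // scale0r.
(* The chosen indices increase strictly, so by the choice of rank [m.+1] the index [m] has been
   passed and [w m] is dependent. *)
have Nlt n : (N (g n, n) < N (g n.+1, n.+1))%N.
  rewrite ltnNge leq_eqVlt; apply/negP => /orP[/eqP h|h].
    by apply: (nd n.+1); rewrite (eE n.+1) h -eE.
  have [_ /(_ _ h) /gd h1] := hNP (g n, n).
  by have [h2 _] := hNP (g n.+1, n.+1); apply: h2; apply/gd; apply: dependentW h1.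
have Nge n : (n <= N (g n, n))%N.
  by elim: n => // n IH; apply: leq_ltn_trans IH (Nlt n).
exists e; split=> // x; have [m <-] := w_surj x; exists m.+1.
by have [_ h] := hNP (g m.+1, m.+1); apply/gd; apply: h; apply: leq_trans (Nge _).
Qed.
End Basis.

(** * Coordinates over the field [F] *)

Section Coordinates.
Variable e : nat -> V.
Hypothesis e_indep : forall n, ~ dependent e n (e n).
Hypothesis e_max : forall x, exists n, dependent e n x.

(** Polynomials over [A] stand for finitely supported coefficient sequences. *)
Definition comb (c : {poly A}) : V := \sum_(k < size c) c`_k *: e k.

Lemma comb_widen n (c : {poly A}) : (size c <= n)%N -> comb c = \sum_(k < n) c`_k *: e k.
Proof.
move=> cn; rewrite /comb (big_ord_widen n (fun k => c`_k *: e k)) // big_mkcond /=.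
by apply: eq_bigr => k _; case: ltnP => // h; rewrite nth_default // scale0r.
Qed.

Lemma comb_linear a (c c' : {poly A}) : comb (a *: c + c') = a *: comb c + comb c'.
Proof.
have [n [h1 h2 h3]] : exists n,
    [/\ (size c <= n)%N, (size c' <= n)%N & (size (a *: c + c')%R <= n)%N].
  exists (size c + size c' + size (a *: c + c')%R)%N; split; lia.
rewrite !(comb_widen (n := n)) // scaler_sumr -big_split /=; apply: eq_bigr => k _.
by rewrite coefD coefZ scalerDl scalerA.
Qed.

Lemma combZ a (c : {poly A}) : comb (a *: c) = a *: comb c.
Proof.
by rewrite -[a *: c]addr0 comb_linear {2}/comb size_poly0 big_ord0 addr0.
Qed.

Lemma comb_inj c : comb c = 0 -> c = 0.
Proof.
move=> c0; apply/eqP; rewrite -size_poly_eq0; case sc: (size c) => [//|n].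
have lc : c`_n != 0.
  by have := lead_coef_eq0 c; rewrite lead_coefE sc /= => ->; rewrite -size_poly_eq0 sc.
exfalso; apply: (e_indep (n := n)); exists (c`_n) => //; exists (fun k => - c`_k).
apply/eqP; rewrite -subr_eq0 -sumrN -{2}c0 /comb sc big_ord_recr /= addrC; apply/eqP; congr (_ + _).
by apply: eq_bigr => k _; rewrite scaleNr opprK.
Qed.

Lemma comb_poly n (c : nat -> A) : comb (\poly_(k < n) c k) = \sum_(k < n) c k *: e k.
Proof.
rewrite (comb_widen (size_poly _ _)); apply: eq_bigr => k _.
by rewrite coef_poly ltn_ord.
Qed.

Lemma combB a b (c c' : {poly A}) : comb (a *: c - b *: c') = a *: comb c - b *: comb c'.
Proof. by rewrite comb_linear -scaleNr combZ scaleNr. Qed.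

(** [P] is the coordinate vector of [x] over [F], and [a] a common denominator. The elements with
    [P = 0] are the torsion elements. *)
Definition has_coord (x : V) (P : {poly F}) : Prop :=
  exists2 a : A, a != 0 & exists2 c, a *: x = comb c & io a *: P = map_poly io c.

Lemma has_coord_uniq x P Q : has_coord x P -> has_coord x Q -> P = Q.
Proof.
move=> [a a0 [c ac aP]] [b b0 [c' bc bQ]].
have h : b *: c = a *: c'.
  apply/eqP; rewrite -subr_eq0; apply/eqP; apply: comb_inj.
  by rewrite combB -ac -bc !scalerA mulrC subrr.
have ab0 : io (a * b) != 0 by rewrite io_eq0 mulA_neq0.
apply: (scalerI ab0); rewrite rmorphM -[RHS]scalerA bQ mulrC -scalerA aP.
by rewrite -!map_polyZ h.
Qed.

Lemma has_coord_comb a x c : a != 0 -> a *: x = comb c ->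
  has_coord x ((io a)^-1 *: map_poly io c).
Proof.
move=> a0 ac; exists a => //; exists c => //.
by rewrite scalerA divff ?scale1r // io_eq0.
Qed.

Lemma has_coord_linear a x y P Q : has_coord x P -> has_coord y Q ->
  has_coord (a *: x + y) (io a *: P + Q).
Proof.
move=> [b b0 [c bc bP]] [b' b'0 [c' bc' bQ]].
exists (b * b'); first exact: mulA_neq0.
exists ((a * b') *: c + b *: c').
  rewrite comb_linear combZ -bc -bc' !scalerA scalerDr !scalerA.
  by congr (_ *: _ + _); ring.
rewrite rmorphD /= !map_polyZ -bP -bQ !scalerA scalerDr !scalerA -!rmorphM.
by congr (io _ *: _ + _); ring.
Qed.

Lemma exists_coord x : exists P, has_coord x P.
Proof.
have [n [a a0 [c ac]]] := e_max x.
by eexists; apply: (has_coord_comb a0); rewrite ac -comb_poly.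
Qed.

Lemma has_coord_size x P n : has_coord x P -> (size P <= n)%N -> dependent e n x.
Proof.
move=> [a a0 [c ac aP]] sP; exists a => //; exists (fun k => c`_k).
rewrite ac; apply: comb_widen; have := size_map_inj_poly io_inj (rmorph0 io) c.
by rewrite /= -aP => <-; rewrite (leq_trans (size_scale_leq _ _)).
Qed.

Lemma has_coord_basis n : has_coord (e n) 'X^n.
Proof.
exists 1; first exact: oner_neq0; exists 'X^n; last by rewrite rmorph1 scale1r map_polyXn.
rewrite scale1r /comb size_polyXn big_ord_recr /= coefXn eqxx scale1r big1 ?add0r //.
by move=> k _; rewrite coefXn ltn_eqF // scale0r.
Qed.
End Coordinates.

Hypothesis Hfin : forall c : A, c != 0 -> exists s : seq A,
  forall x, exists2 y, y \in s & exists z, x - y = c * z.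
Hypothesis Hic : forall c x : F, c != 0 -> (forall n, exists a, c * x ^+ n = io a) ->
  exists a, x = io a.
Hypothesis Vcount : exists w : nat -> V, forall x, exists m, w m = x.
Hypothesis Hrank : forall e n, exists x, ~ dependent e n x.
Hypothesis Hden : forall e n, exists2 d : A, d != 0 & forall x, dependent e n x ->
  exists c : nat -> A, d *: x = \sum_(k < n) c k *: e k.
Hypothesis Htor : forall d : A, d != 0 -> finite_set [set x : V | d *: x = 0].

(** The coordinate map has the torsion as kernel, and [Hden] at [n = 0] gives a single annihilator
    of it, whence finiteness. The image is filtered by degree; its leading coefficients in degree
    [n] form a fractional ideal because denominators are bounded for each [n]. These ideals are
    invertible, hence projective, so the filtration splits; a basis of the resulting sum lifts to a
    free complement of the torsion. *)
Theorem finite_torsion_plus_free : exists T M : set V,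
  [/\ torsion_submodule T, finite_set T, free_submodule_aleph0 M & is_direct_sum T M].
Proof.
have [w hw] := Vcount.
have [e [eind emax]] := exists_maximal_independent hw Hrank.
have [X hX] := choice (exists_coord emax).
have XE x P : has_coord e x P -> X x = P by move=> h; apply: has_coord_uniq (hX x) h.
have XL a x y : X (a *: x + y) = io a *: X x + X y by apply/XE/has_coord_linear.
have X0 : X 0 = 0.
  have := XL 0 0 0; rewrite rmorph0 !scale0r !add0r.
  by have := XL (-1) 0 0; rewrite rmorphN rmorph1 scaler0 addr0 scaleN1r addNr.
have XD x y : X (x + y) = X x + X y by have := XL 1 x y; rewrite rmorph1 !scale1r.
have XZ a x : X (a *: x) = io a *: X x by rewrite -[a *: x]addr0 XL X0 addr0.
have XB x y : X (x - y) = X x - X y.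
  by rewrite -scaleN1r addrC XL rmorphN rmorph1 scaleN1r addrC.
have Xsum n (f : 'I_n -> V) : X (\sum_i f i) = \sum_i X (f i).
  by apply: (big_morph X XD X0).
have Xe n : X (e n) = 'X^n by apply/XE/has_coord_basis.
have Xdep x n : (size (X x) <= n)%N -> dependent e n x by apply: has_coord_size.
pose O : set F := [set x | exists a, x = io a].
have O1 : O 1 by exists 1; rewrite rmorph1.
have OB x y : O x -> O y -> O (x - y).
  by move=> [a ->] [b ->]; exists (a - b); rewrite rmorphB.
have OM x y : O x -> O y -> O (x * y).
  by move=> [a ->] [b ->]; exists (a * b); rewrite rmorphM.
have Ofin c : O c -> c != 0 -> exists s : seq F, forall x, O x ->
    exists2 y, y \in s & exists2 z, O z & x - y = c * z.
  move=> [a ->]; rewrite io_eq0 => /Hfin[s hs]; exists (map io s) => _ [b ->].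
  have [y ys [z hz]] := hs b; exists (io y); first exact: map_f.
  by exists (io z); [exists z | rewrite -rmorphB hz rmorphM].
have Oic c x : c != 0 -> (forall n, O (c * x ^+ n)) -> O x by apply: Hic.
pose J n : set F := [set z | exists2 x, (size (X x) <= n.+1)%N & z = (X x)`_n].
have Jfrac n : is_fractional_ideal O (J n).
  split.
  - by exists 0; rewrite X0 ?size_poly0 ?coef0.
  - move=> _ _ [x sx ->] [y sy ->]; exists (x - y); rewrite XB ?coefB //.
    by rewrite (leq_trans (size_polyD _ _)) // geq_max sx size_polyN.
  - move=> _ _ [a ->] [x sx ->]; exists (a *: x); rewrite XZ ?coefZ //.
    by rewrite (leq_trans (size_scale_leq _ _)).
  - exists 1; last exact: oner_neq0.
    by exists (e n); rewrite Xe ?size_polyXn ?coefXn ?eqxx.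
  have [d d0 hd] := Hden e n.+1; exists (io d) => [|_ [x sx ->]]; first by rewrite io_eq0.
  have [c hc] := hd x (Xdep _ _ sx).
  have /(has_coord_comb d0)/XE -> : d *: x = comb e (\poly_(k < n.+1) c k) by rewrite comb_poly.
  rewrite coefZ mulrA divff ?mul1r ?io_eq0 // coef_map.
  by exists ((\poly_(k < n.+1) c k)`_n).
(* A relation [\sum_i al i * y i = 1] with [al i] in the inverse of [J n] is a section of the
   leading coefficient map: [c] goes to the combination of the [v i] with coefficients [c * al i] in
   [O]. *)
have hE n : exists E : {poly F}, [/\ (size E <= n.+1)%N, E`_n = 1 &
    forall c, J n c -> exists x, X x = c *: E].
  have [m [al [y [hal hy sE]]]] := fractional_invertible O1 OB OM Ofin Oic (Jfrac n).
  have {}hy i : exists v, (size (X v) <= n.+1)%N /\ y i = (X v)`_n.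
    by have [v ? ?] := hy i; exists v.
  have [v hv] := choice hy.
  exists (\sum_i al i *: X (v i)); split.
  - apply: (leq_trans (size_sum _ _ _)); apply/bigmax_leqP => i _.
    by rewrite (leq_trans (size_scale_leq _ _)) //; have [] := hv i.
  - rewrite coef_sum -[RHS]sE; apply: eq_bigr => i _.
    by rewrite coefZ; have [_ <-] := hv i.
  - move=> c Jc; have hac i : exists a, c * al i = io a by rewrite mulrC; apply: hal.
    have [a ha] := choice hac.
    exists (\sum_i a i *: v i); rewrite Xsum scaler_sumr; apply: eq_bigr => i _.
    by rewrite XZ -ha scalerA.
have [E {}hE] := choice hE.
have sE n : size (E n) = n.+1.
  have [s1 E1 _] := hE n; apply/eqP; rewrite eqn_leq s1 ltnNge; apply/negP => h.
  by move/eqP: E1; rewrite nth_default // eq_sym oner_eq0.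
have [u [uJ Ju uind]] := fractional_ideals_sum_free O1 OB OM Ofin Oic Jfrac sE.
have hb k : exists x, X x = u k.
  have [n [c [hc ->]]] := uJ k.
  have hx i : exists x, X x = c i *: E i by have [_ _] := hE i; apply.
  have [x {}hx] := choice hx; exists (\sum_(i < n) x i); rewrite Xsum.
  by apply: eq_bigr => i _; rewrite hx.
have [b {}hb] := choice hb.
have O0 : O 0 by exists 0; rewrite rmorph0.
have OD x y : O x -> O y -> O (x + y).
  by move=> [a1 ->] [a2 ->]; exists (a1 + a2); rewrite rmorphD.
have span x : combinations (fun=> O) u (X x).
  have [n] := ubnP (size (X x)); elim: n x => // n IH x; rewrite ltnS => sx.
  case: n => [|n] in IH sx *.
    move: sx; rewrite leqn0 size_poly_eq0 => /eqP->; exact: combinations0.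
  have Jc : J n (X x)`_n by exists x.
  have [s1 E1 /(_ _ Jc)[y hy]] := hE n.
  have -> : X x = X (x - y) + X y by rewrite XB subrK.
  apply: combinationsD => //; last by rewrite hy; apply: Ju.
  apply: IH; rewrite ltnS; apply/leq_sizeP => k; rewrite leq_eqVlt => /predU1P[<-|nk].
    by rewrite XB hy coefB coefZ E1 mulr1 subrr.
  by rewrite XB hy coefB coefZ (nth_default 0 (leq_trans sx nk)) (nth_default 0 (leq_trans s1 nk)) mulr0 subrr.
pose T := [set x : V | X x = 0].
pose M := [set x | exists n (c : nat -> A), x = \sum_(k < n) c k *: b k].
have Xcomb n (c : nat -> A) : X (\sum_(k < n) c k *: b k) = \sum_(k < n) io (c k) *: u k.
  by rewrite Xsum; apply: eq_bigr => k _; rewrite XZ hb.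
have indb n (c : nat -> A) : \sum_(k < n) io (c k) *: u k = 0 -> forall k, (k < n)%N -> c k = 0.
  by move=> /(uind n (fun k => io (c k))) h k /h /eqP; rewrite io_eq0 => /eqP.
exists T, M; split.
- split.
    split; first by rewrite inE.
    by move=> a x y; rewrite !inE /T /= XL => -> ->; rewrite scaler0 addr0.
  move=> x Tx; have [|a a0 [c ac]] := Xdep x 0%N; first by rewrite Tx size_poly0.
  by exists a => //; rewrite ac big_ord0.
- have [d d0 hd] := Hden e 0%N; apply: sub_finite_set (Htor d0) => x Tx /=.
  by have [|c ->] := hd x; [apply: Xdep; rewrite Tx size_poly0 | rewrite big_ord0].
- split.
    split; first by rewrite inE; exists 0%N, (fun=> 0); rewrite big_ord0.
    move=> a x y; rewrite !inE => -[n [c ->]] [m [c' ->]].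
    set p := a *: \poly_(k < n) c k + \poly_(k < m) c' k.
    exists (size p), (fun k => p`_k).
    by transitivity (comb b p); first by rewrite comb_linear !comb_poly.
  exists b; split=> // n c h; apply: indb; rewrite -Xcomb h; exact: X0.
- split.
    apply/seteqP; split=> x /=.
      move=> [Tx [n [c xE]]]; rewrite xE big1 // => k _.
      by rewrite (indb n c) ?scale0r // -Xcomb -xE.
    by move=> ->; split; [exact: X0 | exists 0%N, (fun=> 0); rewrite big_ord0].
  move=> x; have [n [o [Oo xE]]] := span x; have [c hc] := choice Oo.
  exists (x - \sum_(k < n) c k *: b k), (\sum_(k < n) c k *: b k); split.
  + rewrite /T /= XB Xcomb xE; apply/eqP; rewrite subr_eq0; apply/eqP.
    by apply: eq_bigr => k _; rewrite -hc.
  + by exists n, c.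
  + by rewrite subrK.
Qed.
End LatticeModules.

(** * Degrees of twisted polynomials *)

Lemma bounded_set_enum (T : eqType) (P : T -> Prop) (N : nat) :
  (forall s : seq T, uniq s -> (forall x, x \in s -> P x) -> (size s <= N)%N) ->
  exists s : seq T, uniq s /\ forall x, x \in s <-> P x.
Proof.
move=> hN.
pose Q n := `[< exists s : seq T, [/\ uniq s, forall x, x \in s -> P x & size s = n] >].
have exQ : exists n, Q n by exists 0%N; apply/asboolP; exists [::].
have ubQ n : Q n -> (n <= N)%N by move=> /asboolP[s [us sP <-]]; apply: hN.
have [n /asboolP[s [us sP sn]] hmax] := ex_maxnP exQ ubQ.
exists s; split=> // x; split; first exact: sP.
move=> Px; apply: contrapT => /negP xs.
have := hmax n.+1; rewrite ltnn => h; apply: notF; apply: h; apply/asboolP.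
exists (x :: s); rewrite /= xs us sn; split=> // y; rewrite inE => /predU1P[->//|]; exact: sP.
Qed.

(** The sum of [g] over a window of length [r] is nondecreasing and bounded. Once it is constant,
    sliding the window by one replaces [g n] by an equal [g (n + r)]. *)
Lemma bounded_nondecreasing_stabilizes (g : nat -> nat) (N r : nat) : (0 < r)%N ->
  (forall n, (g n <= N)%N) -> (forall n, (g n <= g (n + r))%N) ->
  exists n0, forall n, (n0 <= n)%N -> g (n + r)%N = g n.
Proof.
move=> r0 gN gr; pose s n := (\sum_(i < r) g (n + i))%N.
have sS n : (s n.+1 + g n = s n + g (n + r))%N.
  rewrite /s; case: r r0 {gr s} => // r _.
  rewrite big_ord_recr [in RHS]big_ord_recl /= addn0.
  have -> : (\sum_(i < r) g (n + bump 0 i) = \sum_(i < r) g (n.+1 + i))%N.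
    by apply: eq_bigr => i _; rewrite addSnnS.
  by rewrite (addSnnS n r); move: (\sum_(_ < _) _)%N => S; lia.
have smono n m : (n <= m)%N -> (s n <= s m)%N.
  move=> /subnK <-; elim: (m - n)%N => // k IH; apply: leq_trans IH _.
  by rewrite addSn -(leq_add2r (g (k + n)%N)) sS leq_add2l.
pose Q k := `[< exists n, s n = k >].
have exQ : exists k, Q k by exists (s 0%N); apply/asboolP; exists 0%N.
have ubQ k : Q k -> (k <= \sum_(i < r) N)%N.
  by move=> /asboolP[n <-]; apply: leq_sum.
have [k /asboolP[n0 sn0] hmax] := ex_maxnP exQ ubQ.
exists n0 => n n0n; have h m : (n0 <= m)%N -> s m = k.
  move=> hm; apply/eqP; rewrite eqn_leq -{2}sn0 smono // andbT.
  by apply: hmax; apply/asboolP; exists m.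
by have := sS n; rewrite !h ?(leq_trans n0n) //; lia.
Qed.

Section TwistedDegree.
Variables (Fq : finFieldType) (K : fieldType) (j : {rmorphism Fq -> K}).
Local Notation q := #|Fq|.
Implicit Types f g : twpoly j.

Definition twsize f : nat := size (f : {poly K}).

Lemma twcoefM f g n :
  twcoef (f * g) n = \sum_(m < n.+1) twcoef f m * twcoef g (n - m) ^+ (q ^ m).
Proof.
pose N := (n.+1 + twsize f + twsize g)%N.
have fN : (size (f : {poly K}) <= N)%N by rewrite /N /twsize; lia.
have gN : (size (g : {poly K}) <= N)%N by rewrite /N /twsize; lia.
have nN : (n.+1 <= N)%N by rewrite /N; lia.
rewrite /twcoef -[f * g]/(twmul Fq (f : {poly K}) (g : {poly K})) (twmul_widen _ fN gN).
rewrite coef_sum (big_ord_widen N (fun m => twcoef f m * twcoef g (n - m) ^+ (q ^ m))) //.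
rewrite [RHS]big_mkcond /=; apply: eq_bigr => m _; rewrite coef_sum ltnS.
case: leqP => [mn|nm]; last first.
  by apply: big1 => k _; rewrite coefZ coefXn eq_sym gtn_eqF ?mulr0 // ltn_addr.
have kN : (n - m < N)%N by apply: leq_trans nN; rewrite ltnS leq_subr.
rewrite (bigD1 (Ordinal kN)) //= coefZ coefXn subnKC // eqxx mulr1 big1 ?addr0 //.
move=> k /eqP hk; rewrite coefZ coefXn; case: eqP => [nE|]; last by rewrite mulr0.
by case: hk; apply/val_inj; rewrite /= nE addKn.
Qed.

Lemma twcoef_lead_neq0 f n : twsize f = n.+1 -> twcoef f n != 0.
Proof.
move=> sf; have := lead_coef_eq0 (f : {poly K}).
by rewrite lead_coefE -/(twsize f) sf /= => ->; rewrite -size_poly_eq0 -/(twsize f) sf.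
Qed.

Lemma twcoef_default f n : (twsize f <= n)%N -> twcoef f n = 0.
Proof. by move=> h; rewrite /twcoef nth_default. Qed.

Lemma twpolyP f g : (forall n, twcoef f n = twcoef g n) -> f = g.
Proof. by move=> h; apply/polyP => n; apply: h. Qed.

Lemma twcoefB f g n : twcoef (f - g) n = twcoef f n - twcoef g n.
Proof. by rewrite /twcoef coefB. Qed.

Lemma twcoefM_lead f g m n : twsize f = m.+1 -> twsize g = n.+1 ->
  twcoef (f * g) (m + n) = twcoef f m * twcoef g n ^+ (q ^ m).
Proof.
move=> sf sg; rewrite twcoefM.
have mS : (m < (m + n).+1)%N by rewrite ltnS leq_addr.
rewrite (bigD1 (Ordinal mS)) //= addKn big1 ?addr0 // => k /eqP hk.
have [km|mk|km] := ltngtP k m.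
- rewrite (twcoef_default (f := g)) ?frob0 ?mulr0 // sg; lia.
- by rewrite (twcoef_default (f := f)) ?mul0r // sf.
- by case: hk; apply/val_inj.
Qed.

Lemma twsizeM f g m n : twsize f = m.+1 -> twsize g = n.+1 -> twsize (f * g) = (m + n).+1.
Proof.
move=> sf sg; apply/eqP; rewrite eqn_leq; apply/andP; split.
  apply/leq_sizeP => k mnk; rewrite -/(twcoef (f * g) k) twcoefM big1 // => l _.
  have [lm|ml] := leqP l m.
    by rewrite (twcoef_default (f := g)) ?frob0 ?mulr0 // sg; lia.
  by rewrite (twcoef_default (f := f)) ?mul0r // sf.
rewrite ltnNge; apply/negP => h.
have := twcoefM_lead sf sg; rewrite twcoef_default // => /esym/eqP.
by rewrite mulf_eq0 expf_eq0 (negPf (twcoef_lead_neq0 sf)) (negPf (twcoef_lead_neq0 sg)) andbF.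
Qed.

Lemma twsize0 f : (twsize f == 0%N) = (f == 0).
Proof. exact: size_poly_eq0. Qed.

Lemma twsize1 : twsize (1 : twpoly j) = 1%N.
Proof. exact: size_poly1. Qed.

Lemma frob_inj i : injective (fun x : K => x ^+ (q ^ i)).
Proof.
move=> x y /eqP; rewrite -subr_eq0 => /eqP h; apply/eqP; rewrite -subr_eq0.
suff /eqP : (x - y) ^+ (q ^ i) = 0 by rewrite expf_eq0 => /andP[].
have := frobD j (x - y) y i; rewrite subrK => e.
by apply: (addIr (y ^+ (q ^ i))); rewrite -e add0r; apply/eqP; rewrite -subr_eq0 h.
Qed.

Section Drinfeld.
Variables (A : comNzRingType) (phi : {rmorphism A -> twpoly j}).
Hypothesis phi_inj : forall a, phi a = 0 -> a = 0.
Variables (t : A) (r : nat).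
Hypotheses (r0 : (0 < r)%N) (ht : twsize (phi t) = r.+1).
Local Notation u := (twcoef (phi t) r).

Let commutes a : phi a * phi t = phi t * phi a.
Proof. by rewrite -!rmorphM mulrC. Qed.

(** Top coefficients of two equal products. The leading coefficients in degree [n] are thus roots of
    one polynomial of degree [q ^ r], the source of the finiteness statements about [A]. *)
Lemma lead_commutes a n : twsize (phi a) = n.+1 ->
  twcoef (phi a) n * u ^+ (q ^ n) = u * twcoef (phi a) n ^+ (q ^ r).
Proof.
move=> sa; rewrite -(twcoefM_lead sa ht) -(twcoefM_lead ht sa) commutes.
by rewrite addnC.
Qed.

Definition lead_at (n : nat) (c : K) : Prop :=
  exists2 a, twsize (phi a) = n.+1 & twcoef (phi a) n = c.

Lemma lead_at_bounded n (s : seq K) : uniq s -> (forall c, c \in s -> lead_at n c) ->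
  (size s <= q ^ r)%N.
Proof.
move=> us hs; pose P : {poly K} := u *: 'X^(q ^ r) - (u ^+ (q ^ n)) *: 'X.
have q1 : (1 < q ^ r)%N.
  by rewrite -[1%N](expn0 q) ltn_exp2l // card_finNzRing_gt1.
have u0 := twcoef_lead_neq0 ht.
have sP : size P = (q ^ r).+1.
  rewrite size_polyDl; first by rewrite size_scale // size_polyXn.
  by rewrite size_polyN !size_scale ?expf_neq0 // size_polyX size_polyXn ltnS.
have : (size s < size P)%N.
  apply: max_poly_roots => //; first by rewrite -size_poly_eq0 sP.
  apply/allP => c /hs[a sa <-]; rewrite /root !hornerE ?hornerXn -(lead_commutes sa).
  by rewrite mulrC subrr.
by rewrite sP ltnS.
Qed.

(** Induction on the degree: there are finitely many leading coefficients, and subtracting a fixed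
    element with the same one lowers the degree. *)
Lemma exists_bounded_size_enum n : exists s : seq A, forall a, (twsize (phi a) <= n)%N -> a \in s.
Proof.
elim: n => [|n [s hs]].
  exists [:: 0] => a; rewrite leqn0 twsize0 => /eqP/phi_inj ->; exact: mem_head.
have [L [uL hL]] := bounded_set_enum (@lead_at_bounded n).
have hr c : exists a, lead_at n c -> twsize (phi a) = n.+1 /\ twcoef (phi a) n = c.
  by have [[a h1 h2]|] := pselect (lead_at n c); [exists a | exists 0].
have {hr}[rp hrp] := choice hr.
exists (s ++ [seq rp c + y | c <- L, y <- s]) => a.
rewrite leq_eqVlt mem_cat => /orP[/eqP sa|h]; last by rewrite hs.
apply/orP; right; pose c := twcoef (phi a) n.
have lc : lead_at n c by exists a.
have [h1 h2] := hrp c lc; apply/allpairsP; exists (c, a - rp c).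
split=> /=; [exact/hL | | by rewrite addrC subrK].
apply: hs; apply/leq_sizeP => k; rewrite rmorphB leq_eqVlt => /predU1P[<-|nk].
  by rewrite -/(twcoef _ n) twcoefB h2 subrr.
by rewrite -/(twcoef _ k) twcoefB !twcoef_default ?subrr ?sa ?h1.
Qed.

(* For large [n] multiplication by [b] maps onto the leading coefficients in degree [n + m]. *)
Lemma eventually_divisible_lead b m : (0 < m)%N -> twsize (phi b) = m.+1 -> exists n0,
  forall a, (n0 < twsize (phi a))%N ->
  exists z, (twsize (phi z) < twsize (phi a))%N /\
            (twsize (phi (a - b * z)%R) < twsize (phi a))%N.
Proof.
move=> m0 sb.
have hL n := bounded_set_enum (@lead_at_bounded n).
have {hL}[L hL] := choice hL.
have ub0 := twcoef_lead_neq0 sb; set ub := twcoef (phi b) m in ub0.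
pose h c := ub * c ^+ (q ^ m).
have hinj : injective h by move=> x y /(mulfI ub0)/frob_inj.
have hLm n c : c \in L n -> h c \in L (n + m)%N.
  have [_ hn] := hL n; have [_ hm] := hL (n + m)%N => /hn[a sa <-]; apply/hm.
  exists (b * a); rewrite rmorphM (addnC n); first exact: twsizeM sb sa.
  exact: twcoefM_lead sb sa.
(* [h] embeds [L n] into [L (n + m)], and all these lists have at most [q ^ r] elements. Their sizes
   become constant along steps of [m], and from then on [h] is onto. *)
have [n0 hn0] : exists n0, forall n, (n0 <= n)%N -> size (L (n + m)%N) = size (L n).
  apply: (bounded_nondecreasing_stabilizes (N := (q ^ r)%N)) => // n.
    by have [uL hn] := hL n; exact: (lead_at_bounded uL (fun c => proj1 (hn c))).
  have [uL _] := hL n; rewrite -(size_map h); apply: uniq_leq_size; first by rewrite map_inj_uniq.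
  by move=> _ /mapP[c cL ->]; apply: hLm.
exists (n0 + m)%N => a sa; pose n := (twsize (phi a) - m).-1.
have sa' : twsize (phi a) = (n + m).+1 by rewrite /n; lia.
have [uL hn] := hL n; have [uLm hnm] := hL (n + m)%N.
have : twcoef (phi a) (n + m) \in map h (L n).
  have [||| _ ->] := @uniq_min_size _ (map h (L n)) (L (n + m)%N).
  - by rewrite map_inj_uniq.
  - by move=> _ /mapP[c cL ->]; apply: hLm.
  - by rewrite size_map hn0 // /n; lia.
  - by apply/hnm; exists a.
move=> /mapP[_ /hn[z sz <-] hz]; exists z; split; first by rewrite sz sa'; lia.
have sbz := twsizeM sb sz; rewrite -rmorphM addnC in sbz.
have lbz := twcoefM_lead sb sz; rewrite -rmorphM addnC -/ub -/(h _) -hz in lbz.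
rewrite sa' ltnS; apply/leq_sizeP => k; rewrite rmorphB leq_eqVlt => /predU1P[<-|nk].
  by rewrite -/(twcoef _ (n + m)) twcoefB lbz subrr.
by rewrite -/(twcoef _ k) twcoefB !twcoef_default ?subrr ?sa' ?sbz.
Qed.

Lemma finite_quotient (c : A) : c != 0 -> exists s : seq A,
  forall x, exists2 y, y \in s & exists z, x - y = c * z.
Proof.
move=> c0; have : twsize (phi c) != 0%N.
  by rewrite twsize0; apply: contraNneq c0 => /phi_inj ->.
case sc: (twsize (phi c)) => [//|m] _.
have [|m0] := posnP m; last first.
  have [n0 hn0] := eventually_divisible_lead m0 sc.
  have [s hs] := exists_bounded_size_enum n0; exists s => x.
  have [k] := ubnP (twsize (phi x)); elim: k x => // k IH x; rewrite ltnS => sx.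
  have [h|h] := leqP (twsize (phi x)) n0.
    by exists x; [exact: hs | exists 0; rewrite subrr mulr0].
  have [z [_ hz]] := hn0 x h; have [|y ys [z' hz']] := IH (x - c * z).
    exact: leq_trans hz sx.
  exists y => //; exists (z + z'); rewrite mulrDr -hz'; ring.
(* If [phi c] is a constant [v], commuting with [phi t] gives [v ^+ (q ^ r) = v]. By injectivity
   [c ^+ k = 1] for [k = q ^ r - 1], so [c] is a unit and a single class remains. *)
move=> m0; rewrite m0 in sc; exists [:: 0] => x; exists 0; first exact: mem_head.
have hc := lead_commutes sc; rewrite expn0 expr1 mulrC in hc.
have /mulfI /(_ _ _ hc) e : u != 0 by apply: twcoef_lead_neq0.
pose k := (q ^ r).-1; have kE : (q ^ r = k.+1)%N by rewrite /k prednK // (q_gt0 Fq).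
set v := twcoef (phi c) 0 in hc e.
have v0 : v != 0 by apply: twcoef_lead_neq0.
have vk : v ^+ k = 1.
  by apply: (mulfI v0); rewrite mulr1 -exprS -kE -e.
have phiX n : phi (c ^+ n) = ((v ^+ n) *: 'X^0 : {poly K}) :> twpoly j.
  elim: n => [|n IH]; first by rewrite expr0 rmorph1 expr0 scale1r expr0.
  have -> : phi (c ^+ n.+1) = phi c * phi (c ^+ n) by rewrite -rmorphM exprS.
  have -> : phi c = (v *: 'X^0 : {poly K}) :> twpoly j.
    apply: twpolyP => -[|l]; rewrite /twcoef expr0 alg_polyC coefC //=.
    by rewrite nth_default // -/(twsize _) sc.
  by rewrite IH -[LHS]/(twmul _ _ _) twmul_monomial expn0 expr1 addn0 exprS.
have ck : c ^+ k = 1.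
  apply/eqP; rewrite -subr_eq0; apply/eqP/phi_inj; rewrite rmorphB phiX vk scale1r expr0.
  by rewrite rmorph1; apply: subrr.
have [k0|k0] := posnP k.
  have := card_finNzRing_gt1 Fq => q1.
  have : (1 < q ^ r)%N by rewrite -[1%N](expn0 q) ltn_exp2l.
  by rewrite kE k0.
by exists (c ^+ k.-1 * x); rewrite subr0 mulrA -exprS prednK // ck mul1r.
Qed.

(** Division by [t] leaves a smaller quotient and a smaller remainder until the degree is bounded.
    The induction principle expresses generation by [s] over polynomials in [t] without fixing their
    coefficients. *)
Lemma finitely_generated_over_powers : exists s : seq A, forall P : A -> Prop,
  (forall x, x \in s -> P x) -> (forall x y, P x -> P y -> P (x + y)) ->
  (forall x, P x -> P (t * x)) -> forall x, P x.
Proof.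
have [n0 hn0] := eventually_divisible_lead r0 ht.
have [s hs] := exists_bounded_size_enum n0; exists s => P Ps PD Pt x.
have [k] := ubnP (twsize (phi x)); elim: k x => // k IH x; rewrite ltnS => sx.
have [h|h] := leqP (twsize (phi x)) n0; first by apply: Ps; apply: hs.
have [z [h1 h2]] := hn0 x h.
rewrite -[x](subrK (t * z)); apply: PD; first by apply: IH; apply: leq_trans h2 sx.
by apply: Pt; apply: IH; apply: leq_trans h1 sx.
Qed.
End Drinfeld.
End TwistedDegree.

(** * Algebraic elements over subfields *)

Section SubfieldType.
Variables (F : fieldType) (E : set F) (hE : GRing.divring_closed (mem E)).

(** With the closure proof as an argument, the predicate carries its own instance. The field type
    built on it gives access to the theory of integral elements. *)
Definition subfield_pred of GRing.divring_closed (mem E) : {pred F} := mem E.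

Fact subfield_pred_closed : GRing.divring_closed (subfield_pred hE).
Proof. exact: hE. Qed.

HB.instance Definition _ :=
  GRing.isDivringClosed.Build F (subfield_pred hE) subfield_pred_closed.

Record subfield_of := SubfieldOf { subfield_val :> F; _ : subfield_val \in subfield_pred hE }.

HB.instance Definition _ := [isSub for subfield_val].
HB.instance Definition _ := [Choice of subfield_of by <:].
HB.instance Definition _ := [SubChoice_isSubIntegralDomain of subfield_of by <:].
HB.instance Definition _ := [SubIntegralDomain_isSubField of subfield_of by <:].

Lemma algebraic_over_integral x :
  algebraic_over E x <-> integralOver (val : subfield_of -> F) x.
Proof.
rewrite -integral_algebraic; split.
  move=> [P P0 [EP Px]].
  have [p hp] : exists p : {poly subfield_of}, map_poly val p = P.
    have h n : (P`_n) \in subfield_pred hE by apply/asboolP; apply: EP.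
    exists (\poly_(n < size P) SubfieldOf (h n)); apply/polyP => n.
    rewrite coef_map coef_poly; case: ltnP => // nP.
    by rewrite nth_default.
  by exists p; rewrite ?hp // -(map_poly_eq0 (val : subfield_of -> F)) hp.
move=> [p p0 px]; exists (map_poly val p); first by rewrite map_poly_eq0.
split=> // i; rewrite coef_map; by have /asboolP := valP (p`_i).
Qed.

Lemma algebraic_over_self x : E x -> algebraic_over E x.
Proof.
move=> Ex; apply/algebraic_over_integral.
have Ex' : x \in subfield_pred hE by apply/asboolP.
exact: (integral_id _ (SubfieldOf Ex')).
Qed.

Lemma algebraic_over_closed : GRing.divring_closed (mem [set x | algebraic_over E x]).
Proof.
split.
- by apply/asboolP/algebraic_over_integral; apply: integral1.
- move=> x y /asboolP/algebraic_over_integral hx /asboolP/algebraic_over_integral hy.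
  by apply/asboolP/algebraic_over_integral; apply: integral_sub.
- move=> x y /asboolP/algebraic_over_integral hx /asboolP/algebraic_over_integral hy.
  by apply/asboolP/algebraic_over_integral; apply: integral_div.
Qed.

Lemma algebraic_over_root (P : {poly F}) x : P != 0 -> (forall i, algebraic_over E P`_i) ->
  root P x -> algebraic_over E x.
Proof.
move=> P0 hP Px; apply/algebraic_over_integral; apply: integral_root P0 Px _.
by move=> _ /(nthP 0)[i _ <-]; apply/algebraic_over_integral.
Qed.
End SubfieldType.

Section SubfieldGenerated.
Variable F : fieldType.

Lemma subfield_generated_min (B E : set F) : GRing.divring_closed (mem E) -> B `<=` E ->
  subfield_generated B `<=` E.
Proof. by move=> hE BE; apply: smallest_sub. Qed.

End SubfieldGenerated.

Section PolyValue.
Variables (k : fieldType) (A : comNzRingType) (f : {rmorphism k -> A}).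

Definition poly_value (x : A) : {poly k} -> A := horner_eval x \o map_poly f.
HB.instance Definition _ x := GRing.RMorphism.on (poly_value x).

Lemma poly_valueC x c : poly_value x c%:P = f c.
Proof. by rewrite /poly_value /= /horner_eval map_polyC hornerC. Qed.

Lemma poly_valueX x : poly_value x 'X = x.
Proof. by rewrite /poly_value /= /horner_eval map_polyX hornerX. Qed.

Lemma poly_valueE x (p : {poly k}) n : (size p <= n)%N ->
  poly_value x p = \sum_(i < n) f p`_i * x ^+ i.
Proof.
move=> pn; rewrite /poly_value /= /horner_eval (@horner_coef_wide _ n).
  by apply: eq_bigr => i _; rewrite coef_map.
by rewrite (leq_trans (size_poly _ _)).
Qed.
End PolyValue.

(** * Algebraic dependence in transcendence degree one *)

Section TwoElements.
Variables (k F : fieldType) (f : {rmorphism k -> F}).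
Local Notation poly_value := (poly_value f).
Local Notation poly_valueE := (poly_valueE f).

(** A square array of coefficients makes the relation symmetric: exchanging [x] and [y] is a
    transposition. *)
Definition dependent_pair (x y : F) : Prop := exists N (c : 'I_N -> 'I_N -> k),
  (exists i l, c i l != 0) /\ \sum_i \sum_l f (c i l) * (x ^+ i * y ^+ l) = 0.

Lemma dependent_pair_sym x y : dependent_pair x y -> dependent_pair y x.
Proof.
move=> [N [c [[i [l h]] e]]]; exists N, (fun i l => c l i); split; first by exists l, i.
rewrite exchange_big -[RHS]e /=; apply: eq_bigr => n _; apply: eq_bigr => m _.
by rewrite (mulrC (y ^+ _)).
Qed.

Definition fraction_field (x : F) : set F :=
  [set z | exists p q, poly_value x q != 0 /\ z = poly_value x p / poly_value x q].

Lemma fraction_field_closed x : GRing.divring_closed (mem (fraction_field x)).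
Proof.
split.
- by apply/asboolP; exists 1, 1; rewrite rmorph1 oner_neq0 divr1.
- move=> _ _ /asboolP[p [q [q0 ->]]] /asboolP[p' [q' [q'0 ->]]]; apply/asboolP.
  exists (p * q' - p' * q), (q * q'); rewrite rmorphB !rmorphM /= mulf_neq0 //; split=> //.
  by field; rewrite q0 q'0.
move=> _ _ /asboolP[p [q [q0 ->]]] /asboolP[p' [q' [q'0 ->]]]; apply/asboolP.
have [p'0|p'0] := eqVneq (poly_value x p') 0.
  by exists 0, 1; rewrite p'0 rmorph1 oner_neq0 rmorph0 !mul0r invr0 mulr0.
exists (p * q'), (q * p'); rewrite !rmorphM /= mulf_neq0 //; split=> //.
by field; rewrite q0 q'0 p'0.
Qed.

Lemma fraction_field_const x : range f `<=` fraction_field x.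
Proof.
by move=> _ [c _ <-]; exists c%:P, 1; rewrite rmorph1 oner_neq0 divr1 poly_valueC.
Qed.

Lemma fraction_field_gen x : fraction_field x x.
Proof. by exists 'X, 1; rewrite rmorph1 oner_neq0 divr1 poly_valueX. Qed.

Lemma algebraic_over_dependent x y : algebraic_over (fraction_field x) y -> dependent_pair x y.
Proof.
move=> [P P0 [EP Py]].
have [D D0 hD] : exists2 D, poly_value x D != 0 & forall i, (i < size P)%N ->
    exists p, poly_value x D * P`_i = poly_value x p.
  elim: (size P) => [|n [D D0 hD]]; first by exists 1; rewrite ?rmorph1 ?oner_neq0.
  have [p [q [q0 e]]] := EP n; exists (D * q); first by rewrite rmorphM mulf_neq0.
  move=> i; rewrite ltnS leq_eqVlt => /predU1P[->|/hD[p' hp']].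
    by exists (D * p); rewrite e !rmorphM /=; field.
  by exists (p' * q); rewrite !rmorphM /= -hp'; ring.
have {}hD i : exists p, (size P <= i)%N \/ poly_value x D * P`_i = poly_value x p.
  have [h|h] := leqP (size P) i; first by exists 0; left.
  by have [p hp] := hD i h; exists p; right.
have [p hp] := choice hD.
pose N := (size P + \sum_(i < size P) size (p i))%N.
have sN i : (i < size P)%N -> (size (p i) <= N)%N.
  by move=> iP; rewrite /N (bigD1 (Ordinal iP)) //=; lia.
have PN : (size P <= N)%N by rewrite leq_addr.
have vE i : (i < size P)%N -> poly_value x D * P`_i = poly_value x (p i).
  by move=> iP; have [|//] := hp i; rewrite leqNgt iP.
exists N, (fun i l : 'I_N => if (l < size P)%N then (p l)`_i else 0); split.
  have sP : (size P).-1.+1 = size P by rewrite prednK // lt0n size_poly_eq0.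
  have lP : ((size P).-1 < size P)%N by rewrite sP.
  have pl0 : p (size P).-1 != 0.
    apply: contra_neq (P0) => h; have := vE _ lP; rewrite h rmorph0 => /eqP.
    by rewrite mulf_eq0 (negPf D0) /= -lead_coefE lead_coef_eq0 => /eqP.
  have spl : (size (p (size P).-1)).-1.+1 = size (p (size P).-1) by rewrite prednK // lt0n size_poly_eq0.
  have h1 : ((size (p (size P).-1)).-1 < N)%N by rewrite spl sN.
  have h2 : ((size P).-1 < N)%N by rewrite sP.
  by exists (Ordinal h1), (Ordinal h2); rewrite /= lP -lead_coefE lead_coef_eq0.
rewrite exchange_big /=; transitivity (\sum_(l < N) poly_value x D * P`_l * y ^+ l); last first.
  move/rootP: Py; rewrite (horner_coef_wide y PN) => Py.
  by under eq_bigr => l _ do rewrite -mulrA; rewrite -mulr_sumr Py mulr0.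
apply: eq_bigr => l _; case: ltnP => lP; last first.
  rewrite (nth_default 0 lP) mulr0 mul0r big1 // => i _.
  by rewrite rmorph0 mul0r.
rewrite (vE l lP) (poly_valueE x (sN l lP)) mulr_suml; apply: eq_bigr => i _.
by rewrite mulrA.
Qed.

Lemma dependent_pair_algebraic x y : (forall p, p != 0 -> poly_value x p != 0) ->
  dependent_pair x y -> algebraic_over (fraction_field x) y.
Proof.
move=> trx [N [c [[i [l h]] e]]].
pose p m : {poly k} := \poly_(n < N) (if insub n is Some n' then
   if insub m is Some m' then c n' m' else 0 else 0).
have pc n (m : 'I_N) : (n : 'I_N) \in 'I_N -> (p m)`_n = c n m.
  by move=> _; rewrite coef_poly ltn_ord !valK.
have {}pc n (m : 'I_N) : (p m)`_(n : 'I_N) = c n m by apply: pc.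
exists (\poly_(m < N) poly_value x (p m)).
  apply/eqP => /polyP/(_ l); rewrite coef_poly ltn_ord coef0 => /eqP.
  apply/negP; apply: trx; apply/eqP => /polyP/(_ i); rewrite pc coef0.
  by move/eqP: h.
split.
  move=> m; rewrite coef_poly; case: ifP => _; last first.
    by exists 0, 1; rewrite rmorph1 rmorph0 oner_neq0 mul0r.
  by exists (p m), 1; rewrite rmorph1 oner_neq0 divr1.
apply/rootP; rewrite horner_poly -[RHS]e [RHS]exchange_big /=; apply: eq_bigr => m _.
rewrite (poly_valueE x (n := N)) ?size_poly // mulr_suml; apply: eq_bigr => n _.
by rewrite pc mulrA.
Qed.

(** Exchange: if [x] is transcendental, its dependence on the basis element [b] can be turned
    around, so [b] is algebraic over the field of [x], and then so is [y]. *)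
Lemma trdeg1_dependent_pair x y : has_trdeg (range f) [set: F] 1 -> dependent_pair x y.
Proof.
move=> [B [_ _ Balg] /card_set_bijP[g [gfun ginj gsurj]]].
have [b Bb gb] := gsurj 0%N isT.
have BE z : range f `<=` fraction_field z -> fraction_field z b ->
    subfield_generated (range f `|` B) `<=` fraction_field z.
  move=> h1 h2; apply: subfield_generated_min; first exact: fraction_field_closed.
  move=> c [/h1//|Bc]; have := gfun c Bc; rewrite /= ltnS leqn0 => /eqP gc.
  by rewrite (ginj c b) ?inE // gc gb.
have [[p [p0 px]]|trx] := pselect (exists p, p != 0 /\ poly_value x p = 0).
  pose N := size p; have N0 : (0 < N)%N by rewrite lt0n size_poly_eq0.
  exists N, (fun i l => if l == Ordinal N0 then p`_i else 0); split.
    have h : (N.-1 < N)%N by rewrite prednK.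
    by exists (Ordinal h), (Ordinal N0); rewrite eqxx /= -lead_coefE lead_coef_eq0.
  rewrite -[RHS]px (poly_valueE x (leqnn _)); apply: eq_bigr => i _.
  rewrite (bigD1 (Ordinal N0)) //= ?eqxx expr0 mulr1 big1 ?addr0 // => l /negPf->.
  by rewrite rmorph0 mul0r.
have {}trx p : p != 0 -> poly_value x p != 0.
  by move=> p0; apply/negP => /eqP px; apply: trx; exists p.
have alg_mono (E E' : set F) z : E `<=` E' -> algebraic_over E z -> algebraic_over E' z.
  by move=> EE' [P P0 [EP Pz]]; exists P => //; split=> // i; apply: EE'.
have hb : algebraic_over (fraction_field x) b.
  apply: dependent_pair_algebraic => //; apply: dependent_pair_sym.
  apply: algebraic_over_dependent; apply: alg_mono (Balg x I); apply: BE.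
    exact: fraction_field_const.
  exact: fraction_field_gen.
have hx := fraction_field_closed x.
have [P P0 [EP Py]] := Balg y I.
apply: algebraic_over_dependent; apply: (algebraic_over_root hx P0) Py => i.
have : subfield_generated (range f `|` B) `<=` [set z | algebraic_over (fraction_field x) z].
  apply: subfield_generated_min; first exact: algebraic_over_closed.
  move=> c [hc|Bc]; first by apply: algebraic_over_self => //; apply: fraction_field_const.
  have := gfun c Bc; rewrite /= ltnS leqn0 => /eqP gc.
  by rewrite (ginj c b) ?inE // gc gb.
by apply.
Qed.
End TwoElements.

(** * The ring of functions away from a point *)

Section ValuationBasics.
Variables (F : fieldType) (v : F -> int) (hv : is_valuation v).

Lemma valuationM x y : x != 0 -> y != 0 -> v (x * y) = v x + v y.
Proof. by case: hv => _ h _ _; apply: h. Qed.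

Lemma valuationX x n : x != 0 -> v (x ^+ n) = v x *+ n.
Proof.
move=> x0; elim: n => [|n IH]; first by rewrite expr0 valuation1.
by rewrite exprS valuationM ?expf_neq0 // IH mulrS.
Qed.

Lemma valuation_root_of_unity x n : (0 < n)%N -> x ^+ n = 1 -> v x = 0.
Proof.
move=> n0 xn; have x0 : x != 0.
  by apply: contra_eq_neq xn => ->; rewrite expr0n gtn_eqF // eq_sym oner_neq0.
have := valuationX n x0; rewrite xn valuation1 // => /esym/eqP.
by rewrite mulrn_eq0 gtn_eqF //= => /eqP.
Qed.

Lemma valuationV x : x != 0 -> v x^-1 = - v x.
Proof.
move=> x0; apply/eqP; rewrite -addr_eq0 addrC -valuationM ?invr_eq0 // divff //.
by rewrite valuation1.
Qed.
End ValuationBasics.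

Lemma finField_expr_card1 (Fq : finFieldType) (c : Fq) : c != 0 -> c ^+ #|Fq|.-1 = 1.
Proof.
move=> c0; apply: (mulfI c0); rewrite -exprS prednK ?expf_card ?mulr1 //.
by rewrite ltnW // card_finNzRing_gt1.
Qed.

Lemma valuation_finField (Fq : finFieldType) (F : fieldType) (f : {rmorphism Fq -> F})
  (v : F -> int) (c : Fq) : is_valuation v -> v (f c) = 0.
Proof.
move=> hv; have [->|c0] := eqVneq c 0; first by rewrite rmorph0; case: hv.
apply: (valuation_root_of_unity hv (n := #|Fq|.-1)).
  by rewrite -subn1 subn_gt0; apply: card_finNzRing_gt1.
by rewrite -rmorphXn finField_expr_card1 // rmorph1.
Qed.

Section CurveRing.
Variables (Fq : finFieldType) (F : fieldType) (jF : {rmorphism Fq -> F}) (oo : F -> int).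
Local Notation A := (curve_ring oo).

Lemma curve_constant_regular c : jF c \in regular_away oo.
Proof. by apply/asboolP => v hv _; rewrite valuation_finField. Qed.

Definition curve_constant (c : Fq) : A := CurveRing (curve_constant_regular c).

Fact curve_constant_is_zmod_morphism : zmod_morphism curve_constant.
Proof. by move=> x y; apply/val_inj; rewrite /= rmorphB. Qed.
Fact curve_constant_is_monoid_morphism : monoid_morphism curve_constant.
Proof. by split=> [|x y]; apply/val_inj; rewrite /= ?rmorph1 ?rmorphM. Qed.
HB.instance Definition _ :=
  GRing.isZmodMorphism.Build Fq A curve_constant curve_constant_is_zmod_morphism.
HB.instance Definition _ :=
  GRing.isMonoidMorphism.Build Fq A curve_constant curve_constant_is_monoid_morphism.

Definition curve_incl : A -> F := val.
HB.instance Definition _ := GRing.RMorphism.on curve_incl.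

Lemma curve_incl_inj : injective curve_incl. Proof. exact: val_inj. Qed.

Lemma curve_mul_eq0 (a b : A) : a * b = 0 -> a = 0 \/ b = 0.
Proof.
move=> /(congr1 curve_incl); rewrite rmorphM rmorph0 => /eqP; rewrite mulf_eq0.
by case/orP => /eqP h; [left | right]; apply: curve_incl_inj; rewrite h rmorph0.
Qed.

(** If [v x] were negative, then for [n = |v c| + 1] the value of [c * x ^+ n] at [v] would be
    negative, against regularity. *)
Lemma curve_ring_completely_integrally_closed (c x : F) : c != 0 ->
  (forall n, exists a : A, c * x ^+ n = curve_incl a) -> exists a : A, x = curve_incl a.
Proof.
move=> c0 h; suff xA : x \in regular_away oo by exists (CurveRing xA).
apply/asboolP => v hv voo; have [->|x0] := eqVneq x 0; first by case: hv => ->.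
rewrite leNgt; apply/negP => vx.
have hn n : 0 <= v c + v x *+ n.
  have [y e] := h n; have /asboolP hy := curve_funP y; rewrite -(valuationX hv) // -(valuationM hv) ?expf_neq0 //.
  by rewrite e; apply: hy.
have := hn (absz (v c)).+1; rewrite -mulr_natr; nia.
Qed.

Variables (K : fieldType) (j : {rmorphism Fq -> K}) (phi : {rmorphism A -> twpoly j}).

Lemma twsize_unit (a b : A) : a * b = 1 -> twsize (phi a) = 1%N.
Proof.
move=> ab; have e : phi a * phi b = 1 by rewrite -rmorphM ab rmorph1.
case sa: (twsize (phi a)) => [|m].
  move/eqP: sa e; rewrite twsize0 => /eqP->; rewrite mul0r => /esym/eqP.
  by rewrite oner_eq0.
case sb: (twsize (phi b)) => [|n].
  move/eqP: sb e; rewrite twsize0 => /eqP->; rewrite mulr0 => /esym/eqP.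
  by rewrite oner_eq0.
have := twsizeM sa sb; rewrite e twsize1 => -[]; lia.
Qed.

Lemma twsize_constant c : c != 0 -> twsize (phi (curve_constant c)) = 1%N.
Proof.
move=> c0; apply: (@twsize_unit _ (curve_constant c^-1)).
by rewrite -rmorphM divff // rmorph1.
Qed.

Variables (t : A) (r : nat).
Hypotheses (r0 : (0 < r)%N) (ht : twsize (phi t) = r.+1).
Local Notation value := (poly_value curve_constant t).

Lemma twsize_poly_value (b : {poly Fq}) : b != 0 ->
  twsize (phi (value b)) = (r * (size b).-1).+1.
Proof.
elim/poly_ind: b => [|p c IH]; first by rewrite eqxx.
move=> pc0; rewrite size_MXaddC rmorphD rmorphM /= poly_valueX poly_valueC rmorphD rmorphM /=.
have [p0|p0] := eqVneq p 0.
  have c0 : c != 0.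
    by apply: contraNneq pc0 => c0; rewrite p0 c0 mul0r polyC0 addr0.
  by rewrite p0 rmorph0 rmorph0 mul0r add0r (negPf c0) size_poly0 muln0 twsize_constant.
have sp : (0 < size p)%N by rewrite lt0n size_poly_eq0.
have := twsizeM (IH p0) ht => sM.
have sc : (twsize (phi (curve_constant c)) <= 1)%N.
  by have [->|/twsize_constant->//] := eqVneq c 0; rewrite !rmorph0 /twsize size_poly0.
have lt : (twsize (phi (curve_constant c)) < twsize (phi (value p) * phi t)%R)%N.
  by rewrite sM ltnS; apply: leq_trans sc _; rewrite addn_gt0 r0 orbT.
rewrite /twsize size_polyDl // -/(twsize (phi (value p) * phi t)) sM.
by congr _.+1; rewrite /= -[in RHS](prednK sp) mulnS addnC.
Qed.

(** In transcendence degree one [a] satisfies an equation over the polynomials in [t], and for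
    nonzero [a] powers of [a] cancel until the constant term is nonzero. If [phi a = 0], then [phi]
    kills this term; but a nonzero polynomial of degree [n] in [t] acts with degree [r * n]. *)
Lemma phi_injective (hF : has_trdeg (range jF) [set: F] 1) (a : A) : phi a = 0 -> a = 0.
Proof.
move=> pa0; apply: contrapT => /eqP a0.
have [N [c [[i0 [l0 cil]] e]]] := trdeg1_dependent_pair (curve_incl a) (curve_incl t) hF.
pose w (i : 'I_N) : {poly Fq} := \sum_(l < N) c i l *: 'X^l.
pose W : {poly {poly Fq}} := \sum_(i < N) (w i)%:P * 'X^i.
have W0 : W != 0.
  apply/eqP => /polyP/(_ i0); rewrite coef_sum coef0 (bigD1 i0) //= coefCM coefXn eqxx mulr1.
  rewrite big1 ?addr0; last first.
    by move=> i /negPf ii; rewrite coefCM coefXn eq_sym -[_ == _]/(i == i0) ii mulr0.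
  move=> /polyP/(_ l0); rewrite coef_sum coef0 (bigD1 l0) //= coefZ coefXn eqxx mulr1.
  rewrite big1 ?addr0; last first.
    by move=> l /negPf ll; rewrite coefZ coefXn eq_sym -[_ == _]/(l == l0) ll mulr0.
  by move/eqP; rewrite (negPf cil).
have [ev evE] : exists ev : {rmorphism {poly Fq} -> A}, forall p, ev p = value p.
  by exists (poly_value curve_constant t).
have : (map_poly ev W).[a] = 0.
  apply: curve_incl_inj; rewrite rmorph0 -[RHS]e rmorph_sum horner_sum rmorph_sum /=.
  apply: eq_bigr => i _; rewrite rmorphM /= map_polyC map_polyXn hornerM hornerC hornerXn.
  rewrite rmorphM rmorphXn /= /w rmorph_sum rmorph_sum /= mulr_suml; apply: eq_bigr => l _.
  rewrite evE -mul_polyC rmorphM rmorphXn /= poly_valueC poly_valueX rmorphM rmorphXn /=.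
  by rewrite -mulrA (mulrC (_ ^+ i)).
elim/poly_ind: W W0 => [|p b IH]; first by rewrite eqxx.
move=> pb0; have -> : (map_poly ev (p * 'X + b%:P)).[a] = (map_poly ev p).[a] * a + ev b.
  by rewrite rmorphD rmorphM /= map_polyX map_polyC hornerD hornerM hornerX hornerC.
have [b0|b0] := eqVneq b 0.
  have -> : ev b = 0 by rewrite b0; exact: (rmorph0 ev).
  rewrite addr0 => /curve_mul_eq0[]; last by move/eqP: a0.
  by apply: IH; apply: contraNneq pb0 => ->; rewrite b0 mul0r polyC0 addr0.
move=> /(congr1 phi); rewrite rmorphD rmorphM pa0 mulr0 add0r rmorph0 /= => /eqP.
by rewrite evE -twsize0 twsize_poly_value.
Qed.
End CurveRing.

(** * Interpolation and perfect closures *)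

Section RealValuation.
Variables (R : realType) (L : fieldType) (w : L -> R).

(** [w 0] is an arbitrary real number, so 0 is put into every ball by hand. The ultrametric
    inequality then needs no exception for [x + y = 0]. *)
Definition ball (c : R) (x : L) : Prop := x = 0 \/ c <= w x.

Definition real_valuation : Prop :=
  (forall x y, x != 0 -> y != 0 -> w (x * y) = w x + w y) /\
  (forall c x y, ball c x -> ball c y -> ball c (x + y)).

Hypothesis hw : real_valuation.

Lemma rvalM x y : x != 0 -> y != 0 -> w (x * y) = w x + w y.
Proof. by case: hw => h _; apply: h. Qed.

Lemma rval1 : w 1 = 0.
Proof.
have := rvalM (oner_neq0 L) (oner_neq0 L); rewrite mulr1 => h.
by apply: (addrI (w 1)); rewrite -h addr0.
Qed.

Lemma rvalX x n : x != 0 -> w (x ^+ n) = w x *+ n.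
Proof.
move=> x0; elim: n => [|n IH]; first by rewrite expr0 rval1.
by rewrite exprS rvalM ?expf_neq0 // IH mulrS.
Qed.

Lemma rvalN x : w (- x) = w x.
Proof.
have [->|x0] := eqVneq x 0; first by rewrite oppr0.
have N1 : (-1 : L) != 0 by rewrite oppr_eq0 oner_neq0.
have h : w (-1) = 0.
  have := rvalX 2 N1; rewrite expr2 mulrNN mulr1 rval1 => /esym/eqP.
  by rewrite mulrn_eq0 => /eqP.
by rewrite -mulN1r rvalM // h add0r.
Qed.

Lemma rvalV x : x != 0 -> w x^-1 = - w x.
Proof.
move=> x0; apply/eqP; rewrite -addr_eq0 addrC -rvalM ?invr_eq0 // divff //.
by rewrite rval1.
Qed.

Lemma ball0 c : ball c 0. Proof. by left. Qed.

Lemma ballD c x y : ball c x -> ball c y -> ball c (x + y).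
Proof. by case: hw => _; apply. Qed.

Lemma ballN c x : ball c x -> ball c (- x).
Proof. by case=> [->|h]; [left; rewrite oppr0 | right; rewrite rvalN]. Qed.

Lemma ballB c x y : ball c x -> ball c y -> ball c (x - y).
Proof. by move=> hx hy; apply: ballD => //; apply: ballN. Qed.

Lemma ballW c d x : c <= d -> ball d x -> ball c x.
Proof. by move=> cd [->|h]; [left | right; apply: le_trans h]. Qed.

Lemma ball_sum (c : R) I (s : seq I) (P : pred I) (f : I -> L) :
  (forall i, P i -> ball c (f i)) -> ball c (\sum_(i <- s | P i) f i).
Proof. by move=> h; apply: (big_ind (ball c)); [apply: ball0 | apply: ballD |]. Qed.

Lemma ballM c d x y : ball c x -> ball d y -> ball (c + d) (x * y).
Proof.
case=> [->|hx]; first by rewrite mul0r; left.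
case=> [->|hy]; first by rewrite mulr0; left.
have [->|x0] := eqVneq x 0; first by rewrite mul0r; left.
have [->|y0] := eqVneq y 0; first by rewrite mulr0; left.
by right; rewrite rvalM // lerD.
Qed.

Lemma ballX c x n : ball c x -> ball (c *+ n) (x ^+ n).
Proof.
move=> h; elim: n => [|n IH]; first by right; rewrite expr0 rval1 mulr0n.
by rewrite exprS mulrS; apply: ballM.
Qed.

Lemma ball_self x : ball (w x) x. Proof. by right. Qed.

Lemma ball_le c x : x != 0 -> ball c x -> c <= w x.
Proof. by move=> /eqP x0 []. Qed.

Lemma ball_div c d x y : ball c x -> y != 0 -> w y <= d -> ball (c - d) (x / y).
Proof.
move=> hx y0 hy; apply: ballM => //; right; rewrite rvalV //; lra.
Qed.

Lemma rvalD_lt c x y : x != 0 -> ball c y -> w x < c -> x + y != 0 /\ w (x + y) = w x.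
Proof.
move=> x0 hy xc; have xy0 : x + y != 0.
  apply/eqP => /eqP; rewrite addr_eq0 => /eqP xy.
  by have := ball_le x0 (eq_ind_r (ball c) (ballN hy) xy); lra.
split=> //; apply/eqP; rewrite eq_le; apply/andP; split.
  have h : ball (Num.min c (w (x + y))) x.
    rewrite -{2}[x](addrK y); apply: ballB; last by apply: ballW hy; rewrite ge_min lexx.
    by right; rewrite ge_min lexx orbT.
  by have := ball_le x0 h; rewrite ge_min => /orP[]; [lra |].
apply: ball_le => //; apply: ballD; first exact: ball_self.
by apply: ballW hy; lra.
Qed.

(* Newton interpolation: divide [f - f(y 0)] by [X - y 0] and induct. *)
Lemma interpolation_ball (A0 B0 : R) (M : nat) (C0 : R) (f : {poly L}) (y : nat -> L) :
  (size f <= M.+1)%N ->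
  (forall k, (k <= M)%N -> ball A0 (y k)) ->
  (forall k l, (k < l <= M)%N -> y k != y l /\ w (y k - y l) <= B0) ->
  (forall k, (k <= M)%N -> ball C0 f.[y k]) ->
  forall i, ball (C0 + (M%:R - i%:R) * A0 - M%:R * B0) f`_i.
Proof.
elim: M C0 f y => [|M IH] C0 f y sf hA hB hC i.
  have [i0|i0] := posnP i; last by rewrite nth_default; [left | apply: leq_trans sf i0].
  rewrite i0 subrr !mul0r subr0 addr0; have := hC 0%N isT.
  by rewrite [f in f.[_]]size1_polyC // hornerC.
have [iM|Mi] := leqP i M.+1; last by rewrite nth_default; [left | apply: leq_trans sf Mi].
have AB : A0 <= B0.
  have [y01 h] := hB 0%N 1%N isT; apply: le_trans h.
  by apply: ball_le; [rewrite subr_eq0 | apply: ballB; apply: hA].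
set c := f.[y 0%N].
have /factor_theorem [g gE] : root (f - c%:P) (y 0%N).
  by rewrite /root hornerD hornerN hornerC subrr.
have fE : f = g * 'X - (y 0%N) *: g + c%:P.
  by rewrite -mul_polyC [_ * g]mulrC -mulrBr -gE subrK.
have sg : (size g <= M.+1)%N.
  have [->|g0] := eqVneq g 0; first by rewrite size_poly0.
  rewrite -ltnS -(size_mulX g0) -[X in (X <= _)%N]/(size (g * 'X)).
  have -> : size (g * 'X) = size (g * ('X - (y 0%N)%:P)).
    by rewrite size_mulX // size_Mmonic ?monicXsubC // size_XsubC addn2.
  rewrite -gE (leq_trans (size_polyD _ _)) // geq_max sf size_polyN.
  by rewrite (leq_trans (size_polyC_leq1 _)).
have gy k : (k <= M)%N -> ball (C0 - B0) g.[y k.+1].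
  move=> kM; have [y0k h] := hB 0%N k.+1 kM.
  have yk0 : y k.+1 - y 0%N != 0 by rewrite subr_eq0 eq_sym.
  have -> : g.[y k.+1] = (f.[y k.+1] - c) / (y k.+1 - y 0%N).
    have : (f - c%:P).[y k.+1] = g.[y k.+1] * (y k.+1 - y 0%N).
      by rewrite gE hornerM hornerXsubC.
    by rewrite hornerD hornerN hornerC => ->; rewrite mulfK.
  apply: ball_div => //; first by apply: ballB; [apply: hC | apply: (hC 0%N)].
  by rewrite -rvalN opprB.
have hg n : ball (C0 - B0 + (M%:R - n%:R) * A0 - M%:R * B0) g`_n.
  apply: (IH _ _ (fun k => y k.+1)) => //.
  - by move=> k kM; apply: hA.
  - by move=> k l /andP[kl lM]; apply: hB; rewrite !ltnS kl.
have h0 : ball (C0 + (M.+1%:R - i%:R) * A0 - M.+1%:R * B0) ((y 0%N *: g)`_i).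
  rewrite coefZ; apply: ballW (ballM (hA 0%N isT) (hg i)).
  by rewrite -natr1; lra.
rewrite fE coefD coefB coefMX coefC; case: i iM h0 => [|i] iM h0 /=.
  rewrite sub0r; apply: ballD; first exact: ballN.
  apply: ballW (hC 0%N isT); rewrite subr0.
  have : M.+1%:R * A0 <= M.+1%:R * B0 by apply: ler_wpM2l.
  lra.
rewrite addr0; apply: ballB => //; apply: ballW (hg i).
by rewrite -!natr1; lra.
Qed.
End RealValuation.

(** * Valuations on the perfect closure *)

Section PerfectClosure.
Variables (R : realType) (p : nat) (K Kper : fieldType) (e : {rmorphism K -> Kper}).
Hypotheses (hp : p \in [pchar K]) (hper : is_perfect_closure p e).

Let p0 n : (0 < p ^ n)%N.
Proof. by rewrite expn_gt0 prime_gt0 // (pcharf_prime hp). Qed.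

Lemma perfect_closure_level x : exists na : nat * K, x ^+ (p ^ na.1) = e na.2.
Proof. by have [_ h] := hper; have [n [a xa]] := h x; exists (n, a). Qed.

Definition perfect_level := projT1 (choice perfect_closure_level).

Definition perfect_val (v : K -> int) (x : Kper) : R :=
  (v (perfect_level x).2)%:~R / (p ^ (perfect_level x).1)%:R.

Lemma perfect_levelE x : x ^+ (p ^ (perfect_level x).1) = e (perfect_level x).2.
Proof. exact: (projT2 (choice perfect_closure_level) x). Qed.

Lemma perfect_levelW x n m a : (n <= m)%N -> x ^+ (p ^ n) = e a ->
  x ^+ (p ^ m) = e (a ^+ (p ^ (m - n))).
Proof. by move=> nm xa; rewrite rmorphXn -xa -exprM -expnD subnKC. Qed.

Lemma perfect_level2 x y : exists n a b, x ^+ (p ^ n) = e a /\ y ^+ (p ^ n) = e b.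
Proof.
exists (maxn (perfect_level x).1 (perfect_level y).1); do 2 eexists; split.
  by apply: perfect_levelW (perfect_levelE x); rewrite leq_maxl.
by apply: perfect_levelW (perfect_levelE y); rewrite leq_maxr.
Qed.

Lemma perfect_frobD n (x y : Kper) : (x + y) ^+ (p ^ n) = x ^+ (p ^ n) + y ^+ (p ^ n).
Proof.
apply: exprDn_pchar; rewrite pnatX (eq_pnat _ (pcharf_eq (rmorph_pchar e hp))).
by rewrite pnat_id // (pcharf_prime hp).
Qed.

Lemma perfect_frob_inj n (x y : Kper) : x ^+ (p ^ n) = y ^+ (p ^ n) -> x = y.
Proof.
move=> h; apply/eqP; rewrite -subr_eq0; have := perfect_frobD n (x - y) y.
rewrite subrK h => /eqP; rewrite -subr_eq0 opprD addrCA subrr addr0 oppr_eq0.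
by rewrite expf_eq0 => /andP[].
Qed.

Lemma perfect_closure_countable : countable [set: K] ->
  exists g : nat -> Kper, forall x, exists m, g m = x.
Proof.
move=> /countable_injP[c cinj].
pose f x := pickle ((perfect_level x).1, c (perfect_level x).2).
have finj : injective f.
  move=> x y /(pcan_inj pickleK) [h1 /cinj h2].
  apply: (@perfect_frob_inj (perfect_level x).1).
  by rewrite perfect_levelE h2 ?inE // -perfect_levelE h1.
have hg m : exists x, forall y, f y = m -> x = y.
  have [[y ym]|h] := pselect (exists y, f y = m).
    by exists y => z; rewrite -ym => /finj.
  by exists 0 => y ym; case: h; exists y.
have [g {}hg] := choice hg; exists g => x; exists (f x); exact: hg.
Qed.

Section Val.
Variables (v : K -> int) (hv : is_valuation v).

Lemma perfect_valE x n a : x ^+ (p ^ n) = e a -> perfect_val v x = (v a)%:~R / (p ^ n)%:R.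
Proof.
rewrite /perfect_val; move: (perfect_levelE x); move: (perfect_level x) => [m b] /= xb xa.
have h : a ^+ (p ^ m) = b ^+ (p ^ n).
  by apply: (fmorph_inj e); rewrite !rmorphXn -xa -xb -!exprM mulnC.
have pn k : (p ^ k)%:R != 0 :> R by rewrite pnatr_eq0 -lt0n p0.
apply/eqP; rewrite eqr_div //; apply/eqP.
have [a0|a0] := eqVneq a 0.
  have b0 : b = 0.
    apply/eqP; move: h; rewrite a0 expr0n gtn_eqF // => /esym/eqP.
    by rewrite expf_eq0 => /andP[].
  by rewrite a0 b0; case: hv => ->; rewrite !mul0r.
have b0 : b != 0.
  apply: contra_neq a0 => b0; apply/eqP; move: h; rewrite b0 expr0n gtn_eqF // => /eqP.
  by rewrite expf_eq0 => /andP[].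
have e1 (z : int) k : (z *+ k)%:~R = z%:~R * k%:R :> R by rewrite rmorphMn mulr_natr.
by rewrite -!e1 -!(valuationX hv) // h.
Qed.

Lemma perfect_val_base a : perfect_val v (e a) = (v a)%:~R.
Proof. by rewrite (@perfect_valE (e a) 0 a) // divr1. Qed.

Lemma perfect_val_valuation : real_valuation (perfect_val v).
Proof.
split=> [x y x0 y0|c x y].
  have [n [a [b [xa yb]]]] := perfect_level2 x y.
  have a0 : a != 0 by rewrite -(fmorph_eq0 e) -xa expf_neq0.
  have b0 : b != 0 by rewrite -(fmorph_eq0 e) -yb expf_neq0.
  rewrite (perfect_valE xa) (perfect_valE yb) (@perfect_valE _ n (a * b)).
    by rewrite (valuationM hv) // rmorphD mulrDl.
  by rewrite exprMn xa yb rmorphM.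
case=> [->|cx]; first by rewrite add0r.
case=> [->|cy]; first by rewrite addr0; right.
have [->|x0] := eqVneq x 0; first by rewrite add0r; right.
have [->|y0] := eqVneq y 0; first by rewrite addr0; right.
have [|xy0] := eqVneq (x + y) 0; first by left.
right; have [n [a [b [xa yb]]]] := perfect_level2 x y.
have xyab : (x + y) ^+ (p ^ n) = e (a + b) by rewrite perfect_frobD xa yb rmorphD.
have a0 : a != 0 by rewrite -(fmorph_eq0 e) -xa expf_neq0.
have b0 : b != 0 by rewrite -(fmorph_eq0 e) -yb expf_neq0.
have ab0 : a + b != 0 by rewrite -(fmorph_eq0 e) -xyab expf_neq0.
move: cx cy; rewrite (perfect_valE xa) (perfect_valE yb) (perfect_valE xyab).
have [_ _ h _] := hv; have := h a b a0 b0 ab0.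
have pn : 0 < (p ^ n)%:R :> R by rewrite ltr0n.
rewrite !ler_pdivlMr // ge_min => /orP[] hab cx cy.
  by apply: le_trans cx _; rewrite ler_int.
by apply: le_trans cy _; rewrite ler_int.
Qed.
End Val.
End PerfectClosure.

(** * Additive operators at one place *)

Section AdditiveOperator.
Variables (L : fieldType) (q r : nat) (a : nat -> L).
Hypotheses (q1 : (1 < q)%N) (r0 : (0 < r)%N) (ar0 : a r != 0).

Definition add_op (x : L) : L := \sum_(i < r.+1) a i * x ^+ (q ^ i).
Definition add_poly : {poly L} := \sum_(i < r.+1) a i *: 'X^(q ^ i).
Definition add_poly_iter (n : nat) : {poly L} := iter n (fun g => add_poly \Po g) 'X.

Lemma horner_add_poly x : add_poly.[x] = add_op x.
Proof. by rewrite horner_sum; apply: eq_bigr => i _; rewrite hornerZ hornerXn. Qed.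

Lemma coef_add_poly i : (i <= r)%N -> add_poly`_(q ^ i) = a i.
Proof.
move=> ir; rewrite coef_sum (bigD1 (Ordinal (ir : (i < r.+1)%N))) //= coefZ coefXn eqxx mulr1.
rewrite big1 ?addr0 // => k ki; rewrite coefZ coefXn eqn_exp2l // eq_sym.
by rewrite -[_ == _]/(k == Ordinal (ir : (i < r.+1)%N)) (negPf ki) mulr0.
Qed.

Lemma size_add_poly : size add_poly = (q ^ r).+1.
Proof.
rewrite /add_poly big_ord_recr /= addrC size_polyDl size_scale ?size_polyXn //.
rewrite ltnS; apply: (leq_trans (size_sum _ _ _)); apply/bigmax_leqP => i _.
by rewrite (leq_trans (size_scale_leq _ _)) // size_polyXn ltn_exp2l.
Qed.

Lemma lead_add_poly : lead_coef add_poly = a r.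
Proof. by rewrite lead_coefE size_add_poly coef_add_poly. Qed.

Lemma size_add_poly_iter n : size (add_poly_iter n) = ((q ^ r) ^ n).+1.
Proof.
elim: n => [|n IH]; first by rewrite size_polyX.
have := size_comp_poly add_poly (add_poly_iter n); rewrite size_add_poly IH /= -expnS => h.
have : size (add_poly_iter n.+1) != 0%N.
  apply/negP => /eqP s0; move: h; rewrite /= -[_ \Po _]/(add_poly_iter n.+1) s0 /= => /esym/eqP.
  by rewrite expn_eq0 expn_eq0 eqn0Ngt (ltnW q1).
by rewrite -lt0n => /prednK <-; rewrite -h.
Qed.

Lemma horner_add_poly_iter n x : (add_poly_iter n).[x] = iter n add_op x.
Proof.
by elim: n => [|n IH]; rewrite ?hornerX //= horner_comp IH horner_add_poly.
Qed.

Section Valuation.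
Variables (R : realType) (w : L -> R) (hw : real_valuation w) (s : R).
Hypothesis hs : w (a r) = ((q ^ r)%:R - 1) * s.
Local Notation Q := ((q ^ r)%:R : R).

(* [lam] is the valuation of [x / gamma] and [alpha i] that of the [i]-th coefficient of the
   conjugate of the operator by [gamma], where [gamma ^+ (q ^ r - 1) = (a r)^-1]. *)
Definition lam (x : L) : R := w x + s.
Definition alpha (i : nat) : R := if a i == 0 then 0 else w (a i) - ((q ^ i)%:R - 1) * s.
(** A crude lower bound of 0 and of all [alpha i], which vanishes when all of them do, hence at
    almost all places. *)
Definition mu : R := - \sum_(i < r.+1) `|alpha i|.
(** The amount by which [x] misses the ball [mu <= lam], outside which the top term of the operator
    dominates. *)
Definition delta (x : L) : R := if x == 0 then 0 else Num.max 0 (mu - lam x).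

Lemma Q_gt1 : 1 < Q.
Proof. by rewrite ltr1n -[1%N](expn0 q) ltn_exp2l. Qed.

Lemma mu_le0 : mu <= 0.
Proof. by rewrite oppr_le0; apply: sumr_ge0. Qed.

Lemma mu_le_alpha i : (i <= r)%N -> mu <= alpha i.
Proof.
move=> ir; rewrite /mu (bigD1 (Ordinal (ir : (i < r.+1)%N))) //=.
have : 0 <= \sum_(k < r.+1 | k != Ordinal (ir : (i < r.+1)%N)) `|alpha k|.
  by apply: sumr_ge0.
have := lerNnormlW (lexx `|alpha i|); move: (\sum_(_ < _ | _) _) => S; lra.
Qed.

Lemma delta_ge0 x : 0 <= delta x.
Proof. by rewrite /delta; case: eqP => // _; rewrite le_max lexx. Qed.


Lemma ball_delta x : ball w (mu - delta x - s) x.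
Proof.
rewrite /delta; have [->|x0] := eqVneq x 0; first by left.
right; have : mu - lam x <= Num.max 0 (mu - lam x) by rewrite le_max lexx orbT.
by move: (Num.max _ _) => m; rewrite /lam; lra.
Qed.

Lemma delta_le x c : 0 <= c -> ball w (mu - c - s) x -> delta x <= c.
Proof.
rewrite /delta => c0 []; first by move=> ->; rewrite eqxx.
by move=> h; case: eqP => // _; rewrite ge_max c0 /lam; lra.
Qed.

Lemma deltaD x y : delta (x + y) <= delta x + delta y.
Proof.
have := delta_ge0 x; have := delta_ge0 y => dy dx; apply: delta_le; first lra.
by apply: (ballD hw); [apply: ballW (ball_delta x) | apply: ballW (ball_delta y)]; lra.
Qed.

Lemma alphaE i : a i != 0 -> w (a i) = alpha i + ((q ^ i)%:R - 1) * s.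
Proof. by rewrite /alpha => /negPf->; rewrite subrK. Qed.

Lemma ball_coef c i : c <= alpha i -> ball w (c + ((q ^ i)%:R - 1) * s) (a i).
Proof.
move=> ci; have [->|ai0] := eqVneq (a i) 0; first by left.
by right; rewrite alphaE // lerD2r.
Qed.

Lemma qi_ge1 i : 1 <= (q ^ i)%:R :> R.
Proof. by rewrite ler1n expn_gt0 (ltnW q1). Qed.

Lemma qi_lt i : (i < r)%N -> (q ^ i)%:R + 1 <= Q.
Proof. by move=> ir; rewrite natr1 ler_nat ltn_exp2l. Qed.

Lemma alpha_r : alpha r = 0.
Proof. by rewrite /alpha (negPf ar0) hs subrr. Qed.

(** A lower term has value at least [alpha i + q ^ i * m - s]. As [alpha i >= mu >= m], [m <= 0] and
    [q ^ i + 1 <= Q], this is at least [Q * m - s]. The top term has [alpha r = 0]. *)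
Lemma add_op_ball m x : m <= mu -> ball w (m - s) x -> ball w (Q * m - s) (add_op x).
Proof.
move=> mmu hx; have := mu_le0 => mu0; apply: (ball_sum hw) => i _.
have [ir|] := ltnP i r.
  have := qi_lt ir; have := qi_ge1 i => h1 h2.
  have hi := ball_coef (mu_le_alpha (ltnW ir)).
  apply: ballW (ballM hw hi (ballX hw (q ^ i) hx)).
  rewrite -mulr_natr; set z := (q ^ i)%:R in h1 h2 *.
  by have h3 : (Q - z - 1) * m <= 0; [nra | nra].
move=> ri; have {ri} ir : (i : nat) = r by apply/eqP; rewrite eqn_leq ri -ltnS ltn_ord.
rewrite ir; have hi := @ball_coef 0 r; rewrite alpha_r lexx in hi.
apply: ballW (ballM hw (hi isT) (ballX hw (q ^ r) hx)).
by rewrite -mulr_natr; nra.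
Qed.

(** Outside the ball the top term dominates: the values of the lower terms exceed its value by at
    least [mu - lam x], which is positive. *)
Lemma add_op_exact x : x != 0 -> lam x < mu -> add_op x != 0 /\ lam (add_op x) = Q * lam x.
Proof.
move=> x0 xmu; have := mu_le0 => mu0; have := Q_gt1 => Q1.
rewrite /add_op big_ord_recr /= addrC.
have t0 : a r * x ^+ (q ^ r) != 0 by rewrite mulf_neq0 // expf_neq0.
have wt : w (a r * x ^+ (q ^ r)) = Q * lam x - s.
  by rewrite (rvalM hw) ?expf_neq0 // (rvalX hw) // hs -mulr_natr /lam; ring.
have hrest : ball w (Q * lam x - s + (mu - lam x)) (\sum_(i < r) a i * x ^+ (q ^ i)).
  apply: (ball_sum hw) => i _; have ir := ltn_ord i.
  have := qi_lt ir; have := qi_ge1 i => h1 h2.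
  have hi := ball_coef (mu_le_alpha (ltnW ir)).
  apply: ballW (ballM hw hi (ballX hw (q ^ i) (ball_self w x))).
  move: h1 h2 xmu mu0; rewrite -mulr_natr /lam; set z := (q ^ i)%:R; move: Q => Q' h1 h2 xmu mu0.
  by have h3 : (Q' - z - 1) * (w x + s) <= 0; [nra | nra].
have [|nz e] := rvalD_lt hw t0 hrest; first by rewrite wt; lra.
by split=> //; rewrite {1}/lam e wt; lra.
Qed.

Lemma rval_lead_iter n : w (lead_coef (add_poly_iter n)) = (Q ^+ n - 1) * s.
Proof.
elim: n => [|n IH]; first by rewrite /= lead_coefX (rval1 hw) subrr mul0r.
have l0 : lead_coef (add_poly_iter n) != 0.
  by rewrite lead_coef_eq0 -size_poly_eq0 size_add_poly_iter.
rewrite /= lead_coef_comp ?size_add_poly_iter ?ltnS ?expn_gt0 ?(ltnW q1) //.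
rewrite size_add_poly /= lead_add_poly (rvalM hw) ?expf_neq0 // (rvalX hw) // IH hs.
by rewrite -mulr_natr exprS; ring.
Qed.

Variables (k : fieldType) (act : {poly k} -> L -> L) (cst : k -> L).
Hypotheses (actMX : forall p c x, act (p * 'X + c%:P) x = act p (add_op x) + cst c * x)
  (act0 : forall x, act 0 x = 0) (cst0 : cst 0 = 0)
  (cst_neq0 : forall c, c != 0 -> cst c != 0) (w_cst : forall c, c != 0 -> w (cst c) = 0).

Lemma ball_cst m c x : ball w m x -> ball w m (cst c * x).
Proof.
move=> hx; have [->|c0] := eqVneq c 0; first by rewrite cst0 mul0r; left.
rewrite -[m]add0r; apply: (ballM hw) => //; right; by rewrite w_cst.
Qed.

Lemma Qn_ge1 n : 1 <= Q ^+ n.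
Proof. by apply: exprn_ege1; apply: ltW; apply: Q_gt1. Qed.

Lemma act_ball n (b : {poly k}) m x : (size b <= n.+1)%N -> m <= mu -> ball w (m - s) x ->
  ball w (Q ^+ n * m - s) (act b x).
Proof.
have := mu_le0 => mu0; have := Q_gt1 => Q1.
elim/poly_ind: b n m x => [|p c IH] n m x sb mmu hx; first by rewrite act0; left.
rewrite actMX; apply: (ballD hw).
  have [->|p0] := eqVneq p 0; first by rewrite act0; left.
  case: n sb => [|n]; rewrite size_MXaddC (negPf p0) /= ltnS.
    by rewrite leqn0 size_poly_eq0 (negPf p0).
  move=> sp; rewrite exprSr -mulrA; apply: IH => //; last exact: add_op_ball.
  by nra.
apply: ball_cst; apply: ballW hx; have := Qn_ge1 n; nra.
Qed.

Lemma act_exact n (b : {poly k}) x : size b = n.+1 -> x != 0 -> lam x < mu ->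
  act b x != 0 /\ lam (act b x) = Q ^+ n * lam x.
Proof.
have := mu_le0 => mu0; have := Q_gt1 => Q1.
elim/poly_ind: b n x => [|p c IH] n x; first by rewrite size_poly0.
rewrite size_MXaddC actMX => sb x0 xmu.
have [p0|p0] := eqVneq p 0.
  move: sb; rewrite p0 eqxx size_poly0 /= act0 add0r; case: eqVneq => // c0 [<-].
  rewrite expr0 mul1r mulf_neq0 ?cst_neq0 //; split=> //.
  by rewrite /lam (rvalM hw) ?cst_neq0 // w_cst // add0r.
have [tx0 txe] := add_op_exact x0 xmu.
move: sb; rewrite (negPf p0) /= => -[sp].
case: n sp => [/eqP|n sp]; first by rewrite size_poly_eq0 (negPf p0).
have [|px0 pxe] := IH n (add_op x) sp tx0; first by rewrite txe; nra.
have hc : ball w (w x) (cst c * x) by apply: ball_cst; right.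
have e2 : w (act p (add_op x)) = Q ^+ n.+1 * lam x - s.
  by move: pxe; rewrite {1}/lam txe exprSr -mulrA => <-; lra.
have hlt : w (act p (add_op x)) < w x.
  rewrite e2; have := Qn_ge1 n; rewrite exprSr; move: (Q ^+ n) => z z1.
  have : z * Q > 1 by nra.
  by move: xmu; rewrite /lam; move: (z * Q) => t ? ?; nra.
have [nz e] := rvalD_lt hw px0 hc hlt.
by split=> //; rewrite {1}/lam e e2; lra.
Qed.

(** Where [delta] is positive, [lam] is multiplied exactly by [Q ^+ n]; the leftover
    [(1 - Q ^+ n) * mu] is nonnegative since [mu <= 0]. *)
Lemma delta_act_ge n (b : {poly k}) x : size b = n.+1 -> Q ^+ n * delta x <= delta (act b x).
Proof.
move=> sb; have := Qn_ge1 n => z1; have := mu_le0 => mu0.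
have [x0|x0] := eqVneq x 0; first by rewrite {1}/delta x0 eqxx mulr0 delta_ge0.
have [h|h] := ltP (lam x) mu; last first.
  rewrite (_ : delta x = 0) ?mulr0 ?delta_ge0 //; rewrite /delta (negPf x0).
  by apply/max_idPl; lra.
have [bx0 bxe] := act_exact sb x0 h.
rewrite /delta (negPf x0) (negPf bx0) bxe; move: (Q ^+ n) z1 => z z1.
have -> : Num.max 0 (mu - lam x) = mu - lam x by apply/max_idPr; lra.
rewrite le_max; apply/orP; right; nra.
Qed.

Lemma delta_act_le n (b : {poly k}) x : (size b <= n.+1)%N -> delta (act b x) <= Q ^+ n * (delta x - mu).
Proof.
move=> sb; have := Qn_ge1 n => z1; have := mu_le0 => mu0; have := delta_ge0 x => dx.
apply: delta_le; first by nra.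
apply: ballW (act_ball sb (m := mu - delta x) _ (ball_delta x)); last lra.
by nra.
Qed.
End Valuation.
End AdditiveOperator.

(** * The excess of a point *)

(** Greedy choice: as long as no class in [X] has more than [m] elements, discarding the class of
    the chosen element leaves enough for the remaining choices. *)
Lemma class_or_spread (T : finType) (E : rel T) (M m : nat) (X : {set T}) :
  (forall x, E x x) -> (forall x y, E x y = E y x) -> (forall x y z, E x y -> E y z -> E x z) ->
  (M * m < #|X|)%N ->
  (exists Y : {set T}, [/\ Y \subset X, (m < #|Y|)%N & {in Y &, forall x y, E x y}]) \/
  (exists s : seq T, [/\ size s = M.+1, {subset s <= X} & pairwise (fun x y => ~~ E x y) s]).
Proof.
move=> Er Es Et; elim: M X => [|M IH] X hX.
  have /card_gt0P[x xX] : (0 < #|X|)%N by apply: leq_ltn_trans hX.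
  by right; exists [:: x]; split=> // y; rewrite inE => /eqP->.
have /card_gt0P[x xX] : (0 < #|X|)%N by apply: leq_ltn_trans hX.
pose C := X :&: [set y | E x y].
have [mC|Cm] := ltnP m #|C|.
  left; exists C; split=> //; first exact: finset.subsetIl.
  by move=> y z; rewrite !inE => /andP[_ xy] /andP[_ xz]; apply: Et xz; rewrite Es.
have [||[s [ss sX sp]]] := IH (X :\: C).
- rewrite cardsD (finset.setIidPr (finset.subsetIl _ _)); rewrite ltn_subRL.
  by apply: leq_ltn_trans hX; rewrite mulSn leq_add2r.
- move=> [Y [YX mY hY]]; left; exists Y; split=> //.
  by apply: fintype.subset_trans YX _; apply: finset.subsetDl.
right; exists (x :: s); split.
- by rewrite /= ss.
- move=> y; rewrite inE => /predU1P[->//|/sX]; by rewrite inE => /andP[].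
- rewrite /= sp andbT; apply/allP => y /sX; rewrite !inE => /andP[h yX].
  by move: h; rewrite yX.
Qed.

(** A relation without [M.+1] pairwise inequivalent elements has at most [M] classes, so passing to
    a large class costs a factor [M]. After all relations of [cs] more than [m] elements remain. *)
Lemma common_class (T : finType) (I : eqType) (E : I -> rel T) (cs : seq I) (M m : nat)
  (X : {set T}) :
  (forall i x, E i x x) -> (forall i x y, E i x y = E i y x) ->
  (forall i x y z, E i x y -> E i y z -> E i x z) ->
  (forall i s, i \in cs -> size s = M.+1 -> ~~ pairwise (fun x y => ~~ E i x y) s) ->
  (M ^ size cs * m < #|X|)%N ->
  exists Y : {set T}, [/\ Y \subset X, (m < #|Y|)%N &
    forall i, i \in cs -> {in Y &, forall x y, E i x y}].
Proof.
move=> Er Es Et; elim: cs X => [|i cs IH] X hs hX.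
  by exists X; split=> //; move: hX; rewrite expn0 mul1n.
rewrite /= expnS -mulnA in hX.
have [] := class_or_spread (Er i) (Es i) (Et i) hX.
  move=> [Y [YX mY hY]].
  have [|Z [ZY mZ hZ]] := IH Y _ mY; first by move=> i' s h; apply: hs; rewrite inE h orbT.
  exists Z; split=> //; first exact: fintype.subset_trans YX.
  move=> i'; rewrite inE => /predU1P[->|]; last exact: hZ.
  by move=> x y xZ yZ; apply: hY; apply: (fintype.subsetP ZY).
by move=> [s [ss _ sp]]; have := hs i s (mem_head _ _) ss; rewrite sp.
Qed.

Section Global.
Variables (R : realType) (p : nat) (K Kper : fieldType) (e : {rmorphism K -> Kper}).
Hypotheses (hp : p \in [pchar K]) (hper : is_perfect_closure p e).
Variables (U : set (K -> int)) (d : (K -> int) -> R).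
Hypothesis hU : good_set U d.
Variables (q r : nat) (c : nat -> K).
Hypotheses (q1 : (1 < q)%N) (r0 : (0 < r)%N) (cr0 : c r != 0).

Local Notation Q := ((q ^ r)%:R : R).
Local Notation w := (perfect_val R hper).
Local Notation a := (fun i => e (c i)).
Local Notation op := (add_op q r a).

Definition shift (v : K -> int) : R := (v (c r))%:~R / (Q - 1).
Local Notation lamU v := (lam (w v) (shift v)).
Local Notation alphaU v := (alpha q a (w v) (shift v)).
Local Notation muU v := (mu q r a (w v) (shift v)).
Local Notation deltaU v := (delta q r a (w v) (shift v)).

Lemma U_valuation v : U v -> is_valuation v. Proof. by case: hU => h _ _ _; apply: h. Qed.
Lemma d_gt0 v : U v -> 0 < d v. Proof. by case: hU => _ h _ _; apply: h. Qed.
Lemma w_valuation v : U v -> real_valuation (w v).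
Proof. by move=> Uv; apply: (perfect_val_valuation R hp hper); apply: U_valuation. Qed.

Lemma ar_neq0 : a r != 0. Proof. by rewrite fmorph_eq0. Qed.

Lemma w_lead v : U v -> w v (a r) = (Q - 1) * shift v.
Proof.
move=> Uv; rewrite (perfect_val_base R hp hper (U_valuation Uv)) /shift mulrC divfK //.
by rewrite subr_eq0 gt_eqF // Q_gt1.
Qed.

(** A list of places off which the given elements have value 0. It turns sums over [U] into sums
    over one list shared by several elements. *)
Definition supports (S : seq (K -> int)) (xs : seq K) : Prop :=
  [/\ uniq S, forall v, v \in S -> U v &
      forall v x, U v -> v \notin S -> x \in xs -> v x = 0].

Lemma exists_support (xs : seq K) : exists S, supports S xs.
Proof.
have fin : finite_set (\bigcup_(x in [set x | x \in xs]) (U `&` [set v | v x != 0])).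
  apply: bigcup_finite; first by apply/finite_seqP; exists xs.
  move=> x _; have [->|x0] := eqVneq x 0; last by case: hU => _ _ h _; apply: h.
  apply: sub_finite_set (finite_set0 _) => v [/U_valuation[v0 _ _ _]] /=.
  by rewrite v0 eqxx.
have /finite_seqP[S SE] := fin; exists (undup S).
have hS v : v \in undup S <-> exists2 x, x \in xs & U v /\ v x != 0.
  rewrite mem_undup; have -> : (v \in S : Prop) = [set` S] v by [].
  by rewrite -SE; split=> [[x /= xs' [Uv vx]]|[x xs' [Uv vx]]]; exists x.
split; first exact: undup_uniq.
  by move=> v /hS[x _ []].
move=> v x Uv vS xs'; apply/eqP; apply: contraNT vS => vx.
by apply/hS; exists x.
Qed.

Lemma sum_support S xs x : supports S xs -> x \in xs -> x != 0 ->
  \sum_(v <- S) d v * (v x)%:~R = 0.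
Proof.
move=> [uS SU off] xs' x0; have [_ _ _ /(_ x x0) pf] := hU; rewrite -[RHS]pf (fsbigE S) //.
  rewrite big_seq_cond [RHS]big_seq_cond; apply: eq_bigl => v.
  by case: (boolP (v \in S)) => //= /SU Uv; rewrite mem_set.
by move=> v Uv vS; rewrite (off v x) // mulr0.
Qed.

Lemma nonneg_constant x : x != 0 -> (forall v, U v -> 0 <= v x) -> forall v, U v -> v x = 0.
Proof.
move=> x0 vx v Uv; have [S hS] := exists_support [:: x]; have [uS SU off] := hS.
have [vS|vS] := boolP (v \in S); last by apply: off; rewrite ?mem_head.
have := sum_support hS (mem_head _ _) x0.
have g0 v' : v' \in S -> 0 <= d v' * (v' x)%:~R.
  by move=> /SU Uv'; rewrite mulr_ge0 ?ler0z ?vx // ltW // d_gt0.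
rewrite (bigD1_seq v) //= big_seq_cond => h.
have s0 : 0 <= \sum_(v' <- S | (v' \in S) && (v' != v)) d v' * (v' x)%:~R.
  by apply: sumr_ge0 => v' /andP[/g0].
have /eqP : d v * (v x)%:~R = 0 by have := g0 v vS; lra.
by rewrite mulf_eq0 gt_eqF ?d_gt0 //= intr_eq0 => /eqP.
Qed.

Definition base (y : Kper) : K := (perfect_level hper y).2.
Definition all_supports (S : seq (K -> int)) (ys : seq Kper) : Prop :=
  supports S ([seq c i | i <- iota 0 r.+1] ++ map base ys).

Section Support.
Variables (S : seq (K -> int)) (ys : seq Kper) (hS : all_supports S ys).
Variables (v : K -> int) (Uv : U v) (vS : v \notin S).

Lemma off_support_coef i : (i <= r)%N -> v (c i) = 0.
Proof.
move=> ir; have [_ _ h] := hS; apply: h => //; rewrite mem_cat; apply/orP; left.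
by apply: map_f; rewrite mem_iota.
Qed.

Lemma off_support_w y : y \in ys -> w v y = 0.
Proof.
move=> yys; have [_ _ h] := hS.
have vy : v (base y) = 0.
  by apply: h => //; rewrite mem_cat; apply/orP; right; apply: map_f.
by rewrite /perfect_val vy mul0r.
Qed.

Lemma off_support_shift : shift v = 0.
Proof. by rewrite /shift off_support_coef // mul0r. Qed.

Lemma off_support_mu : muU v = 0.
Proof.
rewrite /mu big1 ?oppr0 // => i _; rewrite /alpha; case: eqP => [_|_]; rewrite ?normr0 //.
rewrite (perfect_val_base R hp hper (U_valuation Uv)) (off_support_coef (i := i)).
  by rewrite off_support_shift mulr0 subr0 normr0.
by rewrite -ltnS ltn_ord.
Qed.

Lemma off_support_delta y : y \in ys -> deltaU v y = 0.
Proof.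
move=> yys; rewrite /delta; case: eqP => // _.
by rewrite off_support_mu /lam off_support_w // off_support_shift addr0 subrr maxxx.
Qed.
End Support.

Definition excess (y : Kper) : R := \sum_(v \in U) d v * deltaU v y.

Lemma exists_all_supports ys : exists S, all_supports S ys.
Proof. exact: exists_support. Qed.

Lemma excessE S ys y : all_supports S ys -> y \in ys ->
  excess y = \sum_(v <- S) d v * deltaU v y.
Proof.
move=> hS yys; have [uS SU _] := hS; rewrite /excess (fsbigE S) //.
  rewrite big_seq_cond [RHS]big_seq_cond; apply: eq_bigl => v.
  by case: (boolP (v \in S)) => //= /SU Uv; rewrite mem_set.
by move=> v Uv vS; rewrite (off_support_delta hS Uv vS yys) mulr0.
Qed.

(** The shifts also sum to zero, being proportional to the values of [c r], so replacing [w] by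
    [lam] preserves the product formula. *)
Lemma product_formula S ys y : all_supports S ys -> y \in ys -> y != 0 ->
  \sum_(v <- S) d v * lamU v y = 0.
Proof.
move=> hS yys y0; have sumU x (x0 : x != 0) xs := sum_support hS xs x0.
have b0 : base y != 0.
  by rewrite -(fmorph_eq0 e) /base -perfect_levelE expf_neq0.
have h1 := sumU _ cr0; have h2 := sumU _ b0.
rewrite /lam /shift /perfect_val -/(base y).
under eq_bigr => v _ do rewrite mulrDr !mulrA.
rewrite big_split /= -!mulr_suml h1 ?h2 ?mul0r ?addr0 // mem_cat.
  by rewrite (map_f base yys) orbT.
by rewrite map_f // mem_iota /= add0n ltnS leqnn.
Qed.

Lemma excess0 : excess 0 = 0.
Proof.
have [S hS] := exists_all_supports [:: 0]; rewrite (excessE hS) ?mem_head // big1 // => v _.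
by rewrite /delta eqxx mulr0.
Qed.

Lemma excess_ge_term v y : U v -> d v * deltaU v y <= excess y.
Proof.
move=> Uv; have [S hS] := exists_all_supports [:: y].
rewrite (excessE hS) ?mem_head //; have [uS SU _] := hS.
have ge0 v' : v' \in S -> 0 <= d v' * deltaU v' y.
  by move=> /SU Uv'; rewrite mulr_ge0 ?delta_ge0 // ltW // d_gt0.
have [vS|vS] := boolP (v \in S).
  rewrite (bigD1_seq v) //= lerDl big_seq_cond sumr_ge0 // => v' /andP[v'S _]; exact: ge0.
rewrite (off_support_delta hS Uv vS) ?mem_head // mulr0 big_seq_cond sumr_ge0 //.
by move=> v' /andP[v'S _]; exact: ge0.
Qed.

Lemma excess_ge0 y : 0 <= excess y.
Proof.
have [S hS] := exists_all_supports [:: y]; have [uS SU _] := hS.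
rewrite (excessE hS) ?mem_head // big_seq_cond sumr_ge0 // => v /andP[/SU Uv _].
by rewrite mulr_ge0 ?delta_ge0 // ltW // d_gt0.
Qed.

Lemma excessD x y : excess (x + y) <= excess x + excess y.
Proof.
have [S hS] := exists_all_supports [:: x; y; x + y]; have [uS SU _] := hS.
rewrite !(excessE hS) ?inE ?eqxx ?orbT // -big_split /= big_seq [leRHS]big_seq.
apply: ler_sum => v /SU Uv; rewrite -mulrDr ler_wpM2l ?(ltW (d_gt0 Uv)) //.
exact: (deltaD _ _ _ (w_valuation Uv)).
Qed.

Definition total_mu : R := \sum_(v \in U) d v * - muU v.

Lemma total_muE S ys : all_supports S ys -> total_mu = \sum_(v <- S) d v * - muU v.
Proof.
move=> hS; have [uS SU _] := hS; rewrite /total_mu (fsbigE S) //.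
  rewrite big_seq_cond [RHS]big_seq_cond; apply: eq_bigl => v.
  by case: (boolP (v \in S)) => //= /SU Uv; rewrite mem_set.
by move=> v Uv vS; rewrite (off_support_mu hS Uv vS) oppr0 mulr0.
Qed.

Lemma total_mu_ge0 : 0 <= total_mu.
Proof.
have [S hS] := exists_all_supports [::]; have [uS SU _] := hS.
rewrite (total_muE hS) big_seq_cond sumr_ge0 // => v /andP[/SU Uv _].
by rewrite mulr_ge0 ?oppr_ge0 ?mu_le0 // ltW // d_gt0.
Qed.

Section Action.
Variables (k : finFieldType) (act : {poly k} -> Kper -> Kper) (cst : k -> Kper).
Hypotheses (actMX : forall b s x, act (b * 'X + s%:P) x = act b (op x) + cst s * x)
  (actXM : forall b x, act ('X * b) x = op (act b x))
  (actB : forall b b' x, act (b - b') x = act b x - act b' x)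
  (cst0 : cst 0 = 0) (cst_neq0 : forall s, s != 0 -> cst s != 0)
  (w_cst : forall v s, U v -> s != 0 -> w v (cst s) = 0).

Lemma act0 x : act 0 x = 0.
Proof. by rewrite -[X in act X](subrr 0) actB subrr. Qed.

Lemma act_iter n b x : act ('X^n * b) x = iter n op (act b x).
Proof.
by elim: n => [|n IH]; rewrite ?expr0 ?mul1r //= exprS -mulrA actXM IH.
Qed.

Lemma excess_act_ge n (b : {poly k}) x : size b = n.+1 -> Q ^+ n * excess x <= excess (act b x).
Proof.
move=> sb; have [S hS] := exists_all_supports [:: x; act b x]; have [uS SU _] := hS.
rewrite !(excessE hS) ?inE ?eqxx ?orbT // mulr_sumr big_seq [leRHS]big_seq.
apply: ler_sum => v /SU Uv; rewrite mulrCA ler_wpM2l ?(ltW (d_gt0 Uv)) //.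
exact: (delta_act_ge q1 r0 ar_neq0 (w_valuation Uv) (w_lead Uv) actMX act0 cst0 cst_neq0
  (fun s => w_cst Uv)).
Qed.

Lemma excess_act_le n (b : {poly k}) x : (size b <= n.+1)%N ->
  excess (act b x) <= Q ^+ n * (excess x + total_mu).
Proof.
move=> sb; have [S hS] := exists_all_supports [:: x; act b x]; have [uS SU _] := hS.
rewrite !(excessE hS) ?inE ?eqxx ?orbT // (total_muE hS) -big_split /= mulr_sumr.
rewrite big_seq [leRHS]big_seq; apply: ler_sum => v /SU Uv.
rewrite -mulrDr mulrCA ler_wpM2l ?(ltW (d_gt0 Uv)) //.
exact: (delta_act_le q1 r0 ar_neq0 (w_valuation Uv) (w_lead Uv) actMX act0 cst0 (fun s => w_cst Uv)).
Qed.

(* Otherwise interpolation at the [y i] would make the leading coefficient of the [n]-th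
   iterate of [op] smaller than it is. *)
Lemma close_pair v n kap c0 (y : nat -> Kper) : U v ->
  c0 - muU v < Q ^+ n * kap ->
  (forall i, (i <= (q ^ r) ^ n)%N -> ball (w v) (muU v - c0 - shift v) (y i)) ->
  (forall i, (i <= (q ^ r) ^ n)%N -> ball (w v) (muU v - c0 - shift v) (iter n op (y i))) ->
  exists i l, (i < l <= (q ^ r) ^ n)%N /\ ball (w v) (- kap - shift v) (y i - y l).
Proof.
move=> Uv hn hy hf; apply: contrapT => H.
have hw := w_valuation Uv; have sz := size_add_poly_iter q1 ar_neq0 n.
have szle : (size (add_poly_iter q r a n) <= ((q ^ r) ^ n).+1)%N by rewrite sz.
have hB i l : (i < l <= (q ^ r) ^ n)%N -> y i != y l /\ w v (y i - y l) <= - kap - shift v.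
  move=> il; have nb : ~ ball (w v) (- kap - shift v) (y i - y l).
    by move=> hb; apply: H; exists i, l.
  have yy : y i != y l by apply/eqP => yil; apply: nb; left; rewrite yil subrr.
  by split=> //; rewrite leNgt; apply/negP => hlt; apply: nb; right; apply: ltW.
have hC i : (i <= (q ^ r) ^ n)%N ->
    ball (w v) (muU v - c0 - shift v) (add_poly_iter q r a n).[y i].
  by move=> iM; rewrite horner_add_poly_iter; apply: hf.
(* At the top index the bound on the [y i] themselves drops out, and comparison with the known
   leading coefficient gives [muU v - c0 + Q ^+ n * kap <= 0]. *)
have := interpolation_ball hw szle hy hB hC ((q ^ r) ^ n)%N.
have -> : (add_poly_iter q r a n)`_((q ^ r) ^ n) = lead_coef (add_poly_iter q r a n).
  by rewrite lead_coefE sz.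
have l0 : lead_coef (add_poly_iter q r a n) != 0.
  by rewrite lead_coef_eq0 -size_poly_eq0 sz.
move=> /(ball_le l0); rewrite (rval_lead_iter q1 ar_neq0 hw (w_lead Uv)) natrX.
lra.
Qed.

Lemma small_excess_ball v y z : U v -> excess y <= z -> ball (w v) (muU v - z / d v - shift v) y.
Proof.
move=> Uv hz; apply: ballW (ball_delta q r a _ _ y); have := excess_ge_term y Uv.
have dv := d_gt0 Uv => h; have : deltaU v y <= z / d v.
  by rewrite ler_pdivlMr // mulrC; apply: le_trans hz.
lra.
Qed.

(* By the product formula [y] cannot be very small at [v0] without being large elsewhere. *)
Lemma lam_upper_bound (S0 : seq (K -> int)) v0 kap y : uniq S0 ->
  (forall v, U v -> v \notin S0 -> muU v = 0) -> (forall v, v \in S0 -> U v) ->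
  v0 \in S0 -> 0 <= kap -> y != 0 -> excess y <= kap ->
  (forall v, v \in S0 -> ball (w v) (- kap - shift v) y) ->
  d v0 * lamU v0 y <= kap * (1 + \sum_(v <- S0) d v).
Proof.
move=> uS0 off0 SU0 v0S kap0 y0 hy hb.
have [S hS] := exists_all_supports [:: y]; have [uS SU _] := hS.
have pf := product_formula hS (mem_head _ _) y0.
pose S1 := undup (S ++ S0).
have uS1 : uniq S1 by apply: undup_uniq.
have SU1 v : v \in S1 -> U v by rewrite mem_undup mem_cat => /orP[/SU|/SU0].
have hS1 : all_supports S1 [:: y].
  have [_ _ h] := hS; split=> // v x Uv vS1; apply: h => //.
  by apply: contra vS1; rewrite mem_undup mem_cat => ->.
have v0S1 : v0 \in S1 by rewrite mem_undup mem_cat v0S orbT.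
(* Every [g v] is nonnegative: on [S0] because [lamU] is at least [- kap], elsewhere because [muU]
   is 0 and [deltaU] compensates a negative [lamU]. By the product formula they sum to the excess
   plus [kap] times the degrees over [S0]. *)
pose g v := d v * (lamU v y + deltaU v y + (if v \in S0 then kap else 0)).
have g0 v : v \in S1 -> 0 <= g v.
  move=> /SU1 Uv; apply: mulr_ge0; first exact: ltW (d_gt0 Uv).
  have d0 := delta_ge0 q r a (w v) (shift v) y.
  case: (boolP (v \in S0)) => [vS0|vS0].
    by have := ball_le y0 (hb v vS0); rewrite /lam; lra.
  have := ball_le y0 (ball_delta q r a (w v) (shift v) y).
  by rewrite off0 // /lam; lra.
have : g v0 <= \sum_(v <- S1) g v.
  by rewrite (bigD1_seq v0) //= lerDl big_seq_cond sumr_ge0 // => v /andP[/g0].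
have -> : \sum_(v <- S1) g v = excess y + kap * \sum_(v <- S0) d v.
  have gE v : g v = d v * lamU v y + d v * deltaU v y + d v * (if v \in S0 then kap else 0).
    by rewrite -!mulrDr.
  rewrite (eq_bigr _ (fun v _ => gE v)).
  rewrite !big_split /= (product_formula hS1 (mem_head _ _) y0) add0r.
  rewrite -(excessE hS1 (mem_head _ _)); congr (_ + _).
  rewrite mulr_sumr; transitivity (\sum_(v <- S1 | v \in S0) kap * d v).
    by rewrite [RHS]big_mkcond; apply: eq_bigr => v _; case: ifP; rewrite ?mulr0 // mulrC.
  rewrite -big_filter; apply: perm_big; apply: uniq_perm => //; first exact: filter_uniq.
  by move=> v; rewrite mem_filter mem_undup mem_cat; case: (v \in S0); rewrite ?orbT ?andbF.
rewrite /g v0S; have dv := d_gt0 (SU0 _ v0S).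
have d0 := delta_ge0 q r a (w v0) (shift v0) y; move=> h.
have : d v0 * lamU v0 y <= d v0 * (lamU v0 y + deltaU v0 y + kap).
  by rewrite ler_pM2l //; lra.
lra.
Qed.

Hypothesis bad : exists v i, [/\ U v, (i <= r)%N & alphaU v i < 0].
Hypothesis card_k : (1 < #|k|)%N.

Theorem small_excess_torsion : exists (n : nat) (ep : R), 0 < ep /\
  forall z, (forall b : {poly k}, (size b <= n)%N -> excess (act b z) <= ep) ->
  exists b : {poly k}, [/\ b != 0, (size b <= n)%N & act b z = 0].
Proof.
have size_bound (m l n : nat) : (m <= l.+1)%N -> ((n.+1 + m).-1 <= l + n + 2)%N by lia.
have final_bound (al sh et x kp t : R) : 1 <= x -> 0 < kp -> kp * (1 + t) + t * et < - al ->
    - kp - sh + (t - x) * (- kp - sh) - t * (et - sh) <= al + (x - 1) * sh -> False.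
  by move=> x1 kp0 h1 h2; have : 0 < kp * x by [apply: mulr_gt0 => //; lra]; nra.
have [v0 [i0 [Uv0 i0r al0]]] := bad.
have [S0 [uS0 SU0 off0 v0S]] : exists S0, [/\ uniq S0, forall v, v \in S0 -> U v,
    forall v, U v -> v \notin S0 -> muU v = 0 & v0 \in S0].
  have [S hS] := exists_all_supports [::]; have [uS SU _] := hS.
  exists S; split=> //; first by move=> v Uv vS; exact: (off_support_mu hS Uv vS).
  apply: contraLR al0 => v0S; rewrite -leNgt.
  have := mu_le_alpha q a (w v0) (shift v0) i0r.
  by rewrite (off_support_mu hS Uv0 v0S).
pose D0 := \sum_(v <- S0) d v; have dv0 := d_gt0 Uv0; have Q1 := Q_gt1 q1 r0 R.
have D00 : 0 <= D0 by rewrite /D0 big_seq_cond sumr_ge0 // => v /andP[/SU0/d_gt0/ltW].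
(* [kap * B] is [kap * (1 + Q) + Q * eta], the loss in interpolating [op] at [Q + 1] points of the
   ball given by [kap], with differences of value at most [eta] up to shifts. The choice of [kap]
   makes it half of the pole order [- alphaU v0 i0]. *)
pose B := (1 + Q) + Q * ((1 + D0) / d v0).
have B0 : 0 < B.
  have : 0 <= (1 + D0) / d v0 by apply: divr_ge0; [lra | apply: ltW].
  rewrite /B; move: (_ / d v0) => t t0; nra.
pose kap := - alphaU v0 i0 / (2 * B).
have kap0 : 0 < kap by apply: divr_gt0; [lra | nra].
have kapB : kap * B < - alphaU v0 i0.
  have -> : kap * B = - alphaU v0 i0 / 2 by rewrite /kap; field; rewrite gt_eqF.
  lra.
pose bound v := (kap / d v - muU v) / kap.
(* This is the condition of [close_pair] for the [N]-th iterate, met at all places of [S0] at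
   once. *)
have [N hN] : exists N, forall v, v \in S0 -> kap / d v - muU v < Q ^+ N * kap.
  have [N hN] : exists N : nat, forall v, v \in S0 -> bound v < N%:R.
    elim: (S0) => [|v S [N IH]]; first by exists 0%N.
    have h := archi_boundP (normr_ge0 (bound v)).
    exists (N + Num.bound `|bound v|)%N => v'; rewrite inE natrD => /predU1P[->|/IH h'].
      by apply: le_lt_trans (ler_norm _) _; apply: lt_le_trans h _; rewrite lerDr.
    by apply: lt_le_trans h' _; rewrite lerDl.
  exists N => v /hN; rewrite /bound ltr_pdivrMr // => h; apply: lt_le_trans h _.
  rewrite ler_pM2r //; elim: (N) => [|n IH]; first by rewrite expr0 ler01.
  have Q2 : 2 <= Q by rewrite ler_nat -[1%N](expn0 q) ltn_exp2l.
  have Qn1 : 1 <= Q ^+ n by apply: exprn_ege1; apply: ltW.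
  rewrite -natr1 exprS; move: (Q ^+ n) Q IH Q2 Qn1 => x y; nra.
pose M := ((q ^ r) ^ N)%N.
have M0 : (0 < M)%N by rewrite /M !expn_gt0 (ltnW q1).
(* Closeness is required of the points and, for [true], of their images under [op]: interpolating
   [op] needs both small nodes and small values. *)
pose cs := [seq (v, s) | v <- S0, s <- [:: false; true]].
(* There are [#|k| ^ L > L] polynomials of size at most [L], enough to leave more than [q ^ r] of
   them in a common class. *)
pose L := (M ^ size cs * q ^ r).+1.
pose T : finType := {ffun 'I_L -> k}.
pose pl (g : T) : {poly k} := \poly_(i < L) (if insub i is Some i' then g i' else 0).
have plL g : (size (pl g) <= L)%N by apply: size_poly.
have pl_inj : injective pl.
  move=> g g' /polyP h; apply/ffunP => i; have := h i.
  by rewrite !coef_poly ltn_ord !valK.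
have cardT : (M ^ size cs * q ^ r < #|[set: T]%SET|)%N.
  rewrite cardsT card_ffun card_ord -/L.
  by apply: leq_trans (ltn_expl _ card_k); rewrite /L.
(* The largest polynomial applied to [z] is ['X^N * ('X * pl g)], of size at most [L + N + 1]. *)
exists (L + N + 2)%N, kap; split=> // z hz.
pose E (vs : (K -> int) * bool) : rel T := fun g g' =>
  `[< U vs.1 -> ball (w vs.1) (- kap - shift vs.1) (act ('X^(vs.2) * (pl g - pl g')) z) >].
have EX (vs : (K -> int) * bool) g g' : act ('X^(vs.2) * (pl g - pl g')) z =
    act ('X^(vs.2) * pl g) z - act ('X^(vs.2) * pl g') z by rewrite mulrBr actB.
have Er vs g : E vs g g by apply/asboolP => _; rewrite EX subrr; left.
have EN vs g g' : E vs g g' -> E vs g' g.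
  move=> /asboolP h; apply/asboolP => Uv.
  have -> : act ('X^(vs.2) * (pl g' - pl g)) z = - act ('X^(vs.2) * (pl g - pl g')) z.
    by rewrite !EX opprB.
  by apply: (ballN (w_valuation Uv)); apply: h.
have Es vs g g' : E vs g g' = E vs g' g by apply/idP/idP; apply: EN.
have Et vs g1 g2 g3 : E vs g1 g2 -> E vs g2 g3 -> E vs g1 g3.
  move=> /asboolP h1 /asboolP h2; apply/asboolP => Uv.
  have -> : act ('X^(vs.2) * (pl g1 - pl g3)) z =
      act ('X^(vs.2) * (pl g1 - pl g2)) z + act ('X^(vs.2) * (pl g2 - pl g3)) z.
    by rewrite !EX addrA subrK.
  by apply: (ballD (w_valuation Uv)); [apply: h1 | apply: h2].
have szX (s : bool) (b : {poly k}) n : (size b <= n)%N -> (size ('X^s * b)%R <= n.+1)%N.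
  move=> sb; apply: leq_trans (size_polyMleq _ _) _; rewrite size_polyXn.
  by case: s; rewrite /= ?add1n ?add2n //= ltnW.
have spread vs s : vs \in cs -> size s = M.+1 ->
    ~~ pairwise (fun g g' => ~~ E vs g g') s.
  move=> /allpairsP[[v si] /= [vS0 _ ->]] ss; have Uv := SU0 v vS0; apply/negP => pw.
  have g0 : T := [ffun=> 0].
  pose y i := act ('X^si * pl (nth g0 s i)) z.
  have sz2 i : (size ('X^si * pl (nth g0 s i))%R <= L.+1)%N by apply: szX.
  have [|i|i|i [l [/andP[il lM] hil]]] := @close_pair v N kap (kap / d v) y Uv.
  - exact: hN.
  - move=> _; apply: (small_excess_ball Uv); apply: hz.
    by apply: leq_trans (sz2 i) _; rewrite -addnA -addn1 leq_add2l addn2.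
  - move=> _; apply: (small_excess_ball Uv); rewrite /y -act_iter; apply: hz.
    apply: leq_trans (size_polyMleq _ _) _; rewrite size_polyXn.
    exact: size_bound.
  move: pw => /(pairwiseP g0) /(_ i l); rewrite !inE ss !ltnS.
  move=> /(_ (leq_trans (ltnW il) lM) lM il) /asboolP; apply => _.
  by rewrite EX.
have [Y [_ mY hY]] := common_class Er Es Et spread cardT.
apply: contrapT => nob.
have nz g g' : g \in Y -> g' \in Y -> g != g' -> act (pl g - pl g') z != 0.
  move=> gY g'Y gg'; apply/eqP => h; apply: nob; exists (pl g - pl g'); split=> //.
    by rewrite subr_eq0; apply: contra_neq gg' => /pl_inj.
  rewrite (leq_trans (size_polyD _ _)) // geq_max size_polyN.
  by rewrite !(leq_trans (plL _)) // -addnA leq_addr.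
have small g g' : excess (act (pl g - pl g') z) <= kap.
  apply: hz; rewrite (leq_trans (size_polyD _ _)) // geq_max size_polyN.
  by rewrite !(leq_trans (plL _)) // -addnA leq_addr.
have inb v s g g' : v \in S0 -> g \in Y -> g' \in Y ->
    ball (w v) (- kap - shift v) (act ('X^(nat_of_bool s) * (pl g - pl g')) z).
  move=> vS0 gY g'Y; have : E (v, s) g g'.
    by apply: hY => //; apply/allpairsP; exists (v, s); split=> //; case: s.
  by move=> /asboolP; apply; apply: SU0.
have inb0 v g g' : v \in S0 -> g \in Y -> g' \in Y ->
    ball (w v) (- kap - shift v) (act (pl g - pl g') z).
  by move=> h1 h2 h3; have := inb v false g g' h1 h2 h3; rewrite expr0 mul1r.
pose s := enum Y; have ss : (q ^ r < size s)%N by rewrite /s -cardE.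
have [g0 g0Y] : exists g0, g0 \in Y by apply/card_gt0P; apply: leq_ltn_trans mY.
have sY i : (i <= q ^ r)%N -> nth g0 s i \in Y.
  by move=> iq; rewrite -mem_enum; apply: mem_nth; apply: leq_ltn_trans ss.
pose y i := act (pl (nth g0 s i) - pl g0) z.
have yB i l : y i - y l = act (pl (nth g0 s i) - pl (nth g0 s l)) z.
  by rewrite /y -actB opprB addrA subrK.
pose eta := kap * (1 + D0) / d v0.
have hyl i l : (i < l <= q ^ r)%N -> y i != y l /\ w v0 (y i - y l) <= eta - shift v0.
  move=> /andP[il lq]; have iq := leq_trans (ltnW il) lq.
  have nil : nth g0 s i != nth g0 s l.
    rewrite nth_uniq ?enum_uniq ?(leq_ltn_trans _ ss) //; by rewrite ltn_eqF.
  have h0 := nz _ _ (sY i iq) (sY l lq) nil.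
  split; first by rewrite -subr_eq0 yB.
  rewrite yB; have := lam_upper_bound uS0 off0 SU0 v0S (ltW kap0) h0 (small _ _)
    (fun v vS => inb0 v _ _ vS (sY i iq) (sY l lq)).
  rewrite -/D0 mulrC -ler_pdivlMr // -/eta /lam; lra.
have hA i : (i <= q ^ r)%N -> ball (w v0) (- kap - shift v0) (y i).
  by move=> iq; apply: inb0 => //; apply: sY.
have hC i : (i <= q ^ r)%N -> ball (w v0) (- kap - shift v0) (add_poly q r a).[y i].
  move=> iq; rewrite horner_add_poly -actXM -['X]expr1.
  exact: (inb v0 true _ _ v0S (sY i iq) g0Y).
have szf : (size (add_poly q r a) <= (q ^ r).+1)%N by rewrite size_add_poly // ar_neq0.
have := interpolation_ball (w_valuation Uv0) szf hA hyl hC (q ^ i0)%N.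
have ai0 : a i0 != 0.
  by apply: contraTneq al0; rewrite /alpha => ->; rewrite eqxx ltxx.
rewrite (coef_add_poly _ q1) // => /(ball_le ai0).
have aE : w v0 (e (c i0)) = alphaU v0 i0 + ((q ^ i0)%:R - 1) * shift v0.
  exact: (@alphaE Kper q a R (w v0) (shift v0) i0 ai0).
move: al0 kapB; rewrite aE.
have -> : kap * B = kap * (1 + Q) + Q * eta by rewrite /B /eta; field; rewrite gt_eqF.
have qi : 1 <= (q ^ i0)%:R :> R by apply: qi_ge1.
by move=> _; apply: final_bound.
Qed.
End Action.
End Global.

(** * Dirichlet approximation *)

Section Dirichlet.
Variables (R : realType) (k : finFieldType) (V : zmodType).
Variables (act : {poly k} -> V -> V) (D : V -> R) (Q C : R).
Hypotheses (actD : forall b b' x, act (b + b') x = act b x + act b' x)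
  (actDr : forall b x y, act b (x + y) = act b x + act b y)
  (actM : forall b b' x, act (b * b') x = act b (act b' x)).
Hypotheses (Q1 : 1 < Q) (D0 : D 0 = 0) (D_ge0 : forall x, 0 <= D x) (C0 : 0 <= C)
  (DD : forall x y, D (x + y) <= D x + D y)
  (D_ge : forall n (b : {poly k}) x, size b = n.+1 -> Q ^+ n * D x <= D (act b x))
  (D_le : forall n (b : {poly k}) x, (size b <= n.+1)%N -> D (act b x) <= Q ^+ n * (D x + C)).
Hypothesis D_small : exists (n : nat) (ep : R), 0 < ep /\
  forall z, (forall b : {poly k}, (size b <= n)%N -> D (act b z) <= ep) ->
  exists b : {poly k}, [/\ b != 0, (size b <= n)%N & act b z = 0].

Let act0 x : act 0 x = 0.
Proof. by apply: (addrI (act 0 x)); rewrite -actD !addr0. Qed.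
Let actr0 b : act b 0 = 0.
Proof. by apply: (addrI (act b 0)); rewrite -actDr !addr0. Qed.
Let actB b b' x : act (b - b') x = act b x - act b' x.
Proof. by apply: (addIr (act b' x)); rewrite -actD !subrK. Qed.
Let actrB b x y : act b (x - y) = act b x - act b y.
Proof. by apply: (addIr (act b y)); rewrite -actDr !subrK. Qed.
Let act_sum b (I : finType) (f : I -> V) : act b (\sum_i f i) = \sum_i act b (f i).
Proof. exact: (big_morph (act b) (actDr b) (actr0 b)). Qed.

(** Over a finite field the product of all nonzero polynomials of bounded size is available. *)
Lemma common_multiple_bounded_size (s : nat) : exists2 P : {poly k}, P != 0 &
  forall b : {poly k}, b != 0 -> (size b <= s)%N -> exists b', P = b' * b.
Proof.
pose pl (g : {ffun 'I_s -> k}) : {poly k} := \poly_(i < s) (if insub i is Some i' then g i' else 0).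
exists (\prod_(g | pl g != 0) pl g); first by apply/prodf_neq0.
move=> b b0 sb; pose g := [ffun i : 'I_s => b`_i].
have plg : pl g = b.
  apply/polyP => i; rewrite coef_poly; case: ltnP => [h|h].
    by rewrite insubT ffunE.
  by rewrite nth_default // (leq_trans sb).
rewrite (bigD1 g) /=; last by rewrite plg.
by eexists; rewrite plg mulrC.
Qed.

(** Some [b] of bounded size makes all remainders of [b * c i] modulo [be] have size at most
    [d - l]. Removing the quotients from [act b x] leaves a point [z] for which [act be z] involves
    these remainders only; dividing by [be] makes its excess small, so a bounded [b1] kills [z]. The
    size of [b1 * b] does not depend on [be], and [P] is a multiple of every such product. *)
Theorem bounded_denominators (I : finType) (e : I -> V) : exists2 P : {poly k}, P != 0 &
  forall x, (exists2 b : {poly k}, b != 0 & exists c : I -> {poly k},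
               act b x = \sum_i act (c i) (e i)) ->
  exists c : I -> {poly k}, act P x = \sum_i act (c i) (e i).
Proof.
have ar1 (d' m l : nat) : (d' - l <= m)%N -> (m < d')%N -> (d' - m.+1 < l)%N by lia.
have ar2 (d' m : nat) : (m < d')%N -> (d' - (d' - m.+1).+1 = m)%N by lia.
have ar3 (a d' l : nat) : (0 < a)%N -> (a <= d' - l)%N -> (l <= d')%N by lia.
have ar4 (a b n d' : nat) : (a <= n)%N -> (b <= d')%N -> ((a + b).-1 <= (n + d').+1)%N by lia.
have [n0 [ep [ep0 small]]] := D_small.
pose E := \sum_i (D (e i) + C).
have E0 : 0 <= E by apply: sumr_ge0 => i _; apply: addr_ge0.
have Qn0 n : 0 < Q ^+ n by apply: exprn_gt0; apply: lt_trans Q1.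
(* The gap [l] between [be] and the remainders has to outweigh the factor [Q ^+ n0] of the test
   polynomials and the total excess [E] of the [e i]. *)
have [l hl] : exists l, Q ^+ n0 * E <= ep * Q ^+ l.
  have [N hN] : exists N : nat, Q ^+ n0 * E / ep < N%:R.
    exists (Num.bound `|Q ^+ n0 * E / ep|).
    by apply: le_lt_trans (ler_norm _) _; apply: archi_boundP.
  have [l hl] : exists l, N%:R <= Q ^+ l.
    have del : 0 < Q - 1 by rewrite subr_gt0.
    have [M hM] : exists M : nat, N%:R / (Q - 1) < M%:R.
      exists (Num.bound `|N%:R / (Q - 1)|).
      by apply: le_lt_trans (ler_norm _) _; apply: archi_boundP.
    exists M; move: hM; rewrite ltr_pdivrMr // => /ltW hM; apply: le_trans hM _.
    elim: (M) => [|m IH]; first by rewrite mul0r ler01.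
    have Qm1 : 1 <= Q ^+ m by apply: exprn_ege1; apply: ltW.
    rewrite -natr1 exprS; move: (Q ^+ m) IH Qm1 => y IH Qm1; move: m%:R IH => mm IH.
    have : 0 <= (Q - 1) * (y - 1) by apply: mulr_ge0; [exact: ltW | rewrite subr_ge0].
    lra.
  by exists l; move: hN; rewrite ltr_pdivrMr // => h; apply: le_trans (ltW h) _; rewrite mulrC ler_pM2l.
(* One coefficient more than the [#|I| * l] digits to be matched forces a collision. *)
pose kk := (#|I| * l).+1; pose s := (n0 + kk)%N.
have [P P0 hP] := common_multiple_bounded_size s; exists P => // x [be be0 [c hc]].
have [d sbe] : exists d, size be = d.+1.
  by exists (size be).-1; rewrite prednK // lt0n size_poly_eq0.
pose pl (g : {ffun 'I_kk -> k}) : {poly k} :=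
  \poly_(i < kk) (if insub i is Some i' then g i' else 0).
have pl_inj : injective pl.
  move=> g g' /polyP h; apply/ffunP => i; have := h i.
  by rewrite !coef_poly ltn_ord !valK.
(* The top [l] coefficients of each remainder, below index [d]. If [l > d], truncated subtraction
   repeats index 0, and equal digits mean equal remainders. *)
pose dig (g : {ffun 'I_kk -> k}) : {ffun I * 'I_l -> k} :=
  [ffun ij : I * 'I_l => ((pl g * c ij.1) %% be)`_(d - ij.2.+1)].
have [g1 [g2 [g12 dg]]] : exists g1 g2, g1 != g2 /\ dig g1 = dig g2.
  have : ~~ injectiveb dig.
    apply/injectiveP => /leq_card; rewrite !card_ffun card_prod !card_ord.
    by rewrite leq_exp2l ?card_finNzRing_gt1 // ltnn.
  by move=> /injectivePn[g1 [g2 h1 h2]]; exists g1, g2.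
pose b := pl g1 - pl g2.
have b0 : b != 0 by rewrite subr_eq0; apply: contra_neq g12 => /pl_inj.
have sb : (size b <= kk)%N.
  by rewrite (leq_trans (size_polyD _ _)) // geq_max size_polyN !size_poly.
pose rr i := (b * c i) %% be; pose gg i := (b * c i) %/ be.
have srr i : (size (rr i) <= d - l)%N.
  apply/leq_sizeP => m dm; have [md|md] := ltnP m d; last first.
    apply: nth_default; apply: leq_trans md; rewrite -ltnS -sbe.
    by rewrite ltn_modp.
  have jl := ar1 _ _ _ dm md.
  have /ffunP/(_ (i, Ordinal jl)) := dg; rewrite !ffunE /=.
  rewrite (ar2 _ _ md).
  by rewrite /rr /b mulrBl modpD modpN coefB => ->; rewrite subrr.
have [z zE] : exists z, z = act b x - \sum_i act (gg i) (e i) by eexists.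
have hz : act be z = \sum_i act (rr i) (e i).
  rewrite zE actrB -actM mulrC actM hc !act_sum -sumrB; apply: eq_bigr => i _.
  rewrite -!actM -actB; congr (act _ _).
  by rewrite /rr {1}(divp_eq (b * c i) be) -/(gg i) (mulrC be) addrAC subrr add0r.
have hbz (b'' : {poly k}) : (size b'' <= n0)%N -> D (act b'' z) <= ep.
  move=> sb''.
  have h1 := D_ge (act b'' z) sbe; rewrite -actM (mulrC be) actM hz act_sum in h1.
  have Dsum : D (\sum_i act b'' (act (rr i) (e i))) <= \sum_i D (act b'' (act (rr i) (e i))).
    apply: (big_ind2 (fun u v => D u <= v)) => [|u1 v1 u2 v2 hu hv|//]; first by rewrite D0.
    by apply: le_trans (DD _ _) _; apply: lerD.
  have hi i : Q ^+ l * D (act b'' (act (rr i) (e i))) <= Q ^+ (n0 + d) * (D (e i) + C).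
    have DC0 : 0 <= D (e i) + C by apply: addr_ge0.
    rewrite -actM; have [r0|r0] := eqVneq (rr i) 0.
      by rewrite r0 mulr0 act0 D0 mulr0 mulr_ge0 // ltW.
    have ld : (l <= d)%N.
      have : (0 < size (rr i))%N by rewrite lt0n size_poly_eq0.
      by move=> h; apply: ar3 h (srr i).
    have sz : (size (b'' * rr i)%R <= (n0 + (d - l)).+1)%N.
      apply: leq_trans (size_polyMleq _ _) _.
      exact: ar4 sb'' (srr i).
    have := D_le (e i) sz => h; rewrite -[in (n0 + d)%N](subnKC ld) addnCA exprD -mulrA.
    by rewrite ler_pM2l.
  have : Q ^+ l * (Q ^+ d * D (act b'' z)) <= Q ^+ (n0 + d) * E.
    apply: le_trans (ler_wpM2l (ltW (Qn0 l)) (le_trans h1 Dsum)) _.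
    by rewrite mulr_sumr /E mulr_sumr; apply: ler_sum => i _; apply: hi.
  rewrite mulrCA exprD (mulrC (Q ^+ n0)) -mulrA ler_pM2l // => h.
  by rewrite -(ler_pM2r (Qn0 l)) mulrC; apply: le_trans h hl.
have [b1 [b10 sb1 hb1]] := small z hbz.
have sb1b : (size (b1 * b)%R <= s)%N.
  by apply: leq_trans (size_polyMleq _ _) _; apply: leq_trans (leq_pred _) (leq_add sb1 sb).
have [b' PE] := hP (b1 * b) (mulf_neq0 b10 b0) sb1b.
exists (fun i => b' * b1 * gg i); rewrite PE mulrA !actM.
have -> : act b x = z + \sum_i act (gg i) (e i) by rewrite zE subrK.
rewrite !actDr hb1 actr0 add0r !act_sum; apply: eq_bigr => i _.
by rewrite -!actM.
Qed.
End Dirichlet.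

(** * The points of a Drinfeld module *)

Section DrinfeldPoints.
Variables (R : realType) (p : nat) (Fq : finFieldType).
Variables (F : fieldType) (jF : {rmorphism Fq -> F}) (oo : F -> int).
Variables (K : fieldType) (j : {rmorphism Fq -> K}).
Hypotheses (hp : p \in [pchar K]) (hK : countable [set: K]).
Variables (U : set (K -> int)) (d : (K -> int) -> R) (hU : good_set U d).
Variables (Kper : fieldType) (e : {rmorphism K -> Kper}) (hper : is_perfect_closure p e).
Local Notation A := (curve_ring oo).
Variables (i0 : {rmorphism A -> K}) (phi : {rmorphism A -> twpoly j}).
Hypothesis hphi : forall a, twcoef (phi a) 0 = i0 a.
Hypothesis phi_inj : forall a, phi a = 0 -> a = 0.
Variables (t : A) (r : nat).
Hypotheses (r0 : (0 < r)%N) (ht : twsize (phi t) = r.+1).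

Local Notation V := (drinfeld_points phi e).
Local Notation value := (poly_value (curve_constant jF oo) t).
Local Notation q := #|Fq|.
Local Notation c := (twcoef (phi t)).

Let q1 : (1 < q)%N. Proof. exact: card_finNzRing_gt1. Qed.
Let cr0 : c r != 0. Proof. exact: twcoef_lead_neq0. Qed.

Hypothesis bad : exists v i, [/\ U v, (i <= r)%N &
  alpha q (fun i => e (c i)) (perfect_val R hper v) (shift R q r c v) i < 0].

Definition point_act (b : {poly Fq}) (x : Kper) : Kper := value b *: (x : V).
Definition point_const (s : Fq) : Kper := e (i0 (curve_constant jF oo s)).

Lemma scale_t (x : V) : t *: x = add_op q r (fun i => e (c i)) x :> Kper.
Proof.
rewrite -[t *: x]/(tweval e (phi t) x) (@tweval_widen _ _ _ _ e r.+1) //.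
by rewrite -[size _]/(twsize (phi t)) ht.
Qed.

Lemma scale_const s (x : V) : curve_constant jF oo s *: x = point_const s * x :> Kper.
Proof.
rewrite -[_ *: x]/(tweval e (phi (curve_constant jF oo s)) x).
rewrite (@tweval_widen _ _ _ _ e 1); last first.
  rewrite -[size _]/(twsize _); have [->|s0] := eqVneq s 0.
    by rewrite !rmorph0 /twsize size_poly0.
  by rewrite twsize_constant.
by rewrite big_ord1 expn0 expr1 hphi.
Qed.

Lemma point_actD b b' x : point_act (b + b') x = point_act b x + point_act b' x.
Proof. by rewrite /point_act rmorphD scalerDl. Qed.
Lemma point_actDr b x y : point_act b (x + y) = point_act b x + point_act b y.
Proof. exact: (scalerDr (value b) (x : V) y). Qed.
Lemma point_actM b b' x : point_act (b * b') x = point_act b (point_act b' x).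
Proof. by rewrite /point_act rmorphM scalerA. Qed.
Lemma point_actB b b' x : point_act (b - b') x = point_act b x - point_act b' x.
Proof. by rewrite /point_act rmorphB scalerBl. Qed.
Lemma point_actMX b s x : point_act (b * 'X + s%:P) x =
  point_act b (add_op q r (fun i => e (c i)) x) + point_const s * x.
Proof.
rewrite point_actD point_actM; congr (_ + _).
  by congr (point_act b _); rewrite /point_act poly_valueX scale_t.
by rewrite /point_act poly_valueC scale_const.
Qed.
Lemma point_actXM b x : point_act ('X * b) x = add_op q r (fun i => e (c i)) (point_act b x).
Proof. by rewrite point_actM {1}/point_act poly_valueX scale_t. Qed.
Lemma point_const0 : point_const 0 = 0.
Proof. by rewrite /point_const !rmorph0. Qed.
Lemma point_const_neq0 s : s != 0 -> point_const s != 0.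
Proof.
move=> s0; rewrite fmorph_eq0 -hphi; apply: twcoef_lead_neq0; exact: twsize_constant.
Qed.
Lemma w_point_const v s : U v -> s != 0 -> perfect_val R hper v (point_const s) = 0.
Proof.
move=> Uv s0; have hv := U_valuation hU Uv; rewrite (perfect_val_base R hp hper hv).
by rewrite (valuation_finField (i0 \o curve_constant jF oo) s hv).
Qed.

Lemma point_bounded_denominators (I : finType) (f : I -> Kper) : exists2 P : {poly Fq}, P != 0 &
  forall x, (exists2 b : {poly Fq}, b != 0 & exists g : I -> {poly Fq},
               point_act b x = \sum_i point_act (g i) (f i)) ->
  exists g : I -> {poly Fq}, point_act P x = \sum_i point_act (g i) (f i).
Proof.
have hQ := Q_gt1 q1 r0 R.
apply: (bounded_denominators point_actD point_actDr point_actM hQ (C := total_mu hper U d q r c)).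
- exact: (excess0 hp hper hU q r c).
- exact: (excess_ge0 hp hper hU q r c).
- exact: (total_mu_ge0 hp hper hU q r c).
- exact: (excessD hp hper hU q r c).
- exact: (excess_act_ge hp hU q1 r0 cr0 point_actMX point_actB point_const0
    point_const_neq0 w_point_const).
- exact: (excess_act_le hp hU q1 r0 cr0 point_actMX point_actB point_const0 w_point_const).
- exact: (small_excess_torsion hp hU q1 r0 cr0 point_actXM point_actB bad q1).
Qed.

(** Two powers of [t] agree modulo [a] because the quotient is finite; their difference is the
    multiple. *)
Lemma value_multiple (a : A) : a != 0 -> exists2 b : {poly Fq}, b != 0 & exists a', value b = a * a'.
Proof.
move=> a0; have [s hs] := finite_quotient phi_inj r0 ht a0.
have {}hs n : exists y, y \in s /\ exists z, t ^+ n - y = a * z.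
  by have [y ys h] := hs (t ^+ n); exists y.
have [g hg] := choice hs.
have : ~~ uniq (map g (iota 0 (size s).+1)).
  apply/negP => ug; have : (size (map g (iota 0 (size s).+1)) <= size s)%N.
    by apply: uniq_leq_size => // _ /mapP[k _ ->]; have [] := hg k.
  by rewrite size_map size_iota ltnn.
move=> /(uniqPn 0); rewrite size_map size_iota => -[i [k [ik kS]]].
rewrite !(nth_map 0%N) ?size_iota ?(ltn_trans ik) // !nth_iota ?(ltn_trans ik) //.
rewrite !add0n => gik; exists ('X^i - 'X^k).
  rewrite subr_eq0; apply/eqP => /(congr1 (fun P : {poly Fq} => size P)).
  by rewrite !size_polyXn => -[] /eqP; rewrite ltn_eqF.
have [_ [z hz]] := hg i; have [_ [z' hz']] := hg k; exists (z - z').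
by rewrite rmorphB !rmorphXn /= poly_valueX mulrBr -hz -hz' gik; ring.
Qed.

Lemma value_generators : exists s : seq A, forall x, exists b : 'I_(size s) -> {poly Fq},
  x = \sum_l value (b l) * s`_l.
Proof.
have [s hs] := finitely_generated_over_powers phi_inj r0 ht; exists s; apply: hs.
- move=> x xs; have xi : (index x s < size s)%N by rewrite index_mem.
  exists (fun l => (l == Ordinal xi)%:R); rewrite (bigD1 (Ordinal xi)) //= eqxx rmorph1 mul1r.
  rewrite nth_index // big1 ?addr0 // => l /negPf->.
  by rewrite rmorph0 mul0r.
- move=> x y [b ->] [b' ->]; exists (fun l => b l + b' l).
  by rewrite -big_split; apply: eq_bigr => l _; rewrite rmorphD mulrDl.
- move=> x [b ->]; exists (fun l => 'X * b l); rewrite mulr_sumr; apply: eq_bigr => l _.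
  by rewrite rmorphM /= poly_valueX mulrA.
Qed.

Lemma value_neq0 b : b != 0 -> value b != 0.
Proof.
move=> b0; apply/eqP => vb; have := twsize_poly_value jF r0 ht b0.
by rewrite vb rmorph0 /twsize size_poly0.
Qed.

(** Passage from polynomials in [t] to [A]: the products of generators of [A] with the [f k] span
    the same module, and [value_multiple] turns the coefficient of [x] into a polynomial in [t]. *)
Lemma dependent_bounded_denominators (f : nat -> V) n : exists2 P : {poly Fq}, P != 0 &
  forall x, dependent f n x -> exists g : nat -> A, value P *: x = \sum_(k < n) g k *: f k.
Proof.
have [s hs] := value_generators.
have [P P0 hP] := point_bounded_denominators (fun kl : 'I_n * 'I_(size s) => s`_kl.2 *: f kl.1).
exists P => // x [a a0 [g ax]].
have [b b0 [a' ba]] := value_multiple a0.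
have [h hh] := choice (fun k : nat => hs (a' * g k)).
have [|g' hg'] := hP x.
  exists b => //; exists (fun kl : 'I_n * 'I_(size s) => h kl.1 kl.2).
  rewrite /point_act ba mulrC -scalerA ax scaler_sumr.
  rewrite -(pair_big xpredT xpredT (fun (k : 'I_n) (l : 'I_(size s)) => value (h k l) *: (s`_l *: f k))) /=.
  apply: eq_bigr => k _; rewrite scalerA hh scaler_suml; apply: eq_bigr => l _.
  by rewrite scalerA.
exists (fun k => if insub k is Some k' then \sum_l value (g' (k', l)) * s`_l else 0).
rewrite -[LHS]/(point_act P x) hg'.
transitivity (\sum_(kl : 'I_n * 'I_(size s)) value (g' (kl.1, kl.2)) *: (s`_kl.2 *: f kl.1)).
  by apply: eq_bigr => -[].
rewrite -(pair_big xpredT xpredT (fun (k : 'I_n) (l : 'I_(size s)) => value (g' (k, l)) *: (s`_l *: f k))) /=.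
apply: eq_bigr => k _; rewrite valK scaler_suml; apply: eq_bigr => l _.
by rewrite scalerA.
Qed.

Lemma finite_annihilated (a : A) : a != 0 -> finite_set [set x : V | a *: x = 0].
Proof.
move=> a0; pose P : {poly Kper} := \sum_(n < twsize (phi a)) e (twcoef (phi a) n) *: 'X^(q ^ n).
have Px x : P.[x] = a *: (x : V).
  rewrite -[a *: _]/(tweval e (phi a) x) /tweval horner_sum; apply: eq_bigr => n _.
  by rewrite hornerZ hornerXn.
have [m sa] : exists m, twsize (phi a) = m.+1.
  have : twsize (phi a) != 0%N by rewrite twsize0; apply: contraNneq a0 => /phi_inj ->.
  by case: (twsize _) => // m _; exists m.
have P0 : P != 0.
  apply/eqP => /polyP/(_ (q ^ m)%N); rewrite /P sa coef_sum coef0 big_ord_recr /=.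
  rewrite coefZ coefXn eqxx mulr1 big1 ?add0r => [/eqP|k _].
    by rewrite fmorph_eq0 (negPf (twcoef_lead_neq0 sa)).
  by rewrite coefZ coefXn eqn_exp2l // gtn_eqF ?mulr0.
apply/finite_seqP.
have [|s [_ hs]] := @bounded_set_enum Kper (fun x => P.[x] = 0) (size P).
  move=> s us hs; apply: ltnW; apply: max_poly_roots => //.
  by apply/allP => x /hs /rootP.
by exists s; apply/seteqP; split=> x /=; rewrite -Px => /hs.
Qed.

(* Otherwise a nonzero [a] would map [Kper] into one [K^(1/p^m)], against the unbounded
   denominators of the valuations. *)
Lemma infinite_rank (f : nat -> V) n : exists x, ~ dependent f n x.
Proof.
apply: contrapT => H; have {}H x : dependent f n x by apply: contrapT => hx; apply: H; exists x.
have [P P0 hP] := dependent_bounded_denominators f n.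
pose level m (x : Kper) := exists a, x ^+ (p ^ m) = e a.
have levelD m x y : level m x -> level m y -> level m (x + y).
  move=> [a xa] [b yb]; exists (a + b); by rewrite (perfect_frobD e hp) xa yb rmorphD.
have level0 m : level m 0.
  exists 0; rewrite rmorph0 expr0n gtn_eqF // expn_gt0 prime_gt0 //; exact: pcharf_prime hp.
have levelZ m (a : A) (x : V) : level m x -> level m (a *: x).
  move=> [b xb]; rewrite -[a *: x]/(tweval e (phi a) x) /tweval.
  apply: (big_ind (level m)) => // [y z|l _]; first exact: levelD.
  exists (twcoef (phi a) l ^+ (p ^ m) * b ^+ (q ^ l)).
  by rewrite exprMn rmorphM !rmorphXn -xb -!exprM (mulnC (p ^ m)%N).
have [m hm] : exists m, forall k, (k < n)%N -> level m (f k).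
  elim: (n) => [|l [m hm]]; first by exists 0%N.
  have h := perfect_levelE hper (f l); set na := perfect_level hper (f l) in h.
  exists (maxn m na.1) => k; rewrite ltnS leq_eqVlt => /predU1P[->|/hm[a fa]].
    by eexists; apply: perfect_levelW h; rewrite leq_maxr.
  by eexists; apply: perfect_levelW fa; rewrite leq_maxl.
have hlevel (x : V) : level m (value P *: x).
  have [g ->] := hP x (H x); apply: (big_ind (level m)) => // [y z|k _]; first exact: levelD.
  by apply: levelZ; apply: hm.
have [v [_ [Uv _ _]]] := bad; have hv := U_valuation hU Uv.
pose w := perfect_val R hper v; have hw : real_valuation w by apply: (w_valuation hp hper hU Uv).
have [_ _ _ /(_ (-1)) [y y0 vy]] := hv.
pose s := shift R q r c v; pose M0 := mu q r (fun i => e (c i)) w s.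
(* [e y ^+ c0] has value [- c0], far enough out for the operator to scale values exactly. *)
pose c0 := Num.bound `|s - M0|.
have hc0 : s - M0 < c0%:R by apply: le_lt_trans (ler_norm _) (archi_boundP (normr_ge0 _)).
pose N := (size P).-1; have sP : size P = N.+1 by rewrite prednK // lt0n size_poly_eq0.
(* Two points whose values differ by [1 / p ^ B] have images whose values differ by [Q ^ N / p ^ B].
   As [B < p ^ B], this is positive and less than [1 / p ^ m], yet the values of both images are
   multiples of [1 / p ^ m]. *)
pose B := ((q ^ r) ^ N * p ^ m)%N.
have p1 : (1 < p)%N by apply: prime_gt1; apply: pcharf_prime hp.
have hB : (B < p ^ B)%N by apply: ltn_expl.
have [y1 hy1] : exists y1 : Kper, y1 ^+ (p ^ B) = e y.
  have [root _] := hper; elim: (B) (e y) => [|b IH] z; first by exists z; rewrite expr1.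
  by have [z' hz'] := root z; have [z'' hz''] := IH z'; exists z''; rewrite expnSr exprM hz''.
have ey0 : e y != 0 by rewrite fmorph_eq0.
have y10 : y1 != 0.
  apply: contraNneq ey0 => y10; rewrite -hy1 y10 expr0n gtn_eqF // expn_gt0 ltnW //.
have wy : w (e y) = -1 by rewrite /w (perfect_val_base R hp hper hv) vy.
have pB : 0 < (p ^ B)%:R :> R by rewrite ltr0n expn_gt0 ltnW.
have pm : 0 < (p ^ m)%:R :> R by rewrite ltr0n expn_gt0 ltnW.
have wy1 : w y1 = - (p ^ B)%:R^-1 by rewrite /w (perfect_valE R hp hper hv hy1) vy mulN1r.
have exact x : x != 0 -> w x + s < M0 -> exists k : int,
    ((q ^ r) ^ N)%:R * (w x + s) - s = k%:~R / (p ^ m)%:R.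
  have ear0 : (fun i => e (c i)) r != 0 by rewrite fmorph_eq0.
  move=> x0 hx; have [nz] := act_exact q1 r0 ear0 hw (w_lead hp hper hU c q1 r0 Uv)
    point_actMX (act0 point_actB) point_const0 point_const_neq0 (fun s => w_point_const Uv) sP x0 hx.
  have [a ha] := hlevel x; rewrite /lam -natrX -/s => h2; exists (v a).
  by rewrite -(perfect_valE R hp hper hv ha) -h2 addrK /w.
have [k1 h1] : exists k : int, ((q ^ r) ^ N)%:R * (- c0%:R + s) - s = k%:~R / (p ^ m)%:R.
  have := exact (e y ^+ c0); rewrite expf_neq0 // (rvalX hw) // wy mulNrn; apply=> //; lra.
have [k2 h2] : exists k : int,
    ((q ^ r) ^ N)%:R * (- c0%:R - (p ^ B)%:R^-1 + s) - s = k%:~R / (p ^ m)%:R.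
  have := exact (e y ^+ c0 * y1); rewrite mulf_neq0 ?expf_neq0 // (rvalM hw) ?expf_neq0 //.
  rewrite (rvalX hw) // wy wy1 mulNrn; apply=> //.
  have : 0 < (p ^ B)%:R^-1 :> R by rewrite invr_gt0.
  lra.
have h3 : ((k1 - k2)%:~R : R) = B%:R / (p ^ B)%:R.
  have h4 : ((q ^ r) ^ N)%:R / (p ^ B)%:R = (k1 - k2)%:~R / (p ^ m)%:R :> R.
    by rewrite rmorphB mulrBl -h1 -h2; ring.
  by rewrite /B natrM mulrAC h4 divfK // gt_eqF.
have b1 : (k1 - k2)%:~R < 1 :> R by rewrite h3 ltr_pdivrMr // mul1r ltr_nat.
have b0 : 0 < (k1 - k2)%:~R :> R.
  by rewrite h3 divr_gt0 // ltr0n muln_gt0 !expn_gt0 (ltnW p1) (ltnW q1).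
move: b1 b0; rewrite -[1]/(1%:~R) ltr_int ltr0z; lia.
Qed.

Theorem drinfeld_points_structure : exists T M : set V,
  [/\ torsion_submodule T, finite_set T, free_submodule_aleph0 M & is_direct_sum T M].
Proof.
apply: (finite_torsion_plus_free (@curve_incl_inj F oo)).
- exact: (finite_quotient phi_inj r0 ht).
- exact: curve_ring_completely_integrally_closed.
- exact: (perfect_closure_countable hp hper hK).
- exact: infinite_rank.
- move=> f n; have [P P0 hP] := dependent_bounded_denominators f n.
  by exists (value P) => //; apply: value_neq0.
- exact: finite_annihilated.
Qed.
End DrinfeldPoints.

(** * Existence of a bad place *)

Section Constants.
Variables (R : realType) (K : fieldType) (U : set (K -> int)) (d : (K -> int) -> R).
Hypothesis hU : good_set U d.

Lemma constantsP x : constants U x <-> (forall v, U v -> v x = 0).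
Proof.
split=> [[->|[_ //]]|h]; first by move=> v /(U_valuation hU)[].
by have [->|x0] := eqVneq x 0; [left | right].
Qed.

Lemma constants_closed : GRing.divring_closed (mem (constants U)).
Proof.
have hv v : U v -> is_valuation v := fun Uv => U_valuation hU Uv.
split.
- by apply/asboolP/constantsP => v /hv /valuation1.
- move=> x y /asboolP/constantsP hx /asboolP/constantsP hy; apply/asboolP/constantsP.
  have [->|xy0] := eqVneq (x - y) 0; first by move=> v /hv[].
  apply: (nonneg_constant hU xy0) => v Uv.
  have [y0|y0] := eqVneq y 0; first by rewrite y0 subr0 hx.
  have vNy : v (- y) = 0.
    by rewrite -mulN1r (valuationM (hv v Uv)) ?oppr_eq0 ?oner_neq0 // valuationN1 ?hy //; apply: hv.
  have [x0|x0] := eqVneq x 0; first by rewrite x0 sub0r vNy.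
  have [_ _ h _] := hv v Uv; apply: le_trans (h x (- y) x0 _ xy0); last by rewrite oppr_eq0.
  by rewrite hx // vNy minxx.
- move=> x y /asboolP/constantsP hx /asboolP/constantsP hy; apply/asboolP/constantsP => v Uv.
  have [x0|x0] := eqVneq x 0; first by rewrite x0 mul0r; have [] := hv v Uv.
  have [y0|y0] := eqVneq y 0; first by rewrite y0 invr0 mulr0; have [] := hv v Uv.
  by rewrite (valuationM (hv v Uv)) ?invr_eq0 // (valuationV (hv v Uv)) // hx // hy.
Qed.
End Constants.

Lemma image_divring_closed (K L : fieldType) (f : {rmorphism K -> L}) (E : set K) :
  GRing.divring_closed (mem E) -> GRing.divring_closed (mem (f @` E)).
Proof.
move=> [/asboolP h1 hB hV]; split.
- by apply/asboolP; exists 1; rewrite ?rmorph1.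
- move=> _ _ /asboolP[x Ex <-] /asboolP[y Ey <-]; apply/asboolP; exists (x - y); last exact: rmorphB.
  by apply/asboolP; apply: hB; apply/asboolP.
- move=> _ _ /asboolP[x Ex <-] /asboolP[y Ey <-]; apply/asboolP.
  exists (x / y); last exact: fmorph_div.
  by apply/asboolP; apply: hV; apply/asboolP.
Qed.

Lemma has_trdeg_algebraic (F : fieldType) (k E : set F) :
  (forall x, E x -> algebraic_over k x) -> has_trdeg k E 0.
Proof.
move=> hE; exists set0; last by rewrite II0.
split=> //.
  case=> [|n] x _ Bx P _; last by case: (Bx ord0).
  have PE : P = mpoly.mpolyC 0 (mpoly.mcoeff (mpoly.Multinom [tuple]) P).
    apply/mpoly.mpolyP => m; rewrite mpoly.mcoeffC.
    have -> : m = mpoly.Multinom [tuple] by apply/mpoly.mnmP => -[].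
    have -> : mpoly.Multinom [tuple] == mpoly.mnm0 by apply/eqP/mpoly.mnmP => -[].
    by rewrite mulr1.
  by rewrite PE mpoly.mevalC => ->; rewrite mpoly.mpolyC0.
move=> x Ex; have [P P0 [kP Px]] := hE x Ex; exists P => //; split=> // i.
by move=> S [_]; apply; left.
Qed.

Section BadPlace.
Variables (R : realType) (Fq : finFieldType) (A : comNzRingType).
Variables (K : fieldType) (j : {rmorphism Fq -> K}).
Variables (U : set (K -> int)) (d : (K -> int) -> R) (hU : good_set U d).
Variables (Ka : closedFieldType) (ja : {rmorphism K -> Ka}).
Variables (phi : {rmorphism A -> twpoly j}) (t : A) (r : nat).
Hypotheses (r0 : (0 < r)%N) (ht : twsize (phi t) = r.+1).
Local Notation q := #|Fq|.
Local Notation c := (twcoef (phi t)).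

Lemma twcoef_twconstM (f : twpoly (ja \o j)) (x : Ka) n : twcoef (twconst _ x * f) n = x * twcoef f n.
Proof.
rewrite twcoefM (bigD1 ord0) //= subn0 expn0 expr1 {1}/twcoef /twconst coefC eqxx big1 ?addr0 //.
by move=> m /negPf m0; rewrite {1}/twcoef coefC -[_ == _]/(m == ord0) m0 mul0r.
Qed.

Lemma twcoef_Mtwconst (f : twpoly (ja \o j)) (x : Ka) n :
  twcoef (f * twconst _ x) n = twcoef f n * x ^+ (q ^ n).
Proof.
rewrite twcoefM (bigD1 ord_max) //= subnn {2}/twcoef /twconst coefC eqxx big1 ?addr0 //.
move=> m mn; rewrite {2}/twcoef coefC subn_eq0 leqNgt ltn_neqAle -ltnS ltn_ord andbT.
by rewrite -[_ == n]/(m == ord_max) mn /= (frob0 Fq) mulr0.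
Qed.

Lemma twcoef_conjugate (ga : Ka) a n : ga != 0 ->
  twcoef (conjugate ja phi ga a) n = ja (twcoef (phi a) n) * ga ^+ (q ^ n).-1.
Proof.
move=> ga0; rewrite /conjugate twcoef_Mtwconst twcoef_twconstM /twmap.
have -> : twcoef (map_poly ja (phi a) : twpoly (ja \o j)) n = ja (twcoef (phi a) n).
  by rewrite /twcoef coef_map.
by rewrite -[in ga ^+ (q ^ n)](prednK (q_gt0 Fq n)) exprS mulrACA mulVf // mul1r.
Qed.

(* The coefficients of the conjugate of [phi a] are algebraic over those of the conjugate of
   [phi t]: compare the two products of these commuting operators from the top. *)
Lemma conjugate_coef_algebraic (k : set Ka) (hk : GRing.divring_closed (mem k)) (ga : Ka) :
  ga != 0 -> ja (c r) * ga ^+ (q ^ r).-1 = 1 ->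
  (forall i, (i <= r)%N -> algebraic_over k (ja (c i) * ga ^+ (q ^ i).-1)) ->
  forall a n, algebraic_over k (ja (twcoef (phi a) n) * ga ^+ (q ^ n).-1).
Proof.
move=> ga0 lead1 halg a; pose C a n := ja (twcoef (phi a) n) * ga ^+ (q ^ n).-1.
pose S := subfield_pred (algebraic_over_closed hk).
have SP x : x \in S <-> algebraic_over k x by split => [/asboolP|h]; last apply/asboolP.
have Cprod b b' N : C (b * b') N = \sum_(m < N.+1) C b m * C b' (N - m)%N ^+ (q ^ m).
  rewrite /C rmorphM twcoefM rmorph_sum mulr_suml; apply: eq_bigr => m _ /=.
  rewrite rmorphM rmorphXn exprMn -exprM /=.
  have -> : ((q ^ N).-1 = (q ^ m).-1 + (q ^ (N - m)).-1 * q ^ m)%N.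
    have mN : (m <= N)%N by rewrite -ltnS.
    have := q_gt0 Fq m; have := q_gt0 Fq (N - m); rewrite -[in (q ^ N)%N](subnK mN) expnD.
    move: (q ^ m)%N (q ^ (N - m))%N => x y y0 x0; nia.
  by rewrite exprD mulrACA.
have Ct i : C t i \in S.
  apply/SP; have [ir|ri] := leqP i r; first exact: halg.
  by apply/SP; rewrite /C twcoef_default ?ht // rmorph0 mul0r; apply: rpred0.
have Ct0 i : (r < i)%N -> C t i = 0.
  by move=> ri; rewrite /C twcoef_default ?ht // rmorph0 mul0r.
suff h m n : (twsize (phi a) <= n + m)%N -> C a n \in S.
  by move=> n; apply/SP; apply: (h (twsize (phi a)) n); apply: leq_addl.
elim: m n => [|m IH] n sa.
  by rewrite /C twcoef_default ?rmorph0 ?mul0r ?rpred0 // -[n]addn0.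
have IH' k' : (n < k')%N -> C a k' \in S.
  by move=> nk; apply: IH; apply: leq_trans sa _; rewrite -addSnnS leq_add2r.
(* Since [C t r = 1], the two products contain [C a n ^+ (q ^ r)] and [C a n] in degree [n + r]. The
   other terms involve [C t] and higher [C a] only, so [C a n] is a root of the polynomial [P] with
   algebraic coefficients. *)
have := Cprod a t (n + r)%N; rewrite mulrC Cprod.
have n1 : (n < (n + r).+1)%N by rewrite ltnS leq_addr.
have r1 : (r < (n + r).+1)%N by rewrite ltnS leq_addl.
rewrite (bigD1 (Ordinal r1)) //= addnK [in RHS](bigD1 (Ordinal n1)) //= addKn.
have Ctr : C t r = 1 by [].
rewrite Ctr mul1r expr1n mulr1.
set w1 := \sum_(_ < _ | _) _; set w2 := \sum_(_ < _ | _) _ => eqw.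
have Sw1 : w1 \in S.
  apply: rpred_sum => i ir; have [h|h] := ltnP r i; first by rewrite Ct0 // mul0r rpred0.
  apply: rpredM => //; apply: rpredX; apply: IH'.
  have : (i : nat) != r by apply: contraNneq ir => ir; apply/eqP/val_inj.
  by move: h; lia.
have Sw2 : w2 \in S.
  apply: rpred_sum => i ni; have [h|h] := ltnP n i.
    by apply: rpredM; [apply: IH' | apply: rpredX].
  have ni' : (i : nat) != n by apply: contraNneq ni => ni; apply/eqP/val_inj.
  rewrite [C t _]Ct0 ?(frob0 Fq) ?mulr0 ?rpred0 //; lia.
pose P : {poly Ka} := 'X^(q ^ r) - 'X + (w1 - w2)%:P.
have q1 : (1 < q ^ r)%N by rewrite -[1%N](expn0 q) ltn_exp2l // card_finNzRing_gt1.
have Pq : P`_(q ^ r) = 1.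
  by rewrite coefD coefB coefXn coefX coefC eqxx !gtn_eqF ?(ltnW q1) // subr0 addr0.
apply/SP; apply: (algebraic_over_root hk (P := P)).
- by apply/eqP => P0; move/eqP: Pq; rewrite P0 coef0 eq_sym oner_eq0.
- move=> i; apply/SP; rewrite coefD coefB coefXn coefX coefC.
  apply: rpredD; last by case: eqP => _; rewrite ?rpred0 // rpredB.
  by apply: rpredB; apply: rpred_nat.
- apply/rootP; rewrite /P hornerD hornerD hornerN hornerX hornerC hornerXn.
  have -> : w1 = C a n + w2 - C a n ^+ (q ^ r) by rewrite -eqw addrAC subrr add0r.
  by move: (C a n ^+ _) => y; ring.
Qed.

(** Without a pole, the product formula makes a power of every coefficient of the normalized [phi t]
    constant. The conjugate by [ga] is then defined over an algebraic extension of the constants, so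
    its transcendence degree is 0, against minimality of [n]. *)
Lemma exists_bad_place (n : nat) : relative_modular_trdeg ja phi (constants U) n -> (0 < n)%N ->
  exists v i, [/\ U v, (i <= r)%N &
    c i != 0 /\ (v (c i))%:~R - ((q ^ i)%:R - 1) * shift R q r c v < 0].
Proof.
move=> [_ hn] n0; apply: contrapT => H; move: n0; rewrite ltnNge => /negP; apply.
have q1 : (1 < q)%N by apply: card_finNzRing_gt1.
have cr0 : c r != 0 by apply: twcoef_lead_neq0.
have Q1 := Q_gt1 q1 r0 R.
have qr1 : (0 < (q ^ r).-1)%N.
  by rewrite -ltnS prednK ?q_gt0 // -[1%N](expn0 q) ltn_exp2l.
have [ga hga] : exists ga : Ka, ga ^+ (q ^ r).-1 = (ja (c r))^-1.
  have : size ('X^((q ^ r).-1) - ((ja (c r))^-1)%:P) != 1%N.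
    by rewrite size_XnsubC //; case: (_.-1) qr1.
  move=> /closed_rootP[ga]; rewrite /root !hornerE ?hornerXn subr_eq0 => /eqP h.
  by exists ga.
have jcr0 : ja (c r) != 0 by rewrite fmorph_eq0.
have ga0 : ga != 0.
  apply: contraNneq jcr0 => g0; move/eqP: hga; rewrite g0 expr0n gtn_eqF // eq_sym.
  by rewrite invr_eq0 => /eqP->.
have hk := image_divring_closed ja (constants_closed hU).
apply: (hn ga 0%N ga0); apply: has_trdeg_algebraic.
apply: subfield_generated_min; first exact: algebraic_over_closed.
move=> x [kx|]; first exact: algebraic_over_self.
apply: subfield_generated_min; first exact: algebraic_over_closed.
move=> _ [a [m ->]] /=; rewrite twcoef_conjugate //.
apply: conjugate_coef_algebraic => // [|i ir]; first by rewrite hga divff.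
have [ci0|ci0] := eqVneq (c i) 0.
  rewrite ci0 rmorph0 mul0r; apply: algebraic_over_self => //.
  by exists 0; rewrite ?rmorph0 //; left.
(* The power of exponent [q ^ r - 1] of the normalized coefficient; unlike the coefficient it lies
   in [K], where the valuations of [U] apply. *)
pose z := c i ^+ (q ^ r).-1 / c r ^+ (q ^ i).-1.
have Kz : constants U z.
  apply/(constantsP hU); apply: (nonneg_constant hU).
    by rewrite mulf_neq0 ?invr_eq0 ?expf_neq0.
  move=> v Uv; have hv := U_valuation hU Uv.
  rewrite /z (valuationM hv) ?invr_eq0 ?expf_neq0 // (valuationV hv) ?expf_neq0 //.
  rewrite !(valuationX hv) // subr_ge0.
  have h : 0 <= (v (c i))%:~R - ((q ^ i)%:R - 1) * shift R q r c v.
    by rewrite leNgt; apply/negP => hlt; apply: H; exists v, i.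
  have e1 (y : int) k : (y *+ k)%:~R = y%:~R * k%:R :> R by rewrite rmorphMn mulr_natr.
  rewrite -(ler_int R) !e1 -!subn1 !natrB ?q_gt0 //.
  have Q0 : 0 < (q ^ r)%:R - 1 :> R by rewrite subr_gt0.
  move: h; rewrite subr_ge0 /shift mulrA ler_pdivrMr // => h.
  by rewrite mulrC.
pose P : {poly Ka} := 'X^((q ^ r).-1) - (ja z)%:P.
have hkS : subfield_pred (algebraic_over_closed hk) (ja z).
  by apply/asboolP; apply: algebraic_over_self => //; exists z.
apply: (algebraic_over_root hk (P := P)).
- by rewrite -size_poly_eq0 size_XnsubC.
- move=> l; rewrite coefB coefXn coefC.
  suff : ((l == (q ^ r).-1)%:R - (if l == 0%N then ja z else 0)) \in
      subfield_pred (algebraic_over_closed hk) by move=> /asboolP.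
  by apply: rpredB; [apply: rpred_nat | case: eqP => _ //; rewrite rpred0].
rewrite /root !hornerE ?hornerXn exprMn -exprM mulnC exprM hga subr_eq0 /z.
by rewrite fmorph_div !rmorphXn exprVn.
Qed.
End BadPlace.

Theorem mainTheorem12
  (R : realType) (p : nat) (Fq : finFieldType)
  (* A: functions on a curve over Fq, regular away from the closed point oo *)
  (F : fieldType) (jF : {rmorphism Fq -> F}) (hF : is_function_field jF)
  (oo : F -> int) (hoo : is_valuation oo)
  (* K: a countable field of characteristic p containing Fq *)
  (K : fieldType) (j : {rmorphism Fq -> K})
  (hp : p \in [pchar K]) (hK : countable [set: K])
  (* U: a coherent good set of valuations on K with degrees d *)
  (U : set (K -> int)) (d : (K -> int) -> R)
  (hU : good_set U d) (hUc : coherent_set U d)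
  (* Ka: an algebraic closure of K; Kper: a perfect closure of K *)
  (Ka : closedFieldType) (ja : {rmorphism K -> Ka})
  (hKa : is_algebraic_closure ja)
  (Kper : fieldType) (jper : {rmorphism K -> Kper})
  (hKper : is_perfect_closure p jper)
  (* phi: a Drinfeld module of positive relative modular transcendence degree
     over the field of constants of U *)
  (i : {rmorphism curve_ring oo -> K})
  (phi : {rmorphism curve_ring oo -> twpoly j})
  (hphi : is_drinfeld_module i phi)
  (n : nat) (hn : relative_modular_trdeg ja phi (constants U) n)
  (n_gt0 : (0 < n)%N) :
  exists T M : set (drinfeld_points phi jper),
    [/\ torsion_submodule T, finite_set T, free_submodule_aleph0 M
      & is_direct_sum T M].
Proof.
have [hphi0 [a0 [m [m0 am0]]]] := hphi.
have [t [r [r0 ht]]] : exists t r, (0 < r)%N /\ twsize (phi t) = r.+1.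
  exists a0, (twsize (phi a0)).-1.
  have : (m < twsize (phi a0))%N.
    by rewrite ltnNge; apply: contra_neqN am0 => /twcoef_default ->.
  by case: (twsize _) => [//|r]; rewrite ltnS /= => /(leq_trans m0).
have [v [l [Uv lr [cl0 al]]]] := exists_bad_place hU r0 ht hn n_gt0.
apply: (drinfeld_points_structure jF hp hK hU hphi0 (phi_injective r0 ht hF.2) r0 ht
  (hper := hKper)).
exists v, l; split=> //; rewrite /alpha fmorph_eq0 (negPf cl0).
by rewrite (perfect_val_base R hp hKper (U_valuation hU Uv)).
Qed.
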